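(* Let $X = \mathbb{G}(1,4)\cap H^2$ be a general linear section of codimension $2$ of the Grassmannian $\mathbb{G}(1,4)$ of lines in $\mathbb{P}^4_{\mathbb{C}}$ (under the Plücker embedding), and for a point $x\in X$ let $Z_x\subset \mathbb{P}^1\times\mathbb{P}^2$ be the variety of lines on $X$ passing through $x$. Then for every $x\in X$, $Z_x$ has pure dimension $1$, and its numerical class in $N_1(\mathbb{P}^1\times\mathbb{P}^2)$ is $[Z_x]\equiv 2[L_1]+[L_2]$, where $[L_1]$ is the class of a line in a fiber of the first projection $\mathbb{P}^1\times\mathbb{P}^2\to\mathbb{P}^1$ and $[L_2]$ is the class of a fiber of the second projection $\mathbb{P}^1\times\mathbb{P}^2\to\mathbb{P}^2$. Moreover, for $x$ in each of the four orbits $o_1,o_2,o_3,o_4$ of the action of $\mathrm{Aut}(X)$ on $X$: (1) if $x\in o_1$, then $Z_x$ has exactly two irreducible components, both rational; one of them has numerical class $[L_1]$ (and occurs with multiplicity $2$ in $Z_x$), and the other one has numerical class $[L_2]$; (2) if $x\in o_2$, then $Z_x$ has exactly three irreducible components, all rational; two of them have numerical class $[L_1]$, and the other one has numerical class $[L_2]$; (3) if $x\in o_3$, then $Z_x$ has exactly two irreducible components, both rational; one of them has numerical class $[L_1]$ and the other one has numerical class $[L_1]+[L_2]$; (4) if $x\in o_4$, then $Z_x\cong\mathbb{P}^1$.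
   Context: Everything is over $\mathbb{C}$. For a vector subspace $W\subset\mathbb{C}^{N+1}$, $\mathbb{P}(W)$ is the corresponding linear subspace of $\mathbb{P}^N$, and for $\dim W=2$, $[\mathbb{P}(W)]$ is the corresponding point of $\mathbb{G}(1,N)$, embedded in $\mathbb{P}(\bigwedge^2\mathbb{C}^{N+1})$ by the Plücker embedding. Hyperplanes of $\mathbb{P}(\bigwedge^2\mathbb{C}^{N+1})$ are identified with classes $\mathbb{P}(A)$ of nonzero antisymmetric matrices $A$ of size $N+1$: the point $[\mathbb{P}(\mathrm{span}\{p,q\})]$ lies in the hyperplane $\mathbb{P}(A)^*$ if and only if $pA\,{}^tq=0$ ($p,q$ row vectors). A codimension-$2$ linear subspace $H^2$ is the intersection of two hyperplanes $\mathbb{P}(A)^*$, $\mathbb{P}(B)^*$ with $A,B$ linearly independent, so $X=\{[\mathbb{P}(\mathrm{span}\{p,q\})] : pA\,{}^tq=pB\,{}^tq=0\}$. Generality for $N=4$: $H^2$ is called general if no nonzero matrix $\lambda A-\mu B$ ($(\lambda:\mu)\in\mathbb{P}^1$) has rank $\le 2$, i.e. every such $5\times5$ matrix has corank exactly $1$. In this case the map $(\lambda:\mu)\mapsto\mathbb{P}(\ker(\lambda A-\mu B))\in\mathbb{P}^4$ parametrizes a smooth conic $C\subset\mathbb{P}^4$, called the center conic; let $P\cong\mathbb{P}^2$ be the plane spanned by $C$. The group $\mathrm{Aut}(X)$ is identified with the subgroup of $\mathrm{PGL}(5,\mathbb{C})$ of elements whose induced action preserves $H^2$. It acts on $X$ with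 exactly four orbits: $o_1$ = points $[l]\in X$ with $l$ tangent to $C$; $o_2$ = points $[l]\in X$ with $l\subset P$ and $l$ not tangent to $C$; $o_3$ = points $[l]\in X$ with $l$ meeting $C$ but $l\not\subset P$; $o_4$ = points $[l]\in X$ with $l\cap P=\emptyset$. Variety of lines: a line contained in $\mathbb{G}(1,4)$ through $x=[\mathbb{P}(W)]$ has the form $L_{U,V}=\{[\mathbb{P}(W')]: U\subset W'\subset V\}$ with $U\subset W\subset V$, $\dim U=1$, $\dim V=3$, and is identified with the point $(\mathbb{P}(U),\mathbb{P}(V/W))\in\mathbb{P}(W)\times\mathbb{P}(\mathbb{C}^5/W)\cong\mathbb{P}^1\times\mathbb{P}^2$. $Z_x$ is the closed subscheme of $\mathbb{P}(W)\times\mathbb{P}(\mathbb{C}^5/W)$ of those lines contained in $X$; it is the intersection of the two divisors of type $(1,1)$ given by $uA\,{}^tv=0$ and $uB\,{}^tv=0$, where $u\in W$ and $v\in\mathbb{C}^5/W$ (well defined since $[\mathbb{P}(W)]\in X$). $N_1$ denotes $1$-cycles modulo numerical equivalence; multiplicities are those of the components of the scheme $Z_x$. *)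

(* Defs.v *)
From HB Require Import structures.
From mathcomp Require Import all_boot all_order all_algebra.
From mathcomp Require Import boolp classical_sets reals.
From mathcomp Require Import complex mpoly.

Set Implicit Arguments.
Unset Strict Implicit.
Unset Printing Implicit Defensive.

Import GRing.Theory.
Local Open Scope ring_scope.
Local Open Scope classical_set_scope.

(* [n] is the maximal number of strict inclusions in a chain of members of    *)
(* [P]; this yields both Krull dimension and length.                          *)
Definition has_chain (T : Type) (P : set (set T)) (n : nat) : Prop :=
  exists F : nat -> set T,
    (forall i, (i <= n)%N -> P (F i)) /\
    (forall i, (i < n)%N -> F i `<` F i.+1).

Definition max_chain (T : Type) (P : set (set T)) (n : nat) : Prop :=
  has_chain P n /\ ~ has_chain P n.+1.

Section BiprojectiveGeometry.
Variable K : closedFieldType.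

(* P^1 x P^2 with bihomogeneous coordinate ring K[s_0,s_1;t_0,t_1,t_2]: the   *)
(* first two variables have bidegree (1,0), the last three (0,1).  A point is *)
(* given by any pair (s,t) of nonzero vectors, and a subset of P^1 x P^2 by   *)
(* the set of all pairs representing its points.                              *)
Definition bipoly : Type := {mpoly K[2 + 3]}.

Definition bipoint : Type := 'rV[K]_2 * 'rV[K]_3.

Definition bihomog (d e : nat) (f : {mpoly K[2 + 3]}) : Prop :=
  forall m, m \in msupp f ->
    (\sum_(i < 2) m (lshift 3 i))%N = d /\
    (\sum_(j < 3) m (rshift 2 j))%N = e.

Definition bieval (x : bipoint) (f : {mpoly K[2 + 3]}) : K :=
  f.@[fun i => row_mx x.1 x.2 0 i].

Definition vanishes_on (V : set bipoint) (f : {mpoly K[2 + 3]}) : Prop :=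
  forall x, V x -> bieval x f = 0.

(* A closed subscheme is given by a set of bihomogeneous equations.           *)
Definition zeros (S : set bipoly) : set bipoint :=
  [set x | [/\ x.1 != 0, x.2 != 0 & forall f, S f -> bieval x f = 0]].

Definition closed_subset (Z : set bipoint) : Prop :=
  exists S : set bipoly,
    (forall f, S f -> exists d e, bihomog d e f) /\ Z = zeros S.

Definition irreducible_closed (V : set bipoint) : Prop :=
  [/\ closed_subset V, V !=set0 &
      forall Z1 Z2, closed_subset Z1 -> closed_subset Z2 ->
        V `<=` Z1 `|` Z2 -> V `<=` Z1 \/ V `<=` Z2].

Definition components (Z : set bipoint) : set (set bipoint) :=
  [set V | [/\ irreducible_closed V, V `<=` Z &
      forall V', irreducible_closed V' -> V `<=` V' -> V' `<=` Z -> V' = V]].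

Definition krull_dim (V : set bipoint) (n : nat) : Prop :=
  max_chain [set V' | irreducible_closed V' /\ V' `<=` V] n.

Definition pure_dim (Z : set bipoint) (n : nat) : Prop :=
  Z !=set0 /\ forall V, components Z V -> krull_dim V n.

(* The local ring of P^1 x P^2 at the generic point of V, inside the fraction *)
(* field of the coordinate ring.                                              *)
Definition local_ring (V : set bipoint) : set {fraction {mpoly K[2 + 3]}} :=
  [set q | exists d e f g, [/\ bihomog d e f, bihomog d e g,
     ~ vanishes_on V g & q = tofrac f / tofrac g]].

Definition local_ideal (V : set bipoint)
    (J : set {fraction {mpoly K[2 + 3]}}) : Prop :=
  [/\ J `<=` local_ring V, J 0,
      forall q r, J q -> J r -> J (q + r) &
      forall a q, local_ring V a -> J q -> J (a * q)].

(* The ideals of the local ring at V that contain the stalk of the ideal      *)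
(* sheaf of the subscheme S, i.e. the ideals of O_{S,V}.                      *)
Definition scheme_local_ideals (S : set bipoly) (V : set bipoint)
    : set (set {fraction {mpoly K[2 + 3]}}) :=
  [set J | local_ideal V J /\
     forall d e f g, S f -> bihomog d e f -> bihomog d e g ->
       ~ vanishes_on V g -> J (tofrac f / tofrac g)].

(* The length of O_{S,V}. *)
Definition multiplicity (S : set bipoly) (V : set bipoint) (n : nat) : Prop :=
  max_chain (scheme_local_ideals S V) n.

Definition reduced (S : set bipoly) : Prop :=
  forall x, zeros S x -> forall q k, local_ring [set x] q ->
    (forall J, scheme_local_ideals S [set x] J -> J (q ^+ k)) ->
    forall J, scheme_local_ideals S [set x] J -> J q.

(* Formal integral combinations of irreducible closed subsets. *)
Definition cycle : Type := seq (int * set bipoint).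

Definition fundamental_cycle (S : set bipoly) (c : cycle) : Prop :=
  [/\ uniq [seq t.2 | t <- c],
      forall V, components (zeros S) V <-> V \in [seq t.2 | t <- c] &
      forall t, t \in c ->
        exists2 n : nat, multiplicity S t.2 n & t.1 = n%:Z].

(* The scheme-theoretic intersection of the integral subscheme V with the     *)
(* effective divisor f = 0.                                                   *)
Definition divisor_section (V : set bipoint) (f : {mpoly K[2 + 3]})
    : set bipoly :=
  [set g | (exists d e, bihomog d e g) /\ vanishes_on V g] `|` [set f].

(* (f . V) for an integral curve V not contained in the divisor f = 0: the    *)
(* sum over the points p of the intersection of the lengths of O_{V,p}/(f).   *)
Definition intersection_number (f : {mpoly K[2 + 3]}) (V : set bipoint)
    (n : int) : Prop :=
  exists2 c, fundamental_cycle (divisor_section V f) c & n = \sum_(t <- c) t.1.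

Definition cycle_intersection (f : {mpoly K[2 + 3]}) (c : cycle)
    (n : int) : Prop :=
  exists2 i : set bipoint -> int,
    forall t, t \in c -> intersection_number f t.2 (i t.2) &
    n = \sum_(t <- c) t.1 * i t.2.

Definition meets_properly (f : {mpoly K[2 + 3]}) (c : cycle) : Prop :=
  forall t, t \in c -> ~ vanishes_on t.2 f.

(* Numerical equivalence of 1-cycles.  The effective divisors of P^1 x P^2    *)
(* are the zero schemes of nonzero bihomogeneous polynomials, and every       *)
(* divisor is linearly equivalent to a difference of effective ones           *)
(* containing none of finitely many given curves, so it is enough to test     *)
(* against those.                                                             *)
Definition num_equiv (c c' : cycle) : Prop :=
  forall d e f, bihomog d e f -> meets_properly f c -> meets_properly f c' ->
    exists2 n, cycle_intersection f c n & cycle_intersection f c' n.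

(* A line in the fiber over a of the first projection. *)
Definition fiber_line (L : set bipoint) : Prop :=
  exists (a : 'rV[K]_2) (h : 'cV[K]_3), [/\ a != 0, h != 0 &
    L = [set x | [/\ x.1 != 0, x.2 != 0, (x.1 <= a)%MS & x.2 *m h = 0]]].

(* The fiber over b of the second projection. *)
Definition fiber_pr2 (L : set bipoint) : Prop :=
  exists2 b : 'rV[K]_3, b != 0 &
    L = [set x | [/\ x.1 != 0, x.2 != 0 & (x.2 <= b)%MS]].

Definition same_point (m : nat) (u v : 'rV[K]_m) : Prop :=
  u != 0 /\ exists2 c, c != 0 & v = c *: u.

Definition same_bipoint (x y : bipoint) : Prop :=
  same_point x.1 y.1 /\ same_point x.2 y.2.

Definition P1 : set 'rV[K]_2 := [set u | u != 0].

Definition eval_row (m k : nat) (f : 'I_k -> {mpoly K[m]}) (u : 'rV[K]_m)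
    : 'rV[K]_k := \row_i (f i).@[u 0].

Definition bieval_row (k : nat) (f : 'I_k -> {mpoly K[2 + 3]}) (x : bipoint)
    : 'rV[K]_k := \row_i bieval x (f i).

(* Regular maps, acting on representatives: around each point they are given  *)
(* by forms.  The neighbourhood is where these forms define a point; it can   *)
(* be made arbitrarily small by multiplying them by a further form.           *)
Definition regular_from_P1 (U : set 'rV[K]_2) (F : 'rV[K]_2 -> bipoint)
    : Prop :=
  forall u, U u ->
    exists d e (f : 'I_2 -> {mpoly K[2]}) (g : 'I_3 -> {mpoly K[2]}),
    [/\ (forall i, f i \is d.-homog) /\ (forall j, g j \is e.-homog),
        eval_row f u != 0, eval_row g u != 0 &
        forall u', U u' -> eval_row f u' != 0 -> eval_row g u' != 0 ->
          same_bipoint (eval_row f u', eval_row g u') (F u')].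

Definition regular_to_P1 (Y : set bipoint) (G : bipoint -> 'rV[K]_2) : Prop :=
  forall y, Y y -> exists d e (f : 'I_2 -> {mpoly K[2 + 3]}),
    [/\ forall i, bihomog d e (f i), bieval_row f y != 0 &
        forall y', Y y' -> bieval_row f y' != 0 ->
          same_point (bieval_row f y') (G y')].

(* U and Y are isomorphic as varieties. *)
Definition isomorphic (U : set 'rV[K]_2) (Y : set bipoint) : Prop :=
  exists (F : 'rV[K]_2 -> bipoint) (G : bipoint -> 'rV[K]_2),
    [/\ regular_from_P1 U F, regular_to_P1 Y G,
        forall u, U u -> Y (F u) /\ same_point u (G (F u)) &
        forall y, Y y -> U (G y) /\ same_bipoint y (F (G y))].

Definition open_P1 (U : set 'rV[K]_2) : Prop :=
  exists S : set {mpoly K[2]},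
    (forall f, S f -> exists d, f \is d.-homog) /\
    U = [set u : 'rV[K]_2 | u != 0 /\ exists2 f, S f & f.@[u 0] != 0].

(* V is birational to P^1. *)
Definition rational_curve (V : set bipoint) : Prop :=
  exists U Z, [/\ open_P1 U, U !=set0, closed_subset Z, V `\` Z !=set0 &
    isomorphic U (V `\` Z)].

Definition scheme_isomorphic_P1 (S : set bipoly) : Prop :=
  reduced S /\ isomorphic P1 (zeros S).

End BiprojectiveGeometry.

Section LinearSection.
Variable K : closedFieldType.

(* H^2 is cut out by the hyperplanes P(A)^* and P(B)^*. *)
Definition general_section (A B : 'M[K]_5) : Prop :=
  [/\ A^T = - A, B^T = - B,
      forall l m : K, l *: A + m *: B = 0 -> l = 0 /\ m = 0 &
      forall l m : K, l *: A - m *: B != 0 -> (2 < \rank (l *: A - m *: B)%R)%N].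

(* A point of G(1,4) is the row space of a 2 x 5 matrix of rank 2. *)
Definition in_hyperplane (A : 'M[K]_5) (W : 'M[K]_(2, 5)) : Prop :=
  forall p q : 'rV[K]_5, (p <= W)%MS -> (q <= W)%MS -> p *m A *m q^T = 0.

Definition on_X (A B : 'M[K]_5) (W : 'M[K]_(2, 5)) : Prop :=
  [/\ \rank W = 2%N, in_hyperplane A W & in_hyperplane B W].

Definition center_conic (A B : 'M[K]_5) : set 'rV[K]_5 :=
  [set p | p != 0 /\ exists l m : K,
     (l, m) != (0, 0) /\ p *m (l *: A - m *: B) = 0].

(* The row space of M is contained in the span P of the center conic. *)
Definition in_conic_plane (A B : 'M[K]_5) (k : nat) (M : 'M[K]_(k, 5)) : Prop :=
  forall U : 'M[K]_5,
    (forall p, center_conic A B p -> (p <= U)%MS) -> (M <= U)%MS.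

(* The projective tangent space of C at p consists of the v killed by the     *)
(* differentials at p of all forms vanishing on C.                            *)
Definition tangent_to_conic (A B : 'M[K]_5) (W : 'M[K]_(2, 5)) : Prop :=
  exists p, [/\ center_conic A B p, (p <= W)%MS &
    forall v : 'rV[K]_5, (v <= W)%MS ->
    forall (d : nat) (f : {mpoly K[5]}), f \is d.-homog ->
      (forall c, center_conic A B c -> f.@[c 0] = 0) ->
      \sum_(i < 5) v 0 i * (mderiv i f).@[p 0] = 0].

(* The four orbits of Aut(X), given by their geometric description in terms   *)
(* of the conic C and its plane P.                                            *)
Definition orbit1 (A B : 'M[K]_5) (W : 'M[K]_(2, 5)) : Prop :=
  on_X A B W /\ tangent_to_conic A B W.

Definition orbit2 (A B : 'M[K]_5) (W : 'M[K]_(2, 5)) : Prop :=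
  [/\ on_X A B W, in_conic_plane A B W & ~ tangent_to_conic A B W].

Definition orbit3 (A B : 'M[K]_5) (W : 'M[K]_(2, 5)) : Prop :=
  [/\ on_X A B W, exists2 p, center_conic A B p & (p <= W)%MS &
      ~ in_conic_plane A B W].

Definition orbit4 (A B : 'M[K]_5) (W : 'M[K]_(2, 5)) : Prop :=
  on_X A B W /\
  forall p : 'rV[K]_5, (p <= W)%MS -> in_conic_plane A B p -> p = 0.

(* The (1,1)-form u A v^T for u = s W and v = t N, the rows of W being a      *)
(* basis of the subspace W and those of N inducing one of K^5 / W.            *)
Definition line_form (A : 'M[K]_5) (W : 'M[K]_(2, 5)) (N : 'M[K]_(3, 5))
    : {mpoly K[2 + 3]} :=
  \sum_(i < 2) \sum_(j < 3)
    (W *m A *m N^T) i j *: ('X_(lshift 3 i) * 'X_(rshift 2 j)).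

(* Z_x, for x the row space of W. *)
Definition lines_scheme (A B : 'M[K]_5) (W : 'M[K]_(2, 5)) (N : 'M[K]_(3, 5))
    : set (bipoly K) :=
  [set line_form A W N; line_form B W N].

End LinearSection.

Lemma line_formE (K : closedFieldType) (A : 'M[K]_5) (W : 'M[K]_(2, 5))
    (N : 'M[K]_(3, 5)) (s : 'rV[K]_2) (t : 'rV[K]_3) :
  (bieval (s, t) (line_form A W N))%:M = (s *m W) *m A *m (t *m N)^T.
Proof.
rewrite [RHS]mx11_scalar; congr (_%:M).
rewrite trmx_mul !mulmxA -(mulmxA s W) -(mulmxA s (W *m A)).
rewrite /bieval /line_form rmorph_sum /= mxE.
under eq_bigr do rewrite rmorph_sum /=.
rewrite exchange_big /=.
apply: eq_bigr => j _; rewrite !mxE big_distrl /=; apply: eq_bigr => i _.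
by rewrite mevalZ rmorphM /= !mevalXU row_mxEl row_mxEr mulrCA mulrA.
Qed.

Lemma skew2_eq0 (K : numClosedFieldType) (G : 'M[K]_2) (c : 'rV[K]_2) :
  G^T = - G -> c != 0 -> c *m G = 0 -> G = 0.
Proof.
move=> skG c0 cG.
have Gii i : G i i = 0.
  have /matrixP/(_ i i) := skG; rewrite !mxE => /eqP.
  by rewrite -subr_eq0 opprK -mulr2n Num.Theory.mulrn_eq0 => /eqP.
have l01 : lift 0 0 = 1 :> 'I_2 by exact/val_inj.
have cases (P : 'I_2 -> Prop) : P 0 -> P 1 -> forall i, P i.
  by move=> P0 P1 i; case: (unliftP 0 i) => [j|] -> //; rewrite ord1 l01.
have G10 : G 1 0 = - G 0 1 by have /matrixP/(_ 0 1) := skG; rewrite !mxE.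
have E0 : c 0 1 * G 0 1 = 0.
  have /matrixP/(_ 0 0) := cG; rewrite !mxE !big_ord_recl big_ord0 l01.
  by rewrite Gii mulr0 add0r addr0 G10 mulrN => /eqP; rewrite oppr_eq0 => /eqP.
have E1 : c 0 0 * G 0 1 = 0.
  have /matrixP/(_ 0 1) := cG; rewrite !mxE !big_ord_recl big_ord0 l01.
  by rewrite Gii mulr0 !addr0.
have g0 : G 0 1 = 0.
  apply/eqP; apply: contraNT c0 => g0; apply/eqP/rowP; apply: (cases); rewrite mxE.
    by apply/eqP; move/eqP: E1; rewrite mulf_eq0 (negPf g0) orbF.
  by apply/eqP; move/eqP: E0; rewrite mulf_eq0 (negPf g0) orbF.
apply/matrixP; apply: (cases); apply: (cases); rewrite [RHS]mxE ?Gii ?G10 ?g0 //.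
by rewrite oppr0.
Qed.

(* The points of Z_x are exactly the lines { W' : U <= W' <= V } of G(1,4)     *)
(* through x, with U = <s W> and V = <W, t N>, that are contained in X.       *)
Lemma lines_schemeP (K : numClosedFieldType) (A B : 'M[K]_5)
    (W : 'M[K]_(2, 5)) (N : 'M[K]_(3, 5)) (s : 'rV[K]_2) (t : 'rV[K]_3) :
  A^T = - A -> B^T = - B -> on_X A B W -> col_mx W N \in unitmx ->
  s != 0 -> t != 0 ->
  zeros (lines_scheme A B W N) (s, t) <->
  forall W' : 'M[K]_(2, 5), \rank W' = 2%N ->
    (s *m W <= W')%MS -> (W' <= col_mx W (t *m N))%MS -> on_X A B W'.
Proof.
move=> skA skB [rW hA hB] uWN s0 t0.
have rWv : row_free (col_mx (s *m W) (t *m N)).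
  rewrite -kermx_eq0; apply/eqP/row_matrixP => i; rewrite row0.
  have : row i (kermx (col_mx (s *m W) (t *m N))) *m col_mx (s *m W) (t *m N) = 0.
    by rewrite -row_mul mulmx_ker row0.
  set y : 'rV_(1 + 1) := row i _; rewrite -[y]hsubmxK mul_row_col !mulmxA.
  rewrite -mul_row_col => /(congr1 (mulmx^~ (invmx (col_mx W N)))).
  rewrite /= mulmxK // mul0mx -[0]hsubmxK !linear0 => /eq_row_mx[].
  rewrite [lsubmx y]mx11_scalar [rsubmx y]mx11_scalar !mul_scalar_mx.
  move=> /eqP; rewrite scaler_eq0 (negPf s0) orbF => /eqP ->.
  move=> /eqP; rewrite scaler_eq0 (negPf t0) orbF => /eqP ->.
  by rewrite !raddf0 row_mx0.
have key (D : 'M[K]_5) : D^T = - D -> in_hyperplane D W ->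
    bieval (s, t) (line_form D W N) = 0 <->
    forall W' : 'M[K]_(2, 5), \rank W' = 2%N ->
      (s *m W <= W')%MS -> (W' <= col_mx W (t *m N))%MS -> in_hyperplane D W'.
  move=> skD hD; split=> [H W' rW' sW' W'V|H].
    have uDv : s *m W *m D *m (t *m N)^T = 0.
      by rewrite -line_formE H raddf0.
    have uDr (r : 'rV_5) : (r <= W')%MS -> s *m W *m D *m r^T = 0.
      move=> rW1; have /submxP[x ->] := submx_trans rW1 W'V.
      rewrite -[x]hsubmxK mul_row_col linearD /= mulmxDr.
      rewrite hD ?submxMl // add0r [rsubmx x]mx11_scalar mul_scalar_mx.
      by rewrite linearZ /= -scalemxAr uDv scaler0.
    have /submxP[c defc] := sW'.
    have c0 : c != 0.
      apply: contraNneq s0 => c0.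
      move: rWv; rewrite defc c0 mul0mx => /row_freeP[X].
      rewrite mul_col_mx mul0mx -[RHS]submxK.
      move=> /(congr1 (fun M : 'M_(1+1,1+1) => M 0 0)); rewrite submxK.
      rewrite mxE split1 unlift_none /= !mxE /= => /eqP; rewrite eq_sym oner_eq0 //.
    pose G := W' *m D *m W'^T.
    have skG : G^T = - G.
      by rewrite /G !trmx_mul trmxK skD mulmxA mulmxN mulNmx.
    have cG : c *m G = 0.
      apply/rowP=> k; rewrite [RHS]mxE.
      have := uDr (row k W') (row_sub _ _).
      rewrite defc /G !mulmxA => /matrixP/(_ 0 0); rewrite [RHS]mxE => <-.
      by rewrite !mxE; apply: eq_bigr => j _; rewrite !mxE.
    have G0 : G = 0 := skew2_eq0 skG c0 cG.
    move=> p q /submxP[a ->] /submxP[b ->].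
    rewrite trmx_mul !mulmxA -(mulmxA a) -(mulmxA a).
    by rewrite -/G G0 mulmx0 mul0mx.
  have sc := submx_refl (col_mx (s *m W) (t *m N)).
  move: (sc); rewrite -addsmxE addsmx_sub => /andP[ss st].
  have sV : (col_mx (s *m W) (t *m N) <= col_mx W (t *m N))%MS.
    rewrite col_mx_sub; apply/andP; split.
      by apply: (submx_trans (submxMl _ _)); rewrite -addsmxE addsmxSl.
    by rewrite -addsmxE addsmxSr.
  have {}H := H (col_mx (s *m W) (t *m N)) (eqP rWv) ss sV _ _ ss st.
  by move: (line_formE D W N s t); rewrite H => /matrixP/(_ 0 0); rewrite !mxE.
split=> [[_ _ h]|h].
  move=> W' r1 r2 r3; split=> //.
    by apply: (key A skA hA).1 r1 r2 r3; apply: h; left.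
  by apply: (key B skB hB).1 r1 r2 r3; apply: h; right.
split=> // f [] ->.
  by apply/(key A skA hA) => W' r1 r2 r3; have [] := h _ r1 r2 r3.
by apply/(key B skB hB) => W' r1 r2 r3; have [] := h _ r1 r2 r3.
Qed.

(* Main.v *)
(* For x in X let W be the plane in K^5 over x.  Restricted to W x K^5/W, the  *)
(* forms A and B give a pencil of 2 x 3 matrices.  If no nonzero u in W is     *)
(* killed by a member of the pencil, that is, if W misses the center conic,    *)
(* then Z_x is the graph of the cross product of u A and u B, a curve of       *)
(* bidegree (1,2).  If p in W lies on the conic, change the basis of the       *)
(* pencil so that p A = 0; solving c1 A = p B and c2 A = c1 B one gets         *)
(* c2 B = 0 for a suitable choice (Kronecker's normal form of a skew pencil),  *)
(* so the conic is l^2 p + l m c1 + m^2 c2 and its tangent at p is spanned by  *)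
(* p and c1.  With w completing p to a basis of W and xi, eta the dual         *)
(* coordinates, the equations are eta (wA) = 0 and xi (pB) + eta (wB) = 0, and *)
(* - wA is proportional to pB if and only if W is tangent at p, and then Z_x   *)
(*   is a double line and a fiber of the second projection;                    *)
(* - otherwise wB is in the span of wA and pB if and only if W lies in the     *)
(*   plane of the conic, and then Z_x is two lines and a fiber;                *)
(* - otherwise Z_x is a line and a graph of bidegree (1,1).                    *)
(* Every component V is parametrized by P^1 in some bidegree (a,b), and        *)
(* pulling back a form of bidegree (d,e) shows that its divisor has degree     *)
(* a d + b e on V: this determines the numerical class of V.                   *)
Require Import Defs.
From HB Require Import structures.
From mathcomp Require Import all_boot all_order all_algebra.
From mathcomp Require Import boolp classical_sets reals.
From mathcomp Require Import complex mpoly.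
From mathcomp Require Import ring zify.

Set Implicit Arguments.
Unset Strict Implicit.
Unset Printing Implicit Defensive.

Import GRing.Theory.
Local Open Scope ring_scope.
Local Open Scope classical_set_scope.
Local Open Scope complex_scope.

(** * Multivariate polynomials *)

(** Let x be the point of the plane W. Restricting the skew forms A and B to W x K^5/W turns Z_x
    into the common zeros of two (1,1)-forms, and everything depends on how W meets the center
    conic.

    If W misses the conic, u A and u B are independent on K^5/W for every nonzero u in W; their
    cross product is a map from P^1 to P^2 of degree 2 and Z_x is its graph ([smooth_graph],
    [smooth_type]). If W contains a point p of the conic, a change of basis of the pencil gives p A
    = 0. With w completing p to a basis of W and dual coordinates xi, eta, the equations are eta (w
    A) = 0 and xi (p B) + eta (w B) = 0, and the linear relations between w A, p B and w B decide
    the shape of Z_x: [tangent_case], [secant_case] and [transversal_case], assembled in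
    [classify_conic_point].

    These relations acquire their geometric meaning through [kernel_chain]. Skew forms have even
    rank, so every member of the pencil has rank 4 and admits no isotropic subspace of dimension 4.
    This forces vectors c1, c2, independent together with p, such that c1 A = p B, c2 A = c1 B and
    c2 B = 0. Hence the conic is l^2 p + l m c1 + m^2 c2, and its tangent at p is spanned by p and
    c1 ([tangent_line_combination], [line_tangent]).

    The algebraic geometry is reduced to polynomials in one variable. Every component is a line in a
    fiber or a graph over P^1, parametrized in some bidegree (a, b) ([param_curve]). After pulling
    forms back, irreducibility is the absence of zero divisors and local lengths are multiplicities
    of roots ([point_multiplicity]), so a form of bidegree (d, e) cuts the curve in a d + b e points
    ([param_curve_intersection]), and (a, b) determines the numerical class ([num_equiv_classes]). A
    component has multiplicity 1 once its equations follow from those of Z_x by cancelling forms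
    that do not vanish on it ([stalk_cancel], [multiplicity1]). Only the tangent case needs more:
    there the length 2 comes from a derivation ([tangent_chain]) and from a generator of square zero
    ([double_line_length]). *)

Section MultivariatePolynomials.
Variable K : numClosedFieldType.

Lemma mmap_comp (n : nat) (S T : comNzRingType) (f : {rmorphism K -> S})
    (psi : {rmorphism S -> T}) (h : 'I_n -> S) (p : {mpoly K[n]}) :
  psi (mmap f h p) = mmap (psi \o f) (psi \o h) p.
Proof.
rewrite /mmap rmorph_sum; apply: eq_bigr => m _; rewrite rmorphM /=; congr (_ * _).
by rewrite /mmap1 rmorph_prod; apply: eq_bigr => i _; rewrite rmorphXn.
Qed.

Lemma eq_mmap (n : nat) (S : comNzRingType) (f g : K -> S) (h k : 'I_n -> S)
    (p : {mpoly K[n]}) : f =1 g -> h =1 k -> mmap f h p = mmap g k p.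
Proof.
move=> fg hk; rewrite /mmap; apply: eq_bigr => m _; rewrite fg; congr (_ * _).
exact: mmap1_eq.
Qed.

Lemma meval_mmapC (n k : nat) (h : 'I_n -> {mpoly K[k]}) (v : 'I_k -> K)
    (p : {mpoly K[n]}) :
  (mmap (@mpolyC k K) h p).@[v] = p.@[fun i => (h i).@[v]].
Proof.
rewrite (mmap_comp (@mpolyC k K) (meval v)) /meval.
by apply: eq_mmap => // c; exact: mevalC.
Qed.

Lemma horner_mmap (n : nat) (h : 'I_n -> {poly K}) (x : K) (p : {mpoly K[n]}) :
  (mmap (@polyC K) h p).[x] = p.@[fun i => (h i).[x]].
Proof.
rewrite -[LHS]/(horner_eval x _) (mmap_comp (@polyC K) (horner_eval x)) /meval.
by apply: eq_mmap => // c /=; rewrite /horner_eval hornerC.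
Qed.

(** In characteristic zero the naturals below [size p] are distinct, too many to be roots of a
    nonzero [p]. *)
Lemma poly_eq0_root (p : {poly K}) : (forall x, p.[x] = 0) -> p = 0.
Proof.
move=> p0; apply/eqP; apply: contraT => pN0.
have := @max_poly_roots K p [seq i%:R | i <- iota 0 (size p)] pN0.
rewrite size_map size_iota ltnn; apply.
  by apply/allP => x _; rewrite /root p0.
rewrite map_inj_uniq ?iota_uniq // => i j /eqP.
by rewrite Num.Theory.eqr_nat => /eqP.
Qed.

(** The chain rule along a polynomial curve [g]. Both sides are additive in [f] and obey the Leibniz
    rule, so constants and variables suffice. *)
Lemma deriv_mmap (n : nat) (g : 'I_n -> {poly K}) (f : {mpoly K[n]}) :
  (mmap (@polyC K) g f)^`() =
  \sum_i mmap (@polyC K) g (mderiv i f) * (g i)^`().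
Proof.
pose ok f := (mmap (@polyC K) g f)^`() =
  \sum_i mmap (@polyC K) g (mderiv i f) * (g i)^`().
have okM p q : ok p -> ok q -> ok (p * q).
  rewrite /ok rmorphM derivM => -> ->.
  rewrite mulr_suml mulr_sumr -big_split /=; apply: eq_bigr => i _.
  by rewrite mderivM rmorphD !rmorphM /=; ring.
have okC c : ok c%:MP.
  rewrite /ok mmapC derivC big1 // => i _.
  by rewrite mderivC rmorph0 mul0r.
have okX i : ok 'X_i.
  have UU : (U_(i) - U_(i) = 0 :> 'X_{1..n})%MM.
    by apply/mnmP => j; rewrite mnmBE subnn mnm0E.
  rewrite /ok mmapX mmap1U (bigD1 i) //= big1 => [|j ji].
    by rewrite mderivX mnm1E eqxx UU scale1r mpolyX0 rmorph1 mul1r addr0.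
  by rewrite mderivX mnm1E eq_sym (negPf ji) scale0r rmorph0 mul0r.
rewrite -/(ok f); elim/mpolyind: f => [|c m p _ _ IH].
  exact: (okC 0).
rewrite /ok rmorphD derivD IH.
under [RHS]eq_bigr do rewrite mderivD rmorphD mulrDl.
rewrite big_split /=; congr (_ + _).
suff : ok (c *: 'X_[m]) by [].
rewrite -mul_mpolyC; apply: (okM _ _ (okC c)).
rewrite mpolyXE_id; apply: (big_ind ok) => [||i _]; [exact: okC|exact: okM|].
by elim: (m i) => [|k IHk]; [exact: okC|rewrite exprS; apply: okM].
Qed.

(** By induction on the size all partial derivatives are zero, and in characteristic zero this
    leaves only a constant. *)
Lemma mpoly_eq0_eval (n : nat) (p : {mpoly K[n]}) :
  (forall v, p.@[v] = 0) -> p = 0.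
Proof.
move: (leqnn (msize p)); move: {2}(msize p) => k.
elim: k p => [|k IH] p.
  by rewrite leqn0 msize_poly_eq0 => /eqP.
move=> pk p0.
have dp0 i : mderiv i p = 0.
  apply: IH => [|v].
    rewrite msizeE; apply/bigmax_leqP_seq => m.
    rewrite mcoeff_msupp mcoeff_deriv => pm _.
    have : (m + U_(i))%MM \in msupp p.
      by rewrite mcoeff_msupp; apply: contraNneq pm => ->; rewrite mul0rn.
    by move/msize_mdeg_lt; rewrite mdegD mdeg1 addn1 => /leq_trans/(_ pk).
  (* The line through [v] in the direction of the coordinate [i]; [p] vanishes along it, hence so
     does its derivative at [v]. *)
  pose g j := (v j)%:P + (i == j)%:R *: 'X : {poly K}.
  have q0 : mmap (@polyC K) g p = 0.
    by apply: poly_eq0_root => x; rewrite horner_mmap.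
  have := deriv_mmap g p; rewrite q0 deriv0 => /(congr1 (horner^~ 0)) /=.
  rewrite horner0 horner_sum (bigD1 i) //= big1 => [|j ji]; last first.
    by rewrite /g eq_sym (negPf ji) scale0r addr0 derivC mulr0 horner0.
  rewrite /g eqxx scale1r derivD derivC derivX add0r mulr1 addr0 horner_mmap.
  move=> /esym; congr (_ = _); apply: meval_eq => j.
  by rewrite hornerD hornerC hornerZ hornerX mulr0 addr0.
have pc : p = (p@_0)%:MP.
  apply/mpolyP => m; rewrite mcoeffC; case: eqVneq => [->|m0].
    by rewrite mulr1.
  rewrite mulr0; have [i mi] : exists i, m i != 0%N.
    apply/existsP; apply: contraR m0; rewrite negb_exists => /forallP m0.
    by apply/eqP/mnmP => i; rewrite mnm0E; apply/eqP; have := m0 i; rewrite negbK.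
  have := mcoeff_deriv i (m - U_(i))%MM p; rewrite dp0 mcoeff0 submK; last first.
    by rewrite lep1mP.
  by move=> /esym/eqP; rewrite Num.Theory.mulrn_eq0 => /orP[//|/eqP].
by have := p0 (fun=> 0); rewrite pc mevalC => ->; rewrite mpolyC0.
Qed.

(** Substituting polynomials of degree at most [w i] in a form of weight [D] has an expected degree
    [D]; the coefficient there is the value of the form at infinity, whether or not it is zero. *)
Lemma size_mmap_weight (n D : nat) (w : 'I_n -> nat) (g : 'I_n -> {poly K})
    (f : {mpoly K[n]}) :
  (forall m, m \in msupp f -> (\sum_i w i * m i)%N = D) ->
  (forall i, size (g i) <= (w i).+1)%N ->
  (size (mmap (@polyC K) g f) <= D.+1)%N /\
  (mmap (@polyC K) g f)`_D = f.@[fun i => (g i)`_(w i)].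
Proof.
move=> fD gw.
pose ok k q c := (size (q : {poly K}) <= k.+1)%N /\ q`_k = c.
have okM k l q r c d : ok k q c -> ok l r d -> ok (k + l)%N (q * r) (c * d).
  move=> [sq qc] [sr rd]; split.
    by apply: (leq_trans (size_polyMleq _ _)); lia.
  rewrite coefM (bigD1 (inord k)) //= inordK ?ltnS ?leq_addr // addKn qc rd.
  rewrite big1 ?addr0 // => i; rewrite -val_eqE /= inordK ?ltnS ?leq_addr // => ik.
  have [lt|gt|/eqP] := ltngtP i k; last by rewrite (negPf ik).
    rewrite [r`_ _]nth_default ?mulr0 //; apply: (leq_trans sr); lia.
  by rewrite [q`_ _]nth_default ?mul0r //; apply: (leq_trans sq); lia.
have okX k q c e : ok k q c -> ok (k * e)%N (q ^+ e) (c ^+ e).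
  move=> kq; elim: e => [|e IH].
    by rewrite muln0 !expr0; split; rewrite ?size_poly1 ?coefC.
  by rewrite mulnS !exprS; apply: okM.
have okm (m : 'X_{1..n}) : ok (\sum_i w i * m i)%N (mmap1 g m) (\prod_i (g i)`_(w i) ^+ m i).
  rewrite /mmap1; apply: (big_ind3 (fun k q c => ok k q c)) => [||i _].
  - by split; rewrite ?size_poly1 ?coefC.
  - by move=> k q c l r d; apply: okM.
  - by apply: okX.
rewrite /mmap mevalE; split.
  apply: (leq_trans (size_sum _ _ _)); apply/bigmax_leqP_seq => m mf _.
  rewrite mul_polyC; apply: (leq_trans (size_scale_leq _ _)).
  by rewrite -(fD m mf); case: (okm m).
rewrite coef_sum; apply: eq_big_seq => m mf.
by rewrite mul_polyC coefZ -(fD m mf); case: (okm m) => _ ->.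
Qed.

End MultivariatePolynomials.

(** * Closed subsets of the product *)

Section Bihomogeneous.
Variable K : numClosedFieldType.
Local Notation MP := {mpoly K[2 + 3]}.
Implicit Types (f g h : MP) (d e : nat) (x y : bipoint K).
Implicit Types (V W T Z : set (bipoint K)).

Lemma bihomog0 d e : bihomog d e (0 : MP).
Proof. by move=> m; rewrite msupp0. Qed.

Lemma bihomogD d e f g : bihomog d e f -> bihomog d e g -> bihomog d e (f + g).
Proof.
move=> fh gh m /msuppD_le; rewrite mem_cat => /orP[|]; [exact: fh|exact: gh].
Qed.

Lemma bihomogZ d e c f : bihomog d e f -> bihomog d e (c *: f).
Proof. by move=> fh m /msuppZ_le /fh. Qed.

Lemma bihomogN d e f : bihomog d e f -> bihomog d e (- f).
Proof. by rewrite -scaleN1r; exact: bihomogZ. Qed.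

Lemma bihomogB d e f g : bihomog d e f -> bihomog d e g -> bihomog d e (f - g).
Proof. by move=> fh gh; apply: bihomogD => //; exact: bihomogN. Qed.

Lemma bihomogM d e d' e' f g : bihomog d e f -> bihomog d' e' g ->
  bihomog (d + d') (e + e') (f * g).
Proof.
move=> fh gh m /msuppM_le/allpairsP[[p q]] /= [/fh[<- <-] /gh[<- <-] ->].
by split; rewrite -big_split /=; apply: eq_bigr => i _; rewrite mnmDE.
Qed.

Lemma bihomogC c : bihomog 0 0 (c%:MP : MP).
Proof.
move=> m; rewrite msuppC; case: ifP => // _; rewrite inE => /eqP ->.
by split; apply: big1 => i _; rewrite mnm0E.
Qed.

Lemma bihomog1 : bihomog 0 0 (1 : MP).
Proof. by rewrite -mpolyC1; apply: bihomogC. Qed.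

Lemma bihomogXn d e f k : bihomog d e f -> bihomog (k * d) (k * e) (f ^+ k).
Proof.
move=> fh; elim: k => [|k IH]; first exact: bihomog1.
by rewrite exprS !mulSn; apply: bihomogM.
Qed.

Lemma bihomog_sum (I : Type) (r : seq I) (P : pred I) (F : I -> MP) d e :
  (forall i, P i -> bihomog d e (F i)) -> bihomog d e (\sum_(i <- r | P i) F i).
Proof.
by move=> h; apply: big_ind => //; [exact: bihomog0|move=> *; exact: bihomogD].
Qed.

Lemma bihomog_lX i : bihomog 1 0 ('X_(lshift 3 i) : MP).
Proof.
move=> m; rewrite msuppX inE => /eqP ->; split.
  rewrite (bigD1 i) //= mnm1E eqxx big1 ?addn0 // => j ji.
  by rewrite mnm1E eq_lshift eq_sym (negPf ji).
by apply: big1 => j _; rewrite mnm1E eq_lrshift.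
Qed.

Lemma bihomog_rX j : bihomog 0 1 ('X_(rshift 2 j) : MP).
Proof.
move=> m; rewrite msuppX inE => /eqP ->; split.
  by apply: big1 => i _; rewrite mnm1E eq_rlshift.
rewrite (bigD1 j) //= mnm1E eqxx big1 ?addn0 // => i ij.
by rewrite mnm1E eq_rshift eq_sym (negPf ij).
Qed.

Lemma bihomog_uniq d e d' e' f : f != 0 -> bihomog d e f -> bihomog d' e' f ->
  d = d' /\ e = e'.
Proof.
rewrite -msupp_eq0 => f0 fh fh'.
have [m mf] : exists m, m \in msupp f.
  by case: (msupp f) f0 => // m r _; exists m; rewrite mem_head.
by have [<- <-] := fh m mf; have [<- <-] := fh' m mf.
Qed.

Lemma bievalD x f g : bieval x (f + g) = bieval x f + bieval x g.
Proof. exact: mevalD. Qed.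
Lemma bievalB x f g : bieval x (f - g) = bieval x f - bieval x g.
Proof. exact: mevalB. Qed.
Lemma bievalM x f g : bieval x (f * g) = bieval x f * bieval x g.
Proof. exact: mevalM. Qed.
Lemma bievalXn x f k : bieval x (f ^+ k) = bieval x f ^+ k.
Proof. exact: rmorphXn. Qed.
Lemma bievalZ x c f : bieval x (c *: f) = c * bieval x f.
Proof. exact: mevalZ. Qed.
Lemma bieval1 x : bieval x 1 = 1.
Proof. exact: meval1. Qed.
Lemma bieval_sum x (I : Type) (r : seq I) (P : pred I) (F : I -> MP) :
  bieval x (\sum_(i <- r | P i) F i) = \sum_(i <- r | P i) bieval x (F i).
Proof. exact: rmorph_sum. Qed.
Lemma bieval_lX x i : bieval x 'X_(lshift 3 i) = x.1 0 i.
Proof. by rewrite /bieval mevalXU row_mxEl. Qed.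
Lemma bieval_rX x j : bieval x 'X_(rshift 2 j) = x.2 0 j.
Proof. by rewrite /bieval mevalXU row_mxEr. Qed.

Lemma bieval_scale d e f a b (s : 'rV[K]_2) (t : 'rV[K]_3) : bihomog d e f ->
  bieval (a *: s, b *: t) f = a ^+ d * b ^+ e * bieval (s, t) f.
Proof.
move=> fh; rewrite /bieval !mevalE mulr_sumr; apply: eq_big_seq => m /fh[<- <-].
rewrite mulrCA; congr (_ * _); rewrite !big_split_ord /= -!prodrXr.
rewrite mulrACA -!big_split /=; congr (_ * _); apply: eq_bigr => i _.
  by rewrite !row_mxEl mxE exprMn.
by rewrite !row_mxEr mxE exprMn.
Qed.

Lemma bihomog_mmap_weight a b d e f : bihomog d e f ->
  forall m, m \in msupp f ->
  (\sum_i (if split i is inl _ then a else b) * m i)%N = (a * d + b * e)%N.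
Proof.
move=> fh m /fh[<- <-]; rewrite big_split_ord /= !big_distrr /=.
congr (_ + _)%N; apply: eq_bigr => i _.
  by rewrite (unsplitK (inl i)).
by rewrite (unsplitK (inr i)).
Qed.

Lemma same_pointP m (u v : 'rV[K]_m) : u != 0 -> v != 0 ->
  (forall i j, v 0 i * u 0 j = v 0 j * u 0 i) -> same_point u v.
Proof.
move=> u0 v0 uv; split=> //.
have [j uj] : exists j, u 0 j != 0 by apply/rV0Pn.
have E : v = (v 0 j / u 0 j) *: u.
  by apply/rowP => i; rewrite mxE mulrAC -uv mulfK.
exists (v 0 j / u 0 j) => //; apply: contraNneq v0 => c0.
by rewrite E c0 scale0r.
Qed.

Lemma same_point_minor m (u v : 'rV[K]_m) i j : same_point u v ->
  v 0 i * u 0 j = v 0 j * u 0 i.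
Proof. by move=> [_ [c _ ->]]; rewrite !mxE; ring. Qed.

Lemma same_point_neq0 m (u v : 'rV[K]_m) : same_point u v -> v != 0.
Proof. by move=> [u0 [c c0 ->]]; rewrite scaler_eq0 negb_or c0. Qed.

Lemma same_point_refl m (u : 'rV[K]_m) : u != 0 -> same_point u u.
Proof. by move=> u0; split=> //; exists 1; rewrite ?scale1r ?oner_eq0. Qed.

Lemma same_point_sym m (u v : 'rV[K]_m) : same_point u v -> same_point v u.
Proof.
move=> uv; split; first exact: same_point_neq0 uv.
case: uv => _ [c c0 ->]; exists c^-1; rewrite ?invr_eq0 //.
by rewrite scalerA mulVf // scale1r.
Qed.

Lemma same_point_trans m (v u w : 'rV[K]_m) :
  same_point u v -> same_point v w -> same_point u w.
Proof.
move=> [u0 [c c0 ->]] [_ [d d0 ->]]; split=> //; exists (d * c).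
  by rewrite mulf_neq0.
by rewrite scalerA.
Qed.

Lemma same_bipoint_sym x y : same_bipoint x y -> same_bipoint y x.
Proof. by move=> [? ?]; split; apply: same_point_sym. Qed.

Lemma same_bipoint_trans y x z :
  same_bipoint x y -> same_bipoint y z -> same_bipoint x z.
Proof. by move=> [a b] [c d]; split; apply: same_point_trans; eassumption. Qed.

Lemma bieval_same d e f x y : bihomog d e f -> same_bipoint x y ->
  bieval x f = 0 -> bieval y f = 0.
Proof.
case: x y => [s t] [s' t'] fh [[_ [a _ /= ->]] [_ [b _ /= ->]]] f0.
by rewrite (bieval_scale _ _ _ _ fh) f0 mulr0.
Qed.

(** A single point of P^1 x P^2, encoded like every subset as the set of all its representatives. *)
Definition point_class x : set (bipoint K) := [set y | same_bipoint x y].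

Definition proper_point x := x.1 != 0 /\ x.2 != 0.

Lemma point_class_refl x : proper_point x -> point_class x x.
Proof. by move=> [x1 x2]; split; apply: same_point_refl. Qed.

Lemma closed_proper Z x : closed_subset Z -> Z x -> proper_point x.
Proof. by move=> [S [_ ->]] []. Qed.

Lemma closed_same Z x y : closed_subset Z -> Z x -> same_bipoint x y -> Z y.
Proof.
move=> [S [hS ->]] [x1 x2 xS] [xy1 xy2]; split.
- exact: same_point_neq0 xy1.
- exact: same_point_neq0 xy2.
- move=> f Sf; have [d [e fh]] := hS f Sf.
  by apply: (bieval_same fh _ (xS f Sf)).
Qed.

Definition vanishing_forms (V : set (bipoint K)) : set (bipoly K) :=
  [set f | (exists d e, bihomog d e f) /\ vanishes_on V f].

Lemma closed_vanishing V :
  (forall x, proper_point x ->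
     (forall d e f, bihomog d e f -> vanishes_on V f -> bieval x f = 0) -> V x) ->
  (forall x, V x -> proper_point x) -> closed_subset V.
Proof.
move=> Vx Vp; exists (vanishing_forms V); split=> [f []//|].
apply/seteqP; split=> x.
  by move=> xV; have [x1 x2] := Vp x xV; split=> // f [_]; apply.
move=> [x1 x2 xf]; apply: Vx => // d e f fh fV; apply: xf; split=> //.
by exists d, e.
Qed.

(** The equations are the 2 x 2 minors of the coordinates against those of [x], of bidegrees (1,0)
    and (0,1). *)
Lemma point_class_closed x : proper_point x -> closed_subset (point_class x).
Proof.
move=> [x1 x2]; apply: closed_vanishing => [y [y1 y2] yf|y [h1 h2]]; last first.
  by split; [exact: same_point_neq0 h1|exact: same_point_neq0 h2].
split; apply: same_pointP => // i j; apply/eqP; rewrite -subr_eq0; apply/eqP.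
  pose f : MP := x.1 0 j *: 'X_(lshift 3 i) - x.1 0 i *: 'X_(lshift 3 j).
  have fE z : bieval z f = z.1 0 i * x.1 0 j - z.1 0 j * x.1 0 i.
    by rewrite bievalB !bievalZ !bieval_lX; ring.
  rewrite -fE; apply: (yf 1 0)%N => [|z [xz _]].
    by apply: bihomogB; apply/bihomogZ/bihomog_lX.
  by apply/eqP; rewrite fE subr_eq0; apply/eqP/same_point_minor.
pose f : MP := x.2 0 j *: 'X_(rshift 2 i) - x.2 0 i *: 'X_(rshift 2 j).
have fE z : bieval z f = z.2 0 i * x.2 0 j - z.2 0 j * x.2 0 i.
  by rewrite bievalB !bievalZ !bieval_rX; ring.
rewrite -fE; apply: (yf 0 1)%N => [|z [_ xz]].
  by apply: bihomogB; apply/bihomogZ/bihomog_rX.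
by apply/eqP; rewrite fE subr_eq0; apply/eqP/same_point_minor.
Qed.

Lemma closed_class Z x : closed_subset Z -> Z x -> point_class x `<=` Z.
Proof. by move=> Zc Zx y xy; apply: closed_same xy. Qed.

Lemma point_class_irreducible x : proper_point x ->
  irreducible_closed (point_class x).
Proof.
move=> xp; split; first exact: point_class_closed.
  by exists x; apply: point_class_refl.
move=> Z1 Z2 Z1c Z2c xZ.
by case: (xZ x (point_class_refl xp)) => Zx; [left|right]; apply: closed_class.
Qed.

Lemma point_class_eq x y : same_bipoint x y -> point_class x = point_class y.
Proof.
move=> xy; apply/seteqP; split=> z; apply: same_bipoint_trans => //.
exact: same_bipoint_sym.
Qed.

Lemma closed_sub_class T x : closed_subset T -> T !=set0 ->
  T `<=` point_class x -> T = point_class x.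
Proof.
move=> Tc [y Ty] Tx; apply/seteqP; split=> //.
by rewrite (point_class_eq (Tx y Ty)); apply: closed_class.
Qed.

Lemma closedU (Z1 Z2 : set (bipoint K)) : closed_subset Z1 -> closed_subset Z2 ->
  closed_subset (Z1 `|` Z2).
Proof.
move=> [S1 [h1 ->]] [S2 [h2 ->]].
exists [set h | exists f g, [/\ S1 f, S2 g & h = f * g]]; split.
  move=> _ [f [g [/h1[d [e fh]] /h2[d' [e' gh]] ->]]].
  by exists (d + d')%N, (e + e')%N; apply: bihomogM.
apply/seteqP; split=> x.
  case=> -[x1 x2 xS]; split=> // _ [f [g [Sf Sg ->]]]; rewrite bievalM.
    by rewrite xS // mul0r.
  by rewrite [bieval x g]xS // mulr0.
move=> [x1 x2 xS]; case: (pselect (forall f, S1 f -> bieval x f = 0)) => [|/existsNP].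
  by left.
move=> [f /not_implyP[Sf /eqP fx]]; right; split=> // g Sg.
have /eqP := xS (f * g) (ex_intro _ f (ex_intro _ g (And3 Sf Sg erefl))).
by rewrite bievalM mulf_eq0 (negPf fx) => /eqP.
Qed.

Lemma closed_zeros (S : set (bipoly K)) :
  (forall f, S f -> exists d e, bihomog d e f) -> closed_subset (zeros S).
Proof. by move=> h; exists S. Qed.

Lemma closed0 : closed_subset (set0 : set (bipoint K)).
Proof.
exists [set 1]; split=> [_ ->|]; first by exists 0%N, 0%N; apply: bihomog1.
apply/seteqP; split=> x // [_ _ /(_ 1 erefl)].
by rewrite bieval1 => /eqP; rewrite oner_eq0.
Qed.

Lemma irreducible_sub_list (Vs : seq (set (bipoint K))) T :
  (forall V, V \in Vs -> closed_subset V) -> irreducible_closed T ->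
  T `<=` [set x | exists2 V, V \in Vs & V x] -> exists2 V, V \in Vs & T `<=` V.
Proof.
move=> + [Tc T0 Ti]; elim: Vs => [|V Vs IH] Vc TV.
  by have [x /TV[]] := T0.
have VsC : closed_subset [set x | exists2 V, V \in Vs & V x].
  elim: (Vs) (fun V VV => Vc V (mem_behead VV)) => [|W Ws IHW] Wc.
    by rewrite (_ : [set _ | _] = set0); [exact: closed0|apply/seteqP; split=> x // []].
  rewrite (_ : [set _ | _] = W `|` [set x | exists2 V, V \in Ws & V x]).
    apply: closedU; first by apply: Wc; rewrite mem_head.
    by apply: IHW => V' V'W; apply: Wc; rewrite inE V'W orbT.
  apply/seteqP; split=> x.
    by move=> [V']; rewrite inE => /orP[/eqP ->|]; [left|right; exists V'].
  case=> [Wx|[V' V'W V'x]]; first by exists W; rewrite ?mem_head.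
  by exists V' => //; rewrite inE V'W orbT.
have VC : closed_subset V by apply: Vc; rewrite mem_head.
case: (Ti _ _ VC VsC) => [x /TV[W]|TV'|TVs].
- by rewrite inE => /orP[/eqP ->|WVs Wx]; [left|right; exists W].
- by exists V => //; rewrite mem_head.
- have [|W WVs TW] := IH _ TVs; last by exists W; rewrite ?inE ?WVs ?orbT.
  by move=> W WVs; apply: Vc; rewrite inE WVs orbT.
Qed.

(** An irreducible subset of a finite union of closed sets lies in one of them, so a finite union of
    irreducible sets without inclusions has these as its components. *)
Lemma components_list (Vs : seq (set (bipoint K))) Z :
  (forall V, V \in Vs -> irreducible_closed V) ->
  (forall V W, V \in Vs -> W \in Vs -> V `<=` W -> V = W) ->
  Z = [set x | exists2 V, V \in Vs & V x] ->
  components Z = [set` Vs].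
Proof.
move=> Vi VW ->; have Vc V : V \in Vs -> closed_subset V by case/Vi.
have Vsub V : V \in Vs -> V `<=` [set x | exists2 V, V \in Vs & V x].
  by move=> VV x Vx; exists V.
apply/seteqP; split=> [T [Ti TZ Tmax]|V VVs].
  have [V VVs TV] := irreducible_sub_list Vc Ti TZ.
  by rewrite -(Tmax V) //; [exact: Vi|exact: Vsub].
split; [exact: Vi|exact: Vsub|move=> T Ti VT TZ].
have [W WVs TW] := irreducible_sub_list Vc Ti TZ.
have E : V = W by apply: VW => //; apply: subset_trans TW.
by apply/seteqP; split=> //; rewrite {1}E.
Qed.

End Bihomogeneous.

(** * Parametrized curves *)

Section Charts.
Variable K : numClosedFieldType.
Local Notation MP := {mpoly K[2 + 3]}.
Implicit Types (V W T Z : set (bipoint K)) (p q : {poly K}).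

Definition weight (a b : nat) (i : 'I_(2 + 3)) := if split i is inl _ then a else b.

Definition affine_point (phi : 'I_(2 + 3) -> {poly K}) (x : K) : bipoint K :=
  (\row_i (phi (lshift 3 i)).[x], \row_j (phi (rshift 2 j)).[x]).

(** Coefficients in the prescribed degrees [a] and [b], even where some of them vanish: the value at
    infinity of the homogenized parametrization. *)
Definition infinite_point a b (phi : 'I_(2 + 3) -> {poly K}) : bipoint K :=
  (\row_i (phi (lshift 3 i))`_a, \row_j (phi (rshift 2 j))`_b).

(* A parametrization x |-> phi(x) of V by P^1, of bidegree (a,b), whose       *)
(* inverse is given by the two forms [chart0] and [chart1].                   *)
Record curve_chart V (a b : nat) := CurveChart {
  chart_map : 'I_(2 + 3) -> {poly K};
  chart_d : nat;
  chart_e : nat;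
  chart0 : MP;
  chart1 : MP;
  size_chart_map : forall i, (size (chart_map i) <= (weight a b i).+1)%N;
  bihomog_chart0 : bihomog chart_d chart_e chart0;
  bihomog_chart1 : bihomog chart_d chart_e chart1;
  chart0E : mmap (@polyC K) chart_map chart0 = 1;
  chart1E : mmap (@polyC K) chart_map chart1 = 'X;
  chart_closed : closed_subset V;
  chart_affine : forall x, V (affine_point chart_map x);
  chart_infinite : V (infinite_point a b chart_map);
  chart_cover : forall y, V y -> same_bipoint (infinite_point a b chart_map) y \/
    exists x, same_bipoint (affine_point chart_map x) y }.

Section OneChart.
Variables (V : set (bipoint K)) (a b : nat) (c : curve_chart V a b).

Definition pull (f : MP) : {poly K} := mmap (@polyC K) (chart_map c) f.
Local Notation pt := (affine_point (chart_map c)).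
Local Notation ptoo := (infinite_point a b (chart_map c)).

Lemma pullD f g : pull (f + g) = pull f + pull g. Proof. exact: rmorphD. Qed.
Lemma pullB f g : pull (f - g) = pull f - pull g. Proof. exact: rmorphB. Qed.
Lemma pullM f g : pull (f * g) = pull f * pull g. Proof. exact: rmorphM. Qed.
Lemma pullXn f n : pull (f ^+ n) = pull f ^+ n. Proof. exact: rmorphXn. Qed.
Lemma pull0 : pull 0 = 0. Proof. exact: rmorph0. Qed.
Lemma pull1 : pull 1 = 1. Proof. exact: rmorph1. Qed.
Lemma pullZ k f : pull (k *: f) = k *: pull f.
Proof. by rewrite /pull mmapZ mul_polyC. Qed.

Lemma horner_pull f x : (pull f).[x] = bieval (pt x) f.
Proof.
rewrite horner_mmap /bieval; apply: meval_eq => i; rewrite mxE.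
by rewrite -[in LHS](splitK i); case: (split i) => j; rewrite mxE.
Qed.

(** The expected degree [a * d + b * e] is the intersection number to be found; the actual degree
    drops exactly when [f] vanishes at the infinite point. *)
Lemma size_pull d e f : bihomog d e f ->
  (size (pull f) <= (a * d + b * e).+1)%N /\
  (pull f)`_(a * d + b * e) = bieval ptoo f.
Proof.
move=> fh.
have [sf cf] := size_mmap_weight (bihomog_mmap_weight a b fh) (size_chart_map c).
split=> //; rewrite [LHS]cf /bieval; apply: meval_eq => i; rewrite mxE /weight.
by rewrite -[in LHS](splitK i) unsplitK; case: (split i) => j; rewrite mxE.
Qed.

Lemma pull_vanish d e f : bihomog d e f -> vanishes_on V f <-> pull f = 0.
Proof.
move=> fh; split=> [fV|f0 y /(chart_cover c)[|[x]] sy].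
- by apply: poly_eq0_root => x; rewrite horner_pull; apply/fV/(chart_affine c).
- by apply: (bieval_same fh sy); rewrite -(size_pull fh).2 f0 coef0.
- by apply: (bieval_same fh sy); rewrite -horner_pull f0 horner0.
Qed.

Lemma pullMn0 f g : pull f != 0 -> pull g != 0 -> pull (f * g) != 0.
Proof. by move=> f0 g0; rewrite pullM mulf_neq0. Qed.

(** Homogenize [p] in the two chart forms, whose pull-backs are 1 and ['X]. *)
Lemma pull_lift D p : (size p <= D.+1)%N ->
  exists2 g, bihomog (D * chart_d c) (D * chart_e c) g & pull g = p.
Proof.
move=> pD.
exists (\sum_(k < D.+1) p`_k *: (chart0 c ^+ (D - k) * chart1 c ^+ k)).
  apply: bihomog_sum => k _; apply: bihomogZ.
  have kD : (k <= D)%N by rewrite -ltnS.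
  have split_D m : (D * m = (D - k) * m + k * m)%N by rewrite -mulnDl subnK.
  rewrite !split_D; apply: bihomogM; apply: bihomogXn.
    exact: bihomog_chart0.
  exact: bihomog_chart1.
rewrite [LHS]rmorph_sum /= -[RHS]coefK (poly_def (size p)).
rewrite (big_ord_widen D.+1 (fun k => p`_k *: 'X^k)) // [RHS]big_mkcond /=.
apply: eq_bigr => k _; rewrite -/(pull _) pullZ pullM !pullXn.
rewrite /pull chart0E chart1E expr1n mul1r; case: ltnP => // kp.
by rewrite nth_default // scale0r.
Qed.

Lemma affine_point_inj x y : same_bipoint (pt x) (pt y) -> x = y.
Proof.
move=> xy; pose f := chart1 c - x *: chart0 c.
have fh : bihomog (chart_d c) (chart_e c) f.
  by apply/bihomogB/bihomogZ/bihomog_chart0/bihomog_chart1.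
have fE z : bieval (pt z) f = z - x.
  rewrite -horner_pull /f pullB pullZ /pull chart0E chart1E.
  by rewrite !hornerE.
have := bieval_same fh xy; rewrite !fE subrr => /(_ erefl)/eqP.
by rewrite subr_eq0 => /eqP.
Qed.

Lemma chart_proper_affine x : proper_point (pt x).
Proof. exact: closed_proper (chart_closed c) (chart_affine c x). Qed.

(** Forms pull back to the domain [{poly K}]: if V were contained in neither closed set, two forms
    with nonzero pull-backs would have a product vanishing on V. *)
Lemma chart_irreducible : irreducible_closed V.
Proof.
have Vc := chart_closed c; split=> //; first by exists (pt 0); apply: chart_affine.
move=> Z1 Z2 [S1 [h1 ->]] [S2 [h2 ->]] VZ.
have all0 S : (forall f, S f -> exists d e, bihomog d e f) ->
    ~ V `<=` zeros S -> exists2 f, S f & pull f != 0.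
  move=> hS VS; apply: contrapT => nf; apply: VS => x Vx.
  have [x1 x2] := closed_proper Vc Vx; split=> // f Sf.
  have [d [e fh]] := hS f Sf.
  apply: (iffRL (pull_vanish fh)) => //; apply/eqP; apply: contrapT => /negP f0.
  by apply: nf; exists f.
case: (pselect (V `<=` zeros S1)) => [|V1]; first by left.
case: (pselect (V `<=` zeros S2)) => [|V2]; first by right.
have [f Sf f0] := all0 S1 h1 V1; have [g Sg g0] := all0 S2 h2 V2.
have [d [e fh]] := h1 f Sf; have [d' [e' gh]] := h2 g Sg.
have /eqP[] := pullMn0 f0 g0; apply: (iffLR (pull_vanish (bihomogM fh gh))) => x.
move=> /VZ[] [_ _ xS]; rewrite bievalM; first by rewrite xS // mul0r.
by rewrite [bieval x g]xS // mulr0.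
Qed.

(* A closed subset of V other than V is contained in the zero locus on V of a *)
(* form whose pull-back is nonzero, hence, if the point at infinity is not a  *)
(* zero, in finitely many affine points.                                      *)
Lemma zero_affine d e f y : bihomog d e f -> bieval ptoo f != 0 -> V y ->
  bieval y f = 0 -> exists2 x, same_bipoint (pt x) y & root (pull f) x.
Proof.
move=> fh foo /(chart_cover c)[] => [sy|[x sy]] yf.
  by rewrite (bieval_same fh (same_bipoint_sym sy) yf) eqxx in foo.
exists x => //; rewrite /root horner_pull.
by rewrite (bieval_same fh (same_bipoint_sym sy) yf).
Qed.

Lemma pull_neq0 d e f : bihomog d e f -> bieval ptoo f != 0 -> pull f != 0.
Proof. by move=> fh; rewrite -(size_pull fh).2; apply: contraNneq => ->; rewrite coef0. Qed.

(** Split off from the pull-back of [f] the full power of ['X - x] and lift the cofactor to a form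
    [g]. Then T lies in the union of the point over [x] and the zeros of [g]; irreducibility chooses
    one of them, and it is the first since [g] is nonzero over [x]. *)
Lemma irreducible_sub_zero d e f T : bihomog d e f -> bieval ptoo f != 0 ->
  irreducible_closed T -> T `<=` V -> vanishes_on T f ->
  exists2 x, T = point_class (pt x) & root (pull f) x.
Proof.
move=> fh foo [Tc T0 Ti] TV Tf; have f0 := pull_neq0 fh foo.
have [y Ty] := T0; have [x sy fx] := zero_affine fh foo (TV y Ty) (Tf y Ty).
exists x => //; apply: closed_sub_class => //.
have [n [p px fE]] := multiplicity_XsubC (pull f) x.
rewrite f0 /= in px.
have sp : (size p <= (a * d + b * e).+1)%N.
  apply: leq_trans (size_pull fh).1; rewrite fE.
  by rewrite dvdp_leq ?dvdp_mulr // -fE.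
have [g gh gp] := pull_lift sp.
have gc : closed_subset (zeros [set g]).
  by apply: closed_zeros => _ ->; eexists; eexists; exact: gh.
have xc : closed_subset (point_class (pt x)).
  exact/point_class_closed/chart_proper_affine.
case: (Ti _ _ xc gc) => [z Tz|//|Tg].
  have [x' sz] := zero_affine fh foo (TV z Tz) (Tf z Tz).
  rewrite fE /root hornerM mulf_eq0 horner_exp hornerXsubC expf_eq0 subr_eq0.
  case/orP => [px'|/andP[_ /eqP <-]]; last by left.
  have [z1 z2] := closed_proper Tc Tz.
  right; split=> // _ ->; apply: (bieval_same gh sz).
  by rewrite -horner_pull gp; apply/eqP.
have [_ _ /(_ g erefl) gy] := Tg y Ty.
have := bieval_same gh (same_bipoint_sym sy) gy.
by rewrite -horner_pull gp => /rootP; rewrite (negPf px).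
Qed.

End OneChart.
End Charts.

(** * Local ideals *)

Section LocalIdeals.
Variable K : numClosedFieldType.
Local Notation MP := {mpoly K[2 + 3]}.
Local Notation frac := (@tofrac MP).
Implicit Types (V W T Z : set (bipoint K)) (S : set (bipoly K)).

Lemma tofrac_nonvanishing V g : ~ vanishes_on V g -> frac g != 0.
Proof.
move=> gV; rewrite tofrac_eq0; apply/eqP => g0; apply: gV => x _.
by rewrite g0 /bieval meval0.
Qed.

(* The local rings are meaningful only for such V. *)
Definition vanishing_prime V := forall d e d' e' (f g : MP),
  bihomog d e f -> bihomog d' e' g ->
  ~ vanishes_on V f -> ~ vanishes_on V g -> ~ vanishes_on V (f * g).

(** Numerator and denominator of a local function have equal bidegrees, so denominators are needed
    in every bidegree. *)
Definition pad_forms V := forall d e, exists2 h : MP, bihomog d e h & ~ vanishes_on V h.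

Lemma irreducible_prime V : irreducible_closed V -> vanishing_prime V.
Proof.
move=> [Vc V0 Vi] d e d' e' f g fh gh fV gV fgV.
have zc (h : MP) d1 e1 : bihomog d1 e1 h -> closed_subset (zeros [set h]).
  by move=> hh; apply: closed_zeros => _ ->; exists d1, e1.
have zV (h : MP) : V `<=` zeros [set h] -> vanishes_on V h.
  by move=> Vh x /Vh[_ _]; apply.
case: (Vi _ _ (zc f _ _ fh) (zc g _ _ gh)) => [x Vx|/zV//|/zV//].
have [x1 x2] := closed_proper Vc Vx.
have /eqP := fgV x Vx; rewrite bievalM mulf_eq0 => /orP[] /eqP h0.
  by left; split=> // _ ->.
by right; split=> // _ ->.
Qed.

(** A single representative is not a closed set, so this is not a case of [irreducible_prime]; it
    serves [reduced], which localizes at [[set x]]. *)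
Lemma point_prime x : vanishing_prime [set x].
Proof.
move=> d e d' e' f g _ _ fx gx fgx.
have /eqP := fgx x erefl; rewrite bievalM mulf_eq0 => /orP[] /eqP h0.
  by apply: fx => _ ->.
by apply: gx => _ ->.
Qed.

Lemma point_pad V x : V x -> proper_point x -> pad_forms V.
Proof.
move=> Vx [/rV0Pn[i xi] /rV0Pn[j xj]] d e.
exists ('X_(lshift 3 i) ^+ d * 'X_(rshift 2 j) ^+ e).
  have := bihomogM (@bihomogXn K 1 0 _ d (@bihomog_lX K i)) (@bihomogXn K 0 1 _ e (@bihomog_rX K j)).
  by rewrite !muln0 !muln1 addn0 add0n.
move=> /(_ x Vx); rewrite bievalM !bievalXn bieval_lX bieval_rX => /eqP.
by rewrite mulf_eq0 !expf_eq0 (negPf xi) (negPf xj) !andbF.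
Qed.

Lemma divfD (F : fieldType) (a b c d : F) : b != 0 -> d != 0 ->
  a / b + c / d = (a * d + c * b) / (b * d).
Proof. by move=> b0 d0; field; rewrite b0 d0. Qed.

Lemma divf_unit (F : fieldType) (a b : F) : a != 0 -> b != 0 ->
  1 = b / a * (a / b).
Proof. by move=> a0 b0; field; rewrite a0 b0. Qed.

Lemma divf_change (F : fieldType) (f g g' h : F) : g != 0 -> g' != 0 -> h != 0 ->
  f / g = g' / (h * g) * (h * f / g').
Proof. by move=> g0 g0' h0; field; rewrite g0 g0' h0. Qed.

Lemma divf_scale (F : fieldType) (f g h k : F) : g != 0 -> k != 0 ->
  h * f / g = h * k / g * (f / k).
Proof. by move=> g0 k0; field; rewrite g0 k0. Qed.

(** Writes a fraction as a multiple of [h / g] plus a remainder; [u] and [v] will be chosen so that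
    the numerator of the remainder vanishes on the curve. *)
Lemma divf_split (F : fieldType) (h g h' g' u v : F) : g != 0 -> g' != 0 ->
  v != 0 -> h' / g' = u / v * (h / g) + (h' * (g * v) - g' * (h * u)) / (g' * (g * v)).
Proof. by move=> g0 g0' v0; field; rewrite g0 g0' v0. Qed.

Section AtPrime.
Variable V : set (bipoint K).
Hypothesis Vprime : vanishing_prime V.
Hypothesis Vpad : pad_forms V.

Lemma nonvanishing1 : ~ vanishes_on V 1.
Proof.
have [h _ hV] := Vpad 0 0; move=> V1; apply: hV => x Vx.
by have /eqP := V1 x Vx; rewrite bieval1 oner_eq0.
Qed.

Lemma local_ring_frac d e (f g : MP) : bihomog d e f -> bihomog d e g ->
  ~ vanishes_on V g -> local_ring V (frac f / frac g).
Proof. by move=> fh gh gV; exists d, e, f, g. Qed.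

Definition num_ideal (P : MP -> Prop) : set {fraction MP} :=
  [set q | exists d e f g, [/\ bihomog d e f, bihomog d e g,
     ~ vanishes_on V g, P f & q = frac f / frac g]].

Lemma num_ideal_frac (P : MP -> Prop) d e (f g : MP) : P f -> bihomog d e f ->
  bihomog d e g -> ~ vanishes_on V g -> num_ideal P (frac f / frac g).
Proof. by move=> Pf fh gh gV; exists d, e, f, g. Qed.

Lemma num_ideal_scheme (P : MP -> Prop) S : P 0 ->
  (forall f g, P f -> P g -> P (f + g)) -> (forall f g, P f -> P (f * g)) ->
  (forall f, S f -> P f) -> scheme_local_ideals S V (num_ideal P).
Proof.
move=> P0 PD PM SP; split; last first.
  by move=> d e f g Sf fh gh gV; exact: (num_ideal_frac (SP _ Sf) fh gh gV).
split=> [q [d [e [f [g [fh gh gV _ ->]]]]]|||].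
- exact: (local_ring_frac fh gh gV).
- rewrite (_ : 0 = frac 0 / frac 1); last by rewrite tofrac0 mul0r.
  exact: (num_ideal_frac P0 (@bihomog0 K 0 0) (@bihomog1 K) nonvanishing1).
- move=> _ _ [d [e [f [g [fh gh gV Pf ->]]]]] [d' [e' [f' [g' [fh' gh' gV' Pf' ->]]]]].
  rewrite (divfD _ _ (tofrac_nonvanishing gV) (tofrac_nonvanishing gV')).
  rewrite -!tofracM -tofracD.
  apply: (@num_ideal_frac _ (d + d') (e + e')).
  + by apply: PD; apply: PM.
  + apply: bihomogD; first exact: bihomogM.
    by rewrite addnC [(e + _)%N]addnC; apply: bihomogM.
  + exact: bihomogM.
  + exact: (Vprime gh gh').
- move=> _ _ [d [e [f [g [fh gh gV ->]]]]] [d' [e' [f' [g' [fh' gh' gV' Pf' ->]]]]].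
  rewrite mulf_div -!tofracM.
  apply: (@num_ideal_frac _ (d + d') (e + e')); try exact: bihomogM.
    by rewrite mulrC; apply: PM.
  exact: (Vprime gh gh').
Qed.

(** Cross-multiplying two representations of one fraction puts [f * g'] in [P], and the first
    hypothesis cancels the nonvanishing [g']: membership can be read off any numerator. *)
Lemma num_idealP (P : MP -> Prop) d e (f g : MP) :
  (forall d e d' e' f g, bihomog d e f -> bihomog d' e' g ->
     ~ vanishes_on V g -> P (f * g) -> P f) ->
  (forall f g, P f -> P (f * g)) ->
  bihomog d e f -> bihomog d e g -> ~ vanishes_on V g ->
  num_ideal P (frac f / frac g) -> P f.
Proof.
move=> Psat PM fh gh gV [d' [e' [f' [g' [fh' gh' gV' Pf' /eqP]]]]].
rewrite (eqr_div _ _ (tofrac_nonvanishing gV) (tofrac_nonvanishing gV')).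
rewrite -!tofracM tofrac_eq => /eqP E.
by apply: (Psat _ _ _ _ f g' fh gh' gV'); rewrite E; apply: PM.
Qed.

Lemma num_ideal_vanishing W S : (forall f, S f -> vanishes_on W f) ->
  scheme_local_ideals S V (num_ideal (vanishes_on W)).
Proof.
apply: num_ideal_scheme.
- by move=> x _; rewrite /bieval meval0.
- by move=> f g fW gW x Wx; rewrite bievalD fW // gW // addr0.
- by move=> f g fW x Wx; rewrite bievalM fW // mul0r.
Qed.

Lemma num_ideal_vanishingT : num_ideal (vanishes_on V) `<` num_ideal setT.
Proof.
split=> [q [d [e [f [g [fh gh gV _ ->]]]]]|]; first by exists d, e, f, g.
have [h hh hV] := Vpad 0%N 0%N.
move=> /(_ (frac h / frac h)) H; apply: (hV).
apply: (@num_idealP (vanishes_on V) 0 0 h h _ _ hh hh hV).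
- move=> d e d' e' f g fh gh gV fgV.
  by apply: contrapT => fV; apply: (Vprime fh gh).
- by move=> f g fV x Vx; rewrite bievalM fV // mul0r.
- by apply: H; exists 0%N, 0%N, h, h.
Qed.

Section OneIdeal.
Variable J : set {fraction MP}.
Hypothesis Jideal : local_ideal V J.

Lemma local_idealD q r : J q -> J r -> J (q + r).
Proof. by case: Jideal => _ _ JD _; exact: JD. Qed.

Lemma local_idealM a q : local_ring V a -> J q -> J (a * q).
Proof. by case: Jideal => _ _ _; apply. Qed.

Lemma local_ideal1 : J 1 -> local_ring V `<=` J.
Proof. by move=> J1 a aV; rewrite -(mulr1 a); apply: local_idealM. Qed.

Lemma local_ideal_unit d e (f g : MP) : bihomog d e f -> bihomog d e g ->
  ~ vanishes_on V f -> ~ vanishes_on V g -> J (frac f / frac g) ->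
  local_ring V `<=` J.
Proof.
move=> fh gh fV gV Jfg; apply: local_ideal1.
rewrite (divf_unit (tofrac_nonvanishing fV) (tofrac_nonvanishing gV)).
by apply: (local_idealM _ Jfg); apply: (local_ring_frac gh fh).
Qed.

Lemma local_ideal_change d e d' e' (f g h g' : MP) :
  bihomog d e f -> bihomog d e g -> ~ vanishes_on V g ->
  bihomog d' e' h -> ~ vanishes_on V h ->
  bihomog (d' + d) (e' + e) g' -> ~ vanishes_on V g' ->
  J (frac (h * f) / frac g') -> J (frac f / frac g).
Proof.
move=> fh gh gV hh hV gh' gV' Jhf.
rewrite (divf_change _ (tofrac_nonvanishing gV) (tofrac_nonvanishing gV')
  (tofrac_nonvanishing hV)) -!tofracM.
apply: (local_idealM _ Jhf).
by apply: (local_ring_frac gh' (bihomogM hh gh)); exact: (Vprime hh gh).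
Qed.

End OneIdeal.

Variable S : set (bipoly K).

(* f defines a local section of the ideal sheaf of S at V. *)
Definition stalk d e (f : MP) := bihomog d e f /\
  forall J, scheme_local_ideals S V J -> forall g, bihomog d e g ->
    ~ vanishes_on V g -> J (frac f / frac g).

Lemma stalk_gen d e f : S f -> bihomog d e f -> stalk d e f.
Proof.
by move=> Sf fh; split=> // J [_ JS] g gh gV; apply: JS Sf fh gh gV.
Qed.

Lemma stalk0 d e : stalk d e 0.
Proof.
split; first exact: bihomog0.
by move=> J [[_ J0 _ _] _] g _ _; rewrite tofrac0 mul0r.
Qed.

Lemma stalkD d e f f' : stalk d e f -> stalk d e f' -> stalk d e (f + f').
Proof.
move=> [fh fJ] [fh' fJ']; split; first exact: bihomogD.
move=> J SJ g gh gV; rewrite tofracD mulrDl; apply: local_idealD; first by case: SJ.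
  exact: fJ.
exact: fJ'.
Qed.

Lemma stalkM d e d' e' h f : bihomog d' e' h -> stalk d e f ->
  stalk (d' + d) (e' + e) (h * f).
Proof.
move=> hh [fh fJ]; split; first exact: bihomogM.
move=> J SJ g gh gV; have [k kh kV] := Vpad d e; have [l lh lV] := Vpad d' e'.
rewrite tofracM (divf_scale _ _ (tofrac_nonvanishing gV) (tofrac_nonvanishing kV)).
rewrite -tofracM; have [JV _] := SJ; apply: (local_idealM JV); last exact: fJ.
by apply: (local_ring_frac _ gh gV); apply: bihomogM.
Qed.

(** A form that does not vanish on V is a unit at V. This is how factors are removed from the
    equations of Z_x along a component. *)
Lemma stalk_cancel d e d' e' h f : bihomog d' e' h -> ~ vanishes_on V h ->
  bihomog d e f -> stalk (d' + d) (e' + e) (h * f) -> stalk d e f.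
Proof.
move=> hh hV fh [_ hfJ]; split=> // J SJ g gh gV.
have [JV _] := SJ.
apply: (local_ideal_change JV fh gh gV hh hV (bihomogM hh gh)).
  exact: (Vprime hh gh).
by apply: hfJ => //; [exact: bihomogM|exact: (Vprime hh gh)].
Qed.

End AtPrime.

(* At the generic point of V, an ideal of forms that contains all the forms   *)
(* vanishing on V is the maximal ideal or the unit ideal.                     *)
Lemma multiplicity1 V S : irreducible_closed V ->
  (forall f, S f -> vanishes_on V f) ->
  (forall d e f, bihomog d e f -> vanishes_on V f -> stalk V S d e f) ->
  multiplicity S V 1.
Proof.
move=> Vi SV VS; have Vprime := irreducible_prime Vi.
have Vpad : pad_forms V.
  have [Vc [x Vx] _] := Vi; apply: (point_pad Vx).
  exact: closed_proper Vx.
split.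
  exists (fun i => if i is 0%N then num_ideal V (vanishes_on V) else num_ideal V setT).
  split=> [[|i] _|[|//] _]; last exact: num_ideal_vanishingT.
    exact: num_ideal_vanishing.
  exact: num_ideal_scheme.
move=> [F [FS Flt]].
have F1 : local_ring V `<=` F 1%N.
  have [_ /existsNP[q /not_implyP[F1q F0q]]] := Flt 0%N isT.
  have [JV _] := FS 1%N isT.
  have [/(_ q F1q)[d [e [f [g [fh gh gV qE]]]]] _ _ _] := JV.
  case: (pselect (vanishes_on V f)) => fV.
    by case: F0q; rewrite qE; have [_ h] := VS d e f fh fV; apply: h (FS 0%N isT) _ gh gV.
  by apply: (local_ideal_unit JV fh gh) => //; rewrite -qE.
have [_ /existsNP[q /not_implyP[F2q F1q]]] := Flt 1%N isT.
apply: F1q; apply: F1.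
by have [[F2V _ _ _] _] := FS 2%N isT; apply: F2V.
Qed.

End LocalIdeals.

(** * Intersection multiplicities *)

Section Curves.
Variable K : numClosedFieldType.
Local Notation MP := {mpoly K[2 + 3]}.
Local Notation frac := (@tofrac MP).
Implicit Types (V W T Z : set (bipoint K)) (S : set (bipoly K)).

Section LocalMultiplicity.
Variables (V : set (bipoint K)) (a b : nat) (c : curve_chart V a b).
Local Notation pt := (affine_point (chart_map c)).
Variable x : K.
Local Notation Vx := (point_class (pt x)).

Lemma vanishes_on_class d e f : bihomog d e f ->
  vanishes_on Vx f <-> (pull c f).[x] = 0.
Proof.
move=> fh; rewrite horner_pull; split=> [|f0 y sy]; last exact: (bieval_same fh sy f0).
by apply; apply: point_class_refl; apply: chart_proper_affine.
Qed.

Lemma XsubC_exp_cancel k (p q : {poly K}) : q.[x] != 0 ->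
  ('X - x%:P) ^+ k %| p * q -> ('X - x%:P) ^+ k %| p.
Proof.
move=> qx; rewrite Gauss_dvdpl //; apply: coprimep_expl.
by rewrite coprimep_sym coprimep_XsubC.
Qed.

(** Numerators of order at least [k] at [x]. They define [J_ k], the inverse image in the local ring
    of the product of the functions on V vanishing to order at least [k]. *)
Local Notation val_ge k := (fun f => ('X - x%:P) ^+ k %| pull c f).
Local Notation J_ k := (num_ideal Vx (val_ge k)).

Lemma class_prime : vanishing_prime Vx.
Proof. exact/irreducible_prime/point_class_irreducible/chart_proper_affine. Qed.

Lemma class_pad : pad_forms Vx.
Proof.
have xp := chart_proper_affine c x; apply: (point_pad _ xp).
exact: point_class_refl.
Qed.

Lemma val_idealP k d e (h g : MP) : bihomog d e h -> bihomog d e g ->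
  ~ vanishes_on Vx g -> J_ k (frac h / frac g) <-> ('X - x%:P) ^+ k %| pull c h.
Proof.
move=> hh gh gx; split=> [|hk]; last by exists d, e, h, g.
apply: (@num_idealP K Vx (val_ge k) _ _ _ _ _ _ hh gh gx) => [d1 e1 d2 e2 u v uh vh vx|u v].
  rewrite pullM; apply: XsubC_exp_cancel.
  by apply/eqP => /(vanishes_on_class vh).
by rewrite pullM; apply: dvdp_mulr.
Qed.

(** Modulo the forms vanishing on V, one element [h / g] of order exactly [k] generates all of
    [J_ k]. *)
Lemma val_ideal_sub (J : set {fraction MP}) S k d e (h g : MP) q :
  scheme_local_ideals S Vx J -> vanishing_forms V `<=` S ->
  bihomog d e h -> bihomog d e g -> ~ vanishes_on Vx g ->
  J (frac h / frac g) -> pull c h = ('X - x%:P) ^+ k * q -> q.[x] != 0 ->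
  J_ k `<=` J.
Proof.
move=> [JV JS] VS hh gh gx Jhg hE qx.
move=> _ [d' [e' [h' [g' [hh' gh' gx' /dvdpP[q' hE'] ->]]]]].
have px (m : MP) dm em : bihomog dm em m -> ~ vanishes_on Vx m -> (pull c m).[x] != 0.
  by move=> mh mx; apply/eqP => /(vanishes_on_class mh).
(* Large enough for both lifts, so that [u] and [v] have the same bidegree; on V the local function
   [u / v] is the quotient of [h' / g'] by [h / g]. *)
pose D := (size (q' * pull c g)%R + size (pull c g' * q)%R)%N.
have [u uh uE] : exists2 u, bihomog (D * chart_d c) (D * chart_e c) u &
    pull c u = q' * pull c g.
  by apply: pull_lift; exact: leqW (leq_addr _ _).
have [v vh vE] : exists2 v, bihomog (D * chart_d c) (D * chart_e c) v &
    pull c v = pull c g' * q.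
  by apply: pull_lift; exact: leqW (leq_addl _ _).
have vx : ~ vanishes_on Vx v.
  move/(vanishes_on_class vh)/eqP; rewrite vE hornerM mulf_eq0.
  by rewrite (negPf (px _ _ _ gh' gx')) (negPf qx).
have gv := class_prime gh vh gx vx.
have gv' := class_prime gh' (bihomogM gh vh) gx' gv.
rewrite (divf_split (frac h) _ (frac u) (tofrac_nonvanishing gx)
  (tofrac_nonvanishing gx') (tofrac_nonvanishing vx)) -!tofracM -tofracB.
apply: (local_idealD JV).
  by apply: (local_idealM JV _ Jhg); apply: (local_ring_frac uh vh).
have fh : bihomog (d' + (d + D * chart_d c)) (e' + (e + D * chart_e c))
    (h' * (g * v) - g' * (h * u)).
  by apply: bihomogB; apply: bihomogM => //; apply: bihomogM.
apply: (JS _ _ _ _ _ fh _ gv'); last by apply: bihomogM => //; apply: bihomogM.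
apply: VS; split; first by eexists; eexists; exact: fh.
apply/(pull_vanish c fh).
by rewrite pullB !pullM uE vE hE hE'; ring.
Qed.

(** The length is the order [n] of the root: the ideals [J_ k] with [k <= n] give a chain of length
    [n], and no chain is longer because each strict inclusion lowers the least order of an
    element. *)
Lemma point_multiplicity d e f n p : bihomog d e f ->
  pull c f = ('X - x%:P) ^+ n * p -> p.[x] != 0 ->
  multiplicity (divisor_section V f) Vx n.
Proof.
move=> fh fE px; set S := divisor_section V f.
have VS : vanishing_forms V `<=` S by move=> g gV; left.
have J_S k : (k <= n)%N -> scheme_local_ideals S Vx (J_ k).
  move=> kn; apply: (num_ideal_scheme class_prime class_pad).
  - by rewrite pull0 dvdp0.
  - by move=> g h gk hk; rewrite pullD dvdp_addr.
  - by move=> g h gk; rewrite pullM dvdp_mulr.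
  - move=> g [[[d' [e' gh]] /(pull_vanish c gh) ->]|->]; first exact: dvdp0.
    by rewrite fE dvdp_mulr // dvdp_exp2l.
have [o oh ox] := class_pad 0%N 0%N.
split.
  exists (fun i => J_ (n - i)%N); split=> [i _|i lin]; first exact/J_S/leq_subr.
  split=> [_ [d' [e' [h [g [hh gh gx hk ->]]]]]|].
    exists d', e', h, g; split=> //; apply: dvdp_trans hk; apply: dvdp_exp2l; lia.
  have [h hh hE] : exists2 h, bihomog (n * chart_d c) (n * chart_e c) h &
      pull c h = ('X - x%:P) ^+ (n - i.+1).
    by apply: pull_lift; rewrite size_exp_XsubC; lia.
  have [g gh gx] := class_pad (n * chart_d c)%N (n * chart_e c)%N.
  move=> /(_ (frac h / frac g)) H.
  have : J_ (n - i)%N (frac h / frac g) by apply: H; apply/(val_idealP _ hh); rewrite ?hE.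
  move/(val_idealP _ hh gh gx); rewrite hE => le_n.
  have := dvdp_leq (expf_neq0 _ (monic_neq0 (monicXsubC x))) le_n.
  by rewrite !size_exp_XsubC; lia.
move=> [F [FS Flt]].
(* An element of [F i.+1] outside [F i] has order below [n - i], hence generates at least
   [J_ (n - i.+1)]. *)
have FJ i : (i <= n)%N -> J_ (n - i)%N `<=` F i.
  elim: i => [_|i IH lin].
    rewrite subn0; have [g gh gx] := class_pad d e.
    apply: (val_ideal_sub (FS 0%N isT) VS fh gh gx _ fE px).
    by have [_] := FS 0%N isT; apply; [right|exact: fh|exact: gh|exact: gx].
  have lin1 : (i < n.+1)%N by lia.
  have [_ /existsNP[q /not_implyP[Fq Fq']]] := Flt i lin1.
  have Si : (i.+1 <= n.+1)%N by lia.
  have [[/(_ q Fq)[d' [e' [h [g [hh gh gx qE]]]]] _ _ _] _] := FS i.+1 Si.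
  have [k [r rx hE]] := multiplicity_XsubC (pull c h) x.
  have hk : ~~ (('X - x%:P) ^+ (n - i) %| pull c h).
    apply/negP => hk; apply: Fq'; apply: IH; first lia.
    by rewrite qE; apply/(val_idealP _ hh gh gx).
  have h0 : pull c h != 0 by apply: contraNneq hk => ->; rewrite dvdp0.
  rewrite h0 /= in rx.
  have kn : (k <= n - i.+1)%N.
    suff : (k < n - i)%N by lia.
    rewrite ltnNge; apply: contraNN hk => nik; rewrite hE dvdp_mull //.
    exact: dvdp_exp2l.
  apply: (@subset_trans _ (J_ k)).
    move=> _ [d2 [e2 [h2 [g2 [hh2 gh2 gx2 hk2 ->]]]]]; exists d2, e2, h2, g2; split=> //.
    by apply: dvdp_trans hk2; apply: dvdp_exp2l.
  apply: (val_ideal_sub (FS i.+1 Si) VS hh gh gx _ _ rx); first by rewrite -qE.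
  by rewrite hE mulrC.
have [_ /existsNP[q /not_implyP[Fq Fq']]] := Flt n (ltnSn n).
apply: Fq'; apply: (FJ n (leqnn n)).
have [[/(_ q Fq)[d' [e' [h [g [hh gh gx ->]]]]] _ _ _] _] := FS n.+1 (leqnn _).
by exists d', e', h, g; split=> //; rewrite subnn expr0 dvd1p.
Qed.

End LocalMultiplicity.
End Curves.

(** * Numerical classes of curves parametrized by the projective line *)

Section ParametrizedCurves.
Variable K : numClosedFieldType.
Implicit Types (V W T Z : set (bipoint K)) (S : set (bipoly K)).

(* V is parametrized by P^1 in bidegree (a,b); any of its points can be put   *)
(* at infinity.                                                               *)
Definition param_curve V a b := V !=set0 /\
  forall y, V y ->
    exists c : curve_chart V a b, same_bipoint (infinite_point a b (chart_map c)) y.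

Section OneCurve.
Variables (V : set (bipoint K)) (a b : nat).
Hypothesis Vab : param_curve V a b.

Lemma param_curve_chart : exists c : curve_chart V a b, True.
Proof. by have [[y Vy] /(_ y Vy)[c _]] := Vab; exists c. Qed.

Lemma param_curve_irreducible : irreducible_closed V.
Proof. by have [c _] := param_curve_chart; exact: chart_irreducible c. Qed.

Lemma param_curve_closed : closed_subset V.
Proof. by case: param_curve_irreducible. Qed.

(** With a point where [f] is nonzero at infinity, all zeros of [f] on V are affine and the
    pull-back has its full degree. *)
Lemma chart_avoiding d e f : bihomog d e f -> ~ vanishes_on V f ->
  exists c : curve_chart V a b, bieval (infinite_point a b (chart_map c)) f != 0.
Proof.
move=> fh /existsNP[y /not_implyP[Vy /eqP fy]].
have [c cy] := Vab.2 y Vy; exists c; apply: contraNneq fy => f0.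
by rewrite (bieval_same fh cy f0).
Qed.

Lemma irreducible_sub_curve T : irreducible_closed T -> T `<=` V ->
  T = V \/ exists2 y, V y & T = point_class y.
Proof.
move=> Ti TV; have [[S [hS TE]] T0 _] := Ti.
case: (pselect (V `<=` T)) => [VT|VT]; [left|right]; first by apply/seteqP.
have [f Sf fV] : exists2 f, S f & ~ vanishes_on V f.
  apply: contrapT => nf; apply: VT => y Vy; rewrite TE.
  have [y1 y2] := closed_proper param_curve_closed Vy.
  split=> // f Sf; apply: contrapT => fy; apply: nf; exists f => //.
  by move=> /(_ y Vy).
have [d [e fh]] := hS f Sf; have [c coo] := chart_avoiding fh fV.
have [|x -> _] := irreducible_sub_zero fh coo Ti TV.
  by rewrite TE => y [_ _]; apply.
by exists (affine_point (chart_map c) x) => //; exact: chart_affine.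
Qed.

Lemma param_curve_krull_dim : krull_dim V 1.
Proof.
have [c _] := param_curve_chart; have Vi := param_curve_irreducible.
pose pt := affine_point (chart_map c).
have ptp := chart_proper_affine c.
split.
  exists (fun i => if i is 0%N then point_class (pt 0) else V); split=> [[|i] _|[|//] _].
  - split; first exact: point_class_irreducible.
    by apply: closed_class; [exact: chart_closed c|exact: chart_affine].
  - by split.
  - split=> [|/(_ (pt 1) (chart_affine c 1))/affine_point_inj/eqP].
      by apply: closed_class; [exact: chart_closed c|exact: chart_affine].
    by rewrite eq_sym oner_eq0.
move=> [F [FV Flt]].
have [F1i F1V] := FV 1%N isT; have [F2i F2V] := FV 2%N isT.
have [[F0c F00 _] _] := FV 0%N isT; have [F01 F10] := Flt 0%N isT.
have [F12 F21] := Flt 1%N isT.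
have [F1E|[y Vy F1E]] := irreducible_sub_curve F1i F1V.
  by apply: F21; rewrite F1E.
apply: F10; rewrite F1E -(closed_sub_class (x := y) F0c F00) // => z F0z.
by have := F01 z F0z; rewrite F1E.
Qed.

Lemma zeros_divisor_section d e f : bihomog d e f ->
  zeros (divisor_section V f) = [set y | V y /\ bieval y f = 0].
Proof.
move=> fh; apply/seteqP; split=> y.
  move=> [y1 y2 yS]; split; last by apply: yS; right.
  have [S [hS VE]] := param_curve_closed; rewrite VE; split=> // g Sg.
  apply: yS; left; split; first exact: hS.
  by move=> x; rewrite VE => -[_ _]; apply.
move=> [Vy fy]; have [y1 y2] := closed_proper param_curve_closed Vy.
by split=> // g [[_]|-> //]; apply.
Qed.

Lemma components_divisor_section d e f : bihomog d e f -> ~ vanishes_on V f ->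
  components (zeros (divisor_section V f)) =
  [set T | exists2 y, V y /\ bieval y f = 0 & T = point_class y].
Proof.
move=> fh fV; rewrite (zeros_divisor_section fh); apply/seteqP; split=> T.
  move=> [Ti TZ _]; have TV : T `<=` V by move=> y /TZ[].
  have [TE|[y Vy TE]] := irreducible_sub_curve Ti TV.
    by case: fV; rewrite -TE => y /TZ[].
  exists y => //; apply: TZ; rewrite TE; apply: point_class_refl.
  exact: closed_proper param_curve_closed Vy.
move=> [y [Vy fy] ->]; have yp := closed_proper param_curve_closed Vy.
split; first exact: point_class_irreducible.
  move=> z yz; split; first exact: (closed_same param_curve_closed Vy yz).
  exact: (bieval_same fh yz fy).
move=> T' T'i yT' T'Z; have T'V : T' `<=` V by move=> z /T'Z[].
have [TE|[z Vz TE]] := irreducible_sub_curve T'i T'V.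
  by case: fV; rewrite -TE => z /T'Z[].
have : T' y by apply/yT'/point_class_refl.
by rewrite TE => zy; apply: point_class_eq.
Qed.

(** In a chart whose infinite point is not a zero of [f], the pull-back has degree exactly
    [a * d + b * e]; its distinct roots are the points of the intersection and their multiplicities
    the local lengths. *)
Lemma param_curve_intersection d e f : bihomog d e f -> ~ vanishes_on V f ->
  intersection_number f V (a * d + b * e)%N%:Z.
Proof.
move=> fh fV; have [c coo] := chart_avoiding fh fV.
have [r fE] := closed_field_poly_normal (pull c f).
have f0 := pull_neq0 fh coo.
have l0 : lead_coef (pull c f) != 0 by rewrite lead_coef_eq0.
have rootE x : root (pull c f) x = (x \in r).
  by rewrite fE rootZ // root_prod_XsubC.
have size_r : size r = (a * d + b * e)%N.
  have [sf cf] := size_pull c fh.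
  have : size (pull c f) = (size r).+1.
    by rewrite fE size_scale // size_prod_XsubC.
  move=> sr; apply/eqP; rewrite eqn_leq -ltnS -sr sf /=.
  rewrite leqNgt; apply/negP => lt; move: coo; rewrite -cf nth_default ?eqxx //.
  by rewrite sr.
pose cls x := point_class (affine_point (chart_map c) x).
exists [seq ((count_mem x r)%:Z, cls x) | x <- undup r]; last first.
  rewrite big_map /= -size_r -(big_morph Posz PoszD (erefl 0%:Z)); congr Posz.
  rewrite -sum1_size -big_undup_iterop_count; apply: eq_bigr => x _.
  by case: (count_mem x r) => // n; elim: n => //= n ->; rewrite add1n.
split.
- rewrite -map_comp map_inj_in_uniq ?undup_uniq // => x y _ _ /= xy.
  apply: (@affine_point_inj _ _ _ _ c); rewrite -[same_bipoint _ _]/(cls x _) xy.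
  exact/point_class_refl/chart_proper_affine.
- move=> T; rewrite (components_divisor_section fh fV) -map_comp; split.
    move=> [y [Vy fy] ->]; have [x sy xr] := zero_affine fh coo Vy fy.
    apply/mapP; exists x; first by rewrite mem_undup -rootE.
    exact/esym/point_class_eq.
  case/mapP=> x; rewrite mem_undup -rootE => /rootP fx ->.
  exists (affine_point (chart_map c) x) => //; split; first exact: chart_affine.
  by rewrite -horner_pull.
move=> _ /mapP[x xr ->]; exists (count_mem x r) => //=.
apply: (@point_multiplicity _ _ _ _ c x _ _ _ _
  (lead_coef (pull c f) *: \prod_(z <- r | z != x) ('X - z%:P)) fh).
  rewrite {1}fE -scalerAr; congr (_ *: _).
  rewrite (bigID (pred1 x)) /=; congr (_ * _).
  rewrite (eq_bigr (fun=> 'X - x%:P)) => [|z /eqP ->//].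
  by rewrite big_const_seq iter_mulr_1.
rewrite hornerZ mulf_neq0 // horner_prod; rewrite prodf_seq_neq0; apply/allP => z _; apply/implyP => zx.
by rewrite hornerXsubC subr_eq0 eq_sym.
Qed.

End OneCurve.

(** Each curve meets a form of bidegree (d, e) in a number linear in its own bidegree, so only the
    two weighted sums of the bidegrees matter. *)
Lemma num_equiv_classes (c c' : Defs.cycle K) (kl kl' : set (bipoint K) -> nat * nat) :
  (forall t, t \in c -> param_curve t.2 (kl t.2).1 (kl t.2).2) ->
  (forall t, t \in c' -> param_curve t.2 (kl' t.2).1 (kl' t.2).2) ->
  \sum_(t <- c) t.1 * ((kl t.2).1)%:Z = \sum_(t <- c') t.1 * ((kl' t.2).1)%:Z ->
  \sum_(t <- c) t.1 * ((kl t.2).2)%:Z = \sum_(t <- c') t.1 * ((kl' t.2).2)%:Z ->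
  num_equiv c c'.
Proof.
move=> cp cp' e1 e2 d e f fh fc fc'.
pose s (x : Defs.cycle K) (k : set (bipoint K) -> nat * nat) :=
  \sum_(t <- x) t.1 * ((k t.2).1 * d + (k t.2).2 * e)%N%:Z.
have sE x k : s x k = (\sum_(t <- x) t.1 * ((k t.2).1)%:Z) * d%:Z +
    (\sum_(t <- x) t.1 * ((k t.2).2)%:Z) * e%:Z.
  rewrite !mulr_suml -big_split; apply: eq_bigr => t _ /=.
  by rewrite PoszD !PoszM mulrDr !mulrA.
exists (s c kl).
  exists (fun V => ((kl V).1 * d + (kl V).2 * e)%N%:Z) => // t tc.
  by apply: param_curve_intersection fh (fc t tc); exact: cp.
rewrite sE e1 e2 -sE.
exists (fun V => ((kl' V).1 * d + (kl' V).2 * e)%N%:Z) => // t tc.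
by apply: param_curve_intersection fh (fc' t tc); exact: cp'.
Qed.

End ParametrizedCurves.

(** * Graphs and lines *)

Section CurveFamilies.
Variable K : numClosedFieldType.
Local Notation MP := {mpoly K[2 + 3]}.

(** Fibers of the second projection are the graphs of constant maps ([fiber_pr2_graph]), so graphs
    and lines in fibers account for all components. *)
Definition graph (beta : 'I_3 -> {mpoly K[2]}) : set (bipoint K) :=
  [set x | [/\ x.1 != 0, x.2 != 0 & (x.2 <= eval_row beta x.1)%MS]].

Definition lift_s (p : {mpoly K[2]}) : MP :=
  mmap (@mpolyC (2 + 3) K) (fun i : 'I_2 => 'X_(lshift 3 i)) p.

Lemma bieval_lift_s x p : bieval x (lift_s p) = p.@[x.1 0].
Proof. by rewrite /bieval meval_mmapC; apply: meval_eq => i; exact: bieval_lX. Qed.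

Lemma bihomog_lift_s n p : p \is n.-homog -> bihomog n 0 (lift_s p).
Proof.
move=> /dhomogP ph; rewrite /lift_s /mmap big_seq; apply: bihomog_sum => m mp.
have <- : mdeg m = n := ph m mp.
rewrite mul_mpolyC; apply: bihomogZ; rewrite /mmap1 mdegE.
apply: (big_ind2 (fun a g => bihomog a 0 g)) => [||i _].
- exact: bihomog1.
- by move=> a f b g fh gh; apply: (bihomogM fh gh).
- by have := @bihomogXn K _ _ _ (m i) (@bihomog_lX K i); rewrite muln1 muln0.
Qed.

Lemma eval_row_scale m k n (f : 'I_k -> {mpoly K[m]}) c (u : 'rV[K]_m) :
  (forall i, f i \is n.-homog) -> eval_row f (c *: u) = c ^+ n *: eval_row f u.
Proof.
move=> fh; apply/rowP => i; rewrite !mxE !mevalE mulr_sumr.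
apply: eq_big_seq => p pf; have <- : mdeg p = n := dhomogP _ _ _ (fh i) p pf.
rewrite mulrCA; congr (_ * _).
by rewrite mdegE -prodrXr -big_split; apply: eq_bigr => j _; rewrite mxE exprMn.
Qed.

Definition line_map m (Q : 'M[K]_(2, m)) (i : 'I_m) : {poly K} :=
  (Q 0 i)%:P + Q 1 i *: 'X.

Lemma size_line_map m (Q : 'M[K]_(2, m)) i : (size (line_map Q i) <= 2)%N.
Proof.
apply: (leq_trans (size_polyD _ _)); rewrite geq_max (leq_trans (size_polyC_leq1 _)) //.
by rewrite (leq_trans (size_scale_leq _ _)) // size_polyX.
Qed.

Lemma coef1_line_map m (Q : 'M[K]_(2, m)) i : (line_map Q i)`_1 = Q 1 i.
Proof. by rewrite coefD coefC coefZ coefX mulr1 add0r. Qed.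

Lemma horner_line_map m (Q : 'M[K]_(2, m)) x i :
  (line_map Q i).[x] = (row 0 Q + x *: row 1 Q) 0 i.
Proof. by rewrite !mxE hornerD hornerC hornerZ hornerX mulrC. Qed.

Lemma ord2P (P : 'I_2 -> Prop) : P 0 -> P 1 -> forall i, P i.
Proof.
move=> P0 P1 [[|[|//]] lt]; [move: P0|move: P1]; congr P; exact: val_inj.
Qed.

(** A right inverse of [Q] provides the linear forms that serve as [chart0] and [chart1]. *)
Lemma line_map_coord m (Q : 'M[K]_(2, m)) (D : 'M[K]_(m, 2)) : Q *m D = 1%:M ->
  \sum_i (D i 0)%:P * line_map Q i = 1 /\ \sum_i (D i 1)%:P * line_map Q i = 'X.
Proof.
move=> QD.
have E k : \sum_i (D i k)%:P * line_map Q i = ((Q *m D) 0 k)%:P + (Q *m D) 1 k *: 'X.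
  rewrite !mxE scaler_suml rmorph_sum /= -big_split /=; apply: eq_bigr => i _.
  by rewrite mulrDr -!polyCM mul_polyC scalerA mulrC [D i k * _]mulrC.
rewrite !E QD !mxE /=; split; first by rewrite scale0r addr0.
by rewrite scale1r add0r.
Qed.

Lemma row_mul2 m (Q : 'M[K]_(2, m)) (z : 'rV[K]_2) :
  z *m Q = z 0 0 *: row 0 Q + z 0 1 *: row 1 Q.
Proof.
apply/rowP => i; rewrite !mxE !big_ord_recl big_ord0 addr0.
by rewrite (_ : lift _ _ = 1) //; apply: val_inj.
Qed.

Lemma line_span m (Q : 'M[K]_(2, m)) (z : 'rV[K]_2) : row_free Q -> z != 0 ->
  same_point (row 1 Q) (z *m Q) \/
  exists x, same_point (row 0 Q + x *: row 1 Q) (z *m Q).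
Proof.
move=> Qf z0.
have comb (c d : K) : (c, d) != (0, 0) -> c *: row 0 Q + d *: row 1 Q != 0.
  pose y : 'rV[K]_2 := \row_i (if i == 0 then c else d).
  rewrite (_ : _ + _ = y *m Q); last by rewrite row_mul2 !mxE.
  apply: contraNneq => /eqP; rewrite mulmx_free_eq0 // => /eqP/rowP y0.
  by have := y0 0; have := y0 1; rewrite !mxE /= => -> ->.
have [z00|z00] := eqVneq (z 0 0) 0; [left|right].
  split; first by have := comb 0 1; rewrite scale0r scale1r add0r; apply; rewrite xpair_eqE oner_eq0 andbF.
  exists (z 0 1); last by rewrite row_mul2 z00 scale0r add0r.
  by apply: contraNneq z0 => z01; apply/eqP/rowP; apply: ord2P; rewrite mxE.
exists (z 0 1 / z 0 0); split.
  by rewrite -[row 0 Q]scale1r; apply: comb; rewrite xpair_eqE oner_eq0.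
by exists (z 0 0) => //; rewrite row_mul2 scalerDr scalerA mulrCA divff // mulr1.
Qed.

Lemma row_free_rows m (Q : 'M[K]_(2, m)) x : row_free Q ->
  row 1 Q != 0 /\ row 0 Q + x *: row 1 Q != 0.
Proof.
move=> Qf; split.
  rewrite rowE mulmx_free_eq0 //; apply/eqP => /rowP/(_ 1)/eqP.
  by rewrite !mxE /= oner_eq0.
rewrite !rowE scalemxAl -mulmxDl mulmx_free_eq0 //; apply/eqP => /rowP/(_ 0)/eqP.
by rewrite !mxE /= mulr0 addr0 oner_eq0.
Qed.

(** Row 1 is the leading coefficient of [line_map Q], so this frame places [w] at infinity. *)
Lemma complete_row m (w : 'rV[K]_m) (U : 'M[K]_m) : w != 0 -> (1 < \rank U)%N ->
  (w <= U)%MS ->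
  exists Q : 'M[K]_(2, m), [/\ row_free Q, row 1 Q = w & (Q <= U)%MS].
Proof.
move=> w0 rU wU.
have [i iw] : exists i, ~~ (row i U <= w)%MS.
  apply/row_subPn; apply: contraL rU => /mxrankS; rewrite rank_rV w0 -leqNgt.
  exact.
pose Q : 'M[K]_(2, m) := \matrix_k (if k == 0 then row i U else w).
have Q0 : row 0 Q = row i U by rewrite rowK.
have Q1 : row 1 Q = w by rewrite rowK.
exists Q; split=> //.
  rewrite -row_leq_rank.
  have wQ : (w < Q)%MS.
    rewrite ltmxE -{1}Q1 row_sub; apply: contra iw => /(submx_trans _); apply.
    by rewrite -Q0 row_sub.
  by have := rank_ltmx wQ; rewrite rank_rV w0.
by apply/row_subP; apply: ord2P; rewrite ?Q0 ?Q1 // row_sub.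
Qed.

Section Graph.
Variables (n : nat) (beta : 'I_3 -> {mpoly K[2]}).
Hypothesis beta_homog : forall j, beta j \is n.-homog.
Hypothesis beta_neq0 : forall u, u != 0 -> eval_row beta u != 0.

Lemma graphP x : graph beta x <-> x.1 != 0 /\ same_point (eval_row beta x.1) x.2.
Proof.
split=> [[x1 x2 /sub_rVP[c xE]]|[x1 sx]].
  split=> //; split; first exact: beta_neq0.
  by exists c => //; apply: contraNneq x2 => c0; rewrite xE c0 scale0r.
split=> //; first exact: same_point_neq0 sx.
by case: sx => _ [c _ ->]; exact: scalemx_sub.
Qed.

Definition graph_eq i j : MP :=
  'X_(rshift 2 i) * lift_s (beta j) - 'X_(rshift 2 j) * lift_s (beta i).

Lemma bihomog_graph_eq i j : bihomog n 1 (graph_eq i j).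
Proof.
by apply: bihomogB; have := bihomogM (@bihomog_rX K _) (bihomog_lift_s (beta_homog _));
  rewrite add0n addn0; apply.
Qed.

Lemma bieval_graph_eq i j x : bieval x (graph_eq i j) =
  x.2 0 i * eval_row beta x.1 0 j - x.2 0 j * eval_row beta x.1 0 i.
Proof. by rewrite bievalB !bievalM !bieval_rX !bieval_lift_s !mxE. Qed.

Lemma graph_eqP x : proper_point x ->
  graph beta x <-> forall i j, bieval x (graph_eq i j) = 0.
Proof.
move=> [x1 x2]; split=> [/graphP[_ sx] i j|x0].
  by apply/eqP; rewrite bieval_graph_eq subr_eq0; apply/eqP/same_point_minor.
apply/graphP; split=> //; apply: same_pointP => // [|i j]; first exact: beta_neq0.
by apply/eqP; rewrite -subr_eq0 -bieval_graph_eq x0.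
Qed.

Lemma graph_closed : closed_subset (graph beta).
Proof.
apply: closed_vanishing => [x xp xf|x []//].
apply/(graph_eqP xp) => i j; apply: (xf n 1%N); first exact: bihomog_graph_eq.
move=> y yV; have yp : proper_point y by case: yV.
exact: (iffLR (graph_eqP yp) yV i j).
Qed.

Lemma graph_point u : u != 0 -> graph beta (u, eval_row beta u).
Proof.
by move=> u0; apply/graphP; split=> //; apply/same_point_refl/beta_neq0.
Qed.

Lemma graph_same u x : same_point u x.1 -> graph beta x ->
  same_bipoint (u, eval_row beta u) x.
Proof.
move=> ux /graphP[_ sx]; split=> //=; apply: same_point_trans sx.
have [u0 [c c0 ->]] := ux; rewrite (eval_row_scale _ _ beta_homog).
by split; [exact: beta_neq0|exists (c ^+ n); rewrite ?expf_neq0].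
Qed.

Definition graph_map (Q : 'M[K]_2) (i : 'I_(2 + 3)) : {poly K} :=
  match split i with
  | inl i => line_map Q i
  | inr j => mmap (@polyC K) (line_map Q) (beta j)
  end.

Lemma graph_affine Q x : affine_point (graph_map Q) x =
  (row 0 Q + x *: row 1 Q, eval_row beta (row 0 Q + x *: row 1 Q)).
Proof.
congr (_, _); apply/rowP => i; rewrite mxE /graph_map.
  by rewrite (unsplitK (inl i)) horner_line_map.
rewrite (unsplitK (inr i)) horner_mmap [RHS]mxE; apply: meval_eq => k.
exact: horner_line_map.
Qed.

Lemma size_graph_map Q i : (size (graph_map Q i) <= (weight 1 n i).+1)%N /\
  infinite_point 1 n (graph_map Q) = (row 1 Q, eval_row beta (row 1 Q)).
Proof.
have bw j : forall m, m \in msupp (beta j) -> (\sum_k 1 * m k)%N = n.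
  move=> m mb; have <- : mdeg m = n := dhomogP _ _ _ (beta_homog j) m mb.
  rewrite mdegE.
  by apply: eq_bigr => k _; rewrite mul1n.
have sz j := size_mmap_weight (bw j) (fun k => size_line_map Q k).
split.
  rewrite /graph_map /weight; case: (split i) => j; first exact: size_line_map.
  by case: (sz j).
congr (_, _); apply/rowP => j; rewrite !mxE /graph_map.
  by rewrite (unsplitK (inl j)) coef1_line_map.
rewrite (unsplitK (inr j)) (sz j).2; apply: meval_eq => k.
by rewrite coef1_line_map mxE.
Qed.

Lemma mmap_coord_l (Q : 'M[K]_2) (D : 'M[K]_2) k :
  mmap (@polyC K) (graph_map Q) (\sum_i D i k *: 'X_(lshift 3 i)) =
  \sum_i (D i k)%:P * line_map Q i.
Proof.
rewrite rmorph_sum; apply: eq_bigr => i _ /=.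
by rewrite mmapZ mmapX mmap1U /graph_map (unsplitK (inl i)).
Qed.

(** Parametrize P^1 with the given point at infinity and apply [beta]; the first projection inverts
    this map and supplies the chart forms. *)
Lemma graph_param_curve : param_curve (graph beta) 1 n.
Proof.
split.
  exists (delta_mx 0 0, eval_row beta (delta_mx 0 0)); apply: graph_point.
  by apply/eqP => /rowP/(_ 0)/eqP; rewrite !mxE oner_eq0.
move=> y /graphP[y1 y2].
have [||Q [Qf Q1 _]] := @complete_row 2 y.1 1%:M y1; rewrite ?mxrank1 ?submx1 //.
have [D QD] : exists D, Q *m D = 1%:M by apply/row_freeP.
have DQ : D *m Q = 1%:M by apply: mulmx1C.
have [c0 c1] := line_map_coord QD.
have [_ oo] := size_graph_map Q ord0.
have cov z : graph beta z -> same_bipoint (infinite_point 1 n (graph_map Q)) z \/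
    exists x, same_bipoint (affine_point (graph_map Q) x) z.
  move=> gz; have /graphP[z1 z2] := gz.
  have z1E : z.1 = z.1 *m D *m Q by rewrite -mulmxA DQ mulmx1.
  have zD : z.1 *m D != 0 by apply: contraNneq z1 => z0; rewrite z1E z0 mul0mx.
  have [|[x]] := line_span Qf zD; rewrite -z1E => sz; [left|right].
    by rewrite oo; apply: graph_same.
  by exists x; rewrite graph_affine; apply: graph_same.
have hX k : bihomog 1 0 (\sum_i D i k *: 'X_(lshift 3 i) : MP).
  by apply: bihomog_sum => i _; apply/bihomogZ/bihomog_lX.
exists (@CurveChart K (graph beta) 1 n (graph_map Q) 1 0 _ _
  (fun i => (size_graph_map Q i).1) (hX 0) (hX 1)
  (etrans (mmap_coord_l Q D 0) c0) (etrans (mmap_coord_l Q D 1) c1) graph_closed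
  (fun x => eq_ind_r (graph beta) (graph_point (row_free_rows x Qf).2) (graph_affine Q x))
  (eq_ind_r (graph beta) (graph_point (row_free_rows 0 Qf).1) oo) cov).
by rewrite /= oo; apply: graph_same; [rewrite Q1; exact: same_point_refl|apply/graphP].
Qed.

Lemma dhomog_X m i : ('X_i : {mpoly K[m]}) \is 1.-homog.
Proof. by rewrite dhomogX; apply/eqP; exact: mdeg1. Qed.

Lemma eval_rowX m (u : 'rV[K]_m) : eval_row (fun i => 'X_i) u = u.
Proof. by apply/rowP => i; rewrite mxE mevalXU. Qed.

Lemma graph_isomorphic : isomorphic (@P1 K) (graph beta).
Proof.
exists (fun u => (u, eval_row beta u)), fst; split.
- move=> u u0; exists 1%N, n, (fun i => 'X_i), beta; rewrite eval_rowX; split=> //.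
  + by split=> // i; exact: dhomog_X.
  + exact: beta_neq0.
  + by move=> u' u'0 _ b0; rewrite eval_rowX; split; apply: same_point_refl.
- move=> y [y1 y2 _]; exists 1%N, 0%N, (fun i => 'X_(lshift 3 i)).
  have E (z : bipoint K) : bieval_row (fun i => 'X_(lshift 3 i)) z = z.1.
    by apply/rowP => i; rewrite mxE bieval_lX.
  split; [exact: bihomog_lX|by rewrite E|].
  by move=> y' [y1' _ _] _; rewrite E; apply: same_point_refl.
- by move=> u u0; split; [exact: graph_point|exact: same_point_refl].
- move=> y gy; split; first by case: gy.
  apply: same_bipoint_sym; apply: graph_same => //.
  by apply: same_point_refl; case: gy.
Qed.

End Graph.

Lemma fiber_pr2_graph (b : 'rV[K]_3) :
  [set x | [/\ x.1 != 0, x.2 != 0 & (x.2 <= b)%MS]] =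
  graph (fun j => (b 0 j)%:MP).
Proof.
have evE (u : 'rV[K]_2) : eval_row (fun j => (b 0 j)%:MP) u = b.
  by apply/rowP => j; rewrite mxE mevalC.
by apply/seteqP; split=> x [x1 x2 xb]; split=> //; move: xb; rewrite evE.
Qed.

Lemma dhomog_C m (k : K) : (k%:MP : {mpoly K[m]}) \is 0.-homog.
Proof. by rewrite -alg_mpolyC; apply: dhomogZ; exact: dhomog1. Qed.

Definition line (a : 'rV[K]_2) (h : 'cV[K]_3) : set (bipoint K) :=
  [set x | [/\ x.1 != 0, x.2 != 0, (x.1 <= a)%MS & x.2 *m h = 0]].

Lemma rank_ker_col (h : 'cV[K]_3) : h != 0 -> \rank (kermx h) = 2%N.
Proof. by move=> h0; rewrite mxrank_ker -mxrank_tr rank_rV trmx_eq0 h0. Qed.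

Lemma ker_col_neq0 (h : 'cV[K]_3) : h != 0 -> exists2 t : 'rV[K]_3, t != 0 & (t <= kermx h)%MS.
Proof.
move=> h0; have : kermx h != 0 by rewrite -mxrank_eq0 rank_ker_col.
by case/rowV0Pn => t tk t0; exists t.
Qed.

Section Line.
Variables (a : 'rV[K]_2) (h : 'cV[K]_3).
Hypotheses (a0 : a != 0) (h0 : h != 0).

Lemma line_same x : line a h x -> same_point a x.1.
Proof.
move=> [x1 _ /sub_rVP[c xE] _]; split=> //; exists c => //.
by apply: contraNneq x1 => c0; rewrite xE c0 scale0r.
Qed.

Lemma line_closed : closed_subset (line a h).
Proof.
apply: closed_vanishing => [x [x1 x2] xf|x []//].
split=> //.
  have sx : same_point a x.1.
    apply: same_pointP => // i j; apply/eqP; rewrite -subr_eq0; apply/eqP.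
    pose f : MP := a 0 j *: 'X_(lshift 3 i) - a 0 i *: 'X_(lshift 3 j).
    have fE z : bieval z f = z.1 0 i * a 0 j - z.1 0 j * a 0 i.
      by rewrite bievalB !bievalZ !bieval_lX; ring.
    rewrite -fE; apply: (xf 1 0)%N => [|z /line_same az].
      by apply: bihomogB; apply/bihomogZ/bihomog_lX.
    by apply/eqP; rewrite fE subr_eq0; apply/eqP/same_point_minor.
  by case: sx => _ [c _ ->]; exact: scalemx_sub.
pose f : MP := \sum_j h j 0 *: 'X_(rshift 2 j).
have fE z : (bieval z f)%:M = z.2 *m h.
  rewrite [RHS]mx11_scalar; congr _%:M; rewrite bieval_sum mxE.
  by apply: eq_bigr => j _; rewrite bievalZ bieval_rX mulrC.
rewrite -fE (xf 0 1)%N ?raddf0 // => [|z [_ _ _ zh]].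
  by apply: bihomog_sum => j _; apply/bihomogZ/bihomog_rX.
by move/matrixP: (fE z) => /(_ 0 0); rewrite zh !mxE.
Qed.

Definition fiber_map (Q : 'M[K]_(2, 3)) (i : 'I_(2 + 3)) : {poly K} :=
  match split i with inl i => (a 0 i)%:P | inr j => line_map Q j end.

Lemma fiber_affine Q x :
  affine_point (fiber_map Q) x = (a, row 0 Q + x *: row 1 Q).
Proof.
congr (_, _); apply/rowP => i; rewrite mxE /fiber_map.
  by rewrite (unsplitK (inl i)) hornerC.
by rewrite (unsplitK (inr i)) horner_line_map.
Qed.

Lemma fiber_infinite Q : infinite_point 0 1 (fiber_map Q) = (a, row 1 Q).
Proof.
congr (_, _); apply/rowP => i; rewrite mxE /fiber_map.
  by rewrite (unsplitK (inl i)) coefC.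
by rewrite (unsplitK (inr i)) coef1_line_map mxE.
Qed.

Lemma size_fiber_map Q i : (size (fiber_map Q i) <= (weight 0 1 i).+1)%N.
Proof.
rewrite /fiber_map /weight; case: (split i) => j; last exact: size_line_map.
exact: size_polyC_leq1.
Qed.

Lemma mmap_coord_r (Q : 'M[K]_(2, 3)) (D : 'M[K]_(3, 2)) k :
  mmap (@polyC K) (fiber_map Q) (\sum_i D i k *: 'X_(rshift 2 i)) =
  \sum_i (D i k)%:P * line_map Q i.
Proof.
rewrite rmorph_sum; apply: eq_bigr => i _ /=.
by rewrite mmapZ mmapX mmap1U /fiber_map (unsplitK (inr i)).
Qed.

Section Frame.
Variable Q : 'M[K]_(2, 3).
Hypotheses (Qf : row_free Q) (Qh : (Q <= kermx h)%MS).

Lemma frame_ker (z : 'rV[K]_3) : z *m h = 0 -> (z <= Q)%MS.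
Proof.
move=> /sub_kermxP zk; apply: (submx_trans zk).
have [_] := mxrank_leqif_sup Qh.
by rewrite rank_ker_col // (eqP Qf) eqxx => <-.
Qed.

Lemma frame_line (z : 'rV[K]_3) : z != 0 -> (z <= Q)%MS -> line a h (a, z).
Proof. by move=> z0 zQ; split=> //=; apply/sub_kermxP/(submx_trans zQ). Qed.

End Frame.

Lemma line_param_curve : param_curve (line a h) 0 1.
Proof.
have rk : (1 < \rank (kermx h))%N by rewrite rank_ker_col.
have [t t0 th] := ker_col_neq0 h0.
split; first by exists (a, t); split=> //=; apply/sub_kermxP.
move=> y yV; have [y1 y2 ya yh] := yV.
have [|Q [Qf Q1 Qh]] := complete_row y2 rk; first exact/sub_kermxP.
have [D QD] : exists D, Q *m D = 1%:M by apply/row_freeP.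
have [c0 c1] := line_map_coord QD.
have aff x : line a h (affine_point (fiber_map Q) x).
  rewrite fiber_affine; apply: (frame_line Qh (row_free_rows x Qf).2).
  by rewrite addmx_sub ?scalemx_sub ?row_sub.
have inf : line a h (infinite_point 0 1 (fiber_map Q)).
  by rewrite fiber_infinite; apply: (frame_line Qh (row_free_rows 0 Qf).1 (row_sub _ _)).
have cov z : line a h z -> same_bipoint (infinite_point 0 1 (fiber_map Q)) z \/
    exists x, same_bipoint (affine_point (fiber_map Q) x) z.
  move=> zV; have [z1 z2 _ zh] := zV.
  have /submxP[u zE] := frame_ker Qf Qh zh.
  have u0 : u != 0 by apply: contraNneq z2 => u0; rewrite zE u0 mul0mx.
  have [|[x]] := line_span Qf u0; rewrite -zE => sz; [left|right].
    by rewrite fiber_infinite; split=> //; exact: line_same.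
  by exists x; rewrite fiber_affine; split=> //; exact: line_same.
have hX k : bihomog 0 1 (\sum_i D i k *: 'X_(rshift 2 i) : MP).
  by apply: bihomog_sum => i _; apply/bihomogZ/bihomog_rX.
exists (@CurveChart K (line a h) 0 1 (fiber_map Q) 0 1 _ _ (size_fiber_map Q)
  (hX 0) (hX 1) (etrans (mmap_coord_r Q D 0) c0) (etrans (mmap_coord_r Q D 1) c1)
  line_closed aff inf cov).
rewrite /= fiber_infinite Q1; split; first exact: line_same.
exact: same_point_refl.
Qed.

Lemma line_isomorphic : isomorphic (@P1 K) (line a h).
Proof.
have [t t0 th] := ker_col_neq0 h0.
have rk : (1 < \rank (kermx h))%N by rewrite rank_ker_col.
have [Q [Qf _ Qh]] := complete_row t0 rk th.
have [D QD] : exists D, Q *m D = 1%:M by apply/row_freeP.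
have uQ (u : 'rV[K]_2) : u != 0 -> u *m Q != 0 by move=> u0; rewrite mulmx_free_eq0.
have gE (u : 'rV[K]_2) : eval_row (fun j => \sum_i Q i j *: 'X_i) u = u *m Q.
  apply/rowP => j; rewrite !mxE rmorph_sum /=; apply: eq_bigr => i _.
  by rewrite mevalZ mevalXU mulrC.
have fE (u : 'rV[K]_2) : eval_row (fun i => (a 0 i)%:MP : {mpoly K[2]}) u = a.
  by apply/rowP => i; rewrite mxE mevalC.
exists (fun u => (a, u *m Q)), (fun y => y.2 *m D); split.
- move=> u u0; exists 0%N, 1%N, (fun i => (a 0 i)%:MP), (fun j => \sum_i Q i j *: 'X_i).
  rewrite fE gE; split=> //; last first.
  + by move=> u' u'0 _ _; rewrite fE gE; split; apply: same_point_refl => //; exact: uQ.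
  + exact: uQ.
  split=> i; first exact: dhomog_C.
  by apply: rpred_sum => j _; apply: dhomogZ; exact: dhomog_X.
- move=> y [y1 y2 _ yh].
  exists 0%N, 1%N, (fun k => \sum_j D j k *: 'X_(rshift 2 j)).
  have E (z : bipoint K) : bieval_row (fun k => \sum_j D j k *: 'X_(rshift 2 j)) z = z.2 *m D.
    apply/rowP => i; rewrite !mxE bieval_sum; apply: eq_bigr => j _.
    by rewrite bievalZ bieval_rX mulrC.
  split.
  + by move=> k; apply: bihomog_sum => j _; apply/bihomogZ/bihomog_rX.
  + rewrite E; have /submxP[u yE] := frame_ker Qf Qh yh.
    by rewrite yE -mulmxA QD mulmx1; apply: contraNneq y2 => u0; rewrite yE u0 mul0mx.
  + by move=> y' _; rewrite E => y'0; apply: same_point_refl.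
- move=> u u0 /=; split; last by rewrite -mulmxA QD mulmx1; apply: same_point_refl.
  exact: (frame_line Qh (uQ u u0) (submxMl u Q)).
- move=> y yV; have [y1 y2 _ yh] := yV.
  have /submxP[u yE] := frame_ker Qf Qh yh.
  have yD : y.2 *m D = u by rewrite yE -mulmxA QD mulmx1.
  have u0 : u != 0 by apply: contraNneq y2 => u0; rewrite yE u0 mul0mx.
  rewrite /= yD; split=> //; split=> /=; first exact/same_point_sym/line_same.
  by rewrite -yE; apply: same_point_refl.
Qed.

End Line.

Lemma isomorphic_rational V : V !=set0 -> isomorphic (@P1 K) V -> rational_curve V.
Proof.
move=> V0 Viso; exists (@P1 K), set0; rewrite setD0; split=> //.
- exists [set 1]; split=> [_ ->|]; first by exists 0%N; exact: dhomog1.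
  apply/seteqP; split=> u; last by case.
  by move=> u0; split=> //; exists 1; rewrite ?meval1 ?oner_eq0.
- exists (delta_mx 0 0); apply/eqP => /rowP/(_ 0)/eqP.
  by rewrite !mxE oner_eq0.
- exact: closed0.
Qed.

End CurveFamilies.

(** * Ideals of forms *)

Section GradedIdeals.
Variable K : numClosedFieldType.
Local Notation MP := {mpoly K[2 + 3]}.
Implicit Types (V : set (bipoint K)) (S : set (bipoly K)) (f g : MP).

(** Abstracts what three families share: [stalk], the forms vanishing at a point, and the multiples
    of one form along the double line ([mod_b0]). *)
Record graded_ideal (P : nat -> nat -> MP -> Prop) : Prop := GradedIdeal {
  gideal0 : forall d e, P d e 0;
  gidealD : forall d e f g, P d e f -> P d e g -> P d e (f + g);
  gidealM : forall d e d' e' h f, bihomog d' e' h -> P d e f ->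
    P (d' + d)%N (e' + e)%N (h * f) }.

Lemma gidealZ P d e c f : graded_ideal P -> P d e f -> P d e (c *: f).
Proof. by move=> Pid Pf; rewrite -mul_mpolyC; exact: (gidealM Pid (@bihomogC K c) Pf). Qed.

Lemma stalk_graded V S : vanishing_prime V -> pad_forms V -> graded_ideal (stalk V S).
Proof.
move=> Vprime Vpad; split=> [d e|d e f g|d e d' e' h f].
- exact: stalk0.
- exact: stalkD.
- exact: stalkM.
Qed.

Section Congruence.
Variables (P : nat -> nat -> MP -> Prop) (sg tau : 'I_(2 + 3) -> MP) (p q p' q' : nat).
Hypotheses (Pid : graded_ideal P)
  (sgl : forall i, bihomog p q (sg (lshift 3 i)))
  (sgr : forall j, bihomog p' q' (sg (rshift 2 j)))
  (taul : forall i, bihomog p q (tau (lshift 3 i)))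
  (taur : forall j, bihomog p' q' (tau (rshift 2 j)))
  (Pl : forall i, P p q (sg (lshift 3 i) - tau (lshift 3 i)))
  (Pr : forall j, P p' q' (sg (rshift 2 j) - tau (rshift 2 j))).

Let congr_mod d e f g := [/\ bihomog d e f, bihomog d e g & P d e (f - g)].

Let congr_mod1 : congr_mod 0 0 1 1.
Proof. by split; rewrite ?subrr; [exact: bihomog1|exact: bihomog1|exact: gideal0]. Qed.

Let congr_modM d e d' e' f g f' g' : congr_mod d e f g -> congr_mod d' e' f' g' ->
  congr_mod (d + d') (e + e') (f * f') (g * g').
Proof.
move=> [fh gh fg] [fh' gh' fg']; split; try exact: bihomogM.
rewrite (_ : _ - _ = f * (f' - g') + g' * (f - g)); last by ring.
apply: (gidealD Pid); first exact: gidealM.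
by rewrite addnC [(e + _)%N]addnC; apply: gidealM.
Qed.

Let congr_modX d e f g k : congr_mod d e f g ->
  congr_mod (d * k) (e * k) (f ^+ k) (g ^+ k).
Proof.
move=> fg; elim: k => [|k IH]; first by rewrite !muln0.
by rewrite !exprS !mulnS; apply: congr_modM.
Qed.

Let congr_mod_prod (n d e : nat) (m : 'I_n -> nat) (F G : 'I_n -> MP) :
  (forall i, congr_mod d e (F i) (G i)) ->
  congr_mod (d * \sum_i m i) (e * \sum_i m i)
    (\prod_i F i ^+ m i) (\prod_i G i ^+ m i).
Proof.
move=> FG; rewrite !big_distrr /=; elim: (index_enum _) => [|i r IH].
  by rewrite !big_nil.
by rewrite !big_cons; apply: congr_modM => //; exact: congr_modX.
Qed.

(** Congruence modulo a graded ideal is compatible with sums and products, so it passes from the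
    variables to every form. This replaces division by the equations of a curve. *)
Lemma mmap_congr d e f : bihomog d e f -> P (p * d + p' * e) (q * d + q' * e)
  (mmap (@mpolyC (2 + 3) K) sg f - mmap (@mpolyC (2 + 3) K) tau f).
Proof.
move=> fh; rewrite /mmap -sumrB big_seq.
apply: big_ind => [||m /fh[<- <-]]; [exact: gideal0|by move=> *; exact: gidealD|].
rewrite -mulrBr mul_mpolyC; apply: gidealZ => //.
rewrite /mmap1 !big_split_ord /=.
have cl i : congr_mod p q (sg (lshift 3 i)) (tau (lshift 3 i)) by split.
have cr j : congr_mod p' q' (sg (rshift 2 j)) (tau (rshift 2 j)) by split.
by case: (congr_modM (congr_mod_prod (fun i => m (lshift 3 i)) cl)
  (congr_mod_prod (fun j => m (rshift 2 j)) cr)).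
Qed.

End Congruence.

Lemma mmap_scale_t d e f b : bihomog d e f ->
  mmap (@mpolyC (2 + 3) K) (fun i => if split i is inr _ then b * 'X_i else 'X_i) f =
  b ^+ e * f.
Proof.
move=> fh; rewrite [f in RHS]mpolyE mulr_sumr; apply: eq_big_seq => m /fh[_ <-].
rewrite mul_mpolyC -scalerAr; congr (_ *: _); rewrite mpolyXE_id /mmap1 !big_split_ord /=.
rewrite mulrCA; congr (_ * _).
  by apply: eq_bigr => i _; rewrite (unsplitK (inl i)).
rewrite -prodrXr -big_split /=; apply: eq_bigr => j _.
by rewrite (unsplitK (inr j)) exprMn.
Qed.

Lemma mmap_id f : mmap (@mpolyC (2 + 3) K) (fun i => 'X_i) f = f.
Proof.
rewrite [RHS]mpolyE; apply: eq_bigr => m _.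
by rewrite mul_mpolyC mpolyXE_id.
Qed.

Lemma mpoly_eq0_generic f g : g != 0 -> (forall v, g.@[v] != 0 -> f.@[v] = 0) -> f = 0.
Proof.
move=> g0 fg; apply: (mulfI g0); rewrite mulr0; apply: mpoly_eq0_eval => v.
by rewrite mevalM; have [->|/fg ->] := eqVneq g.@[v] 0; rewrite ?mul0r ?mulr0.
Qed.

Definition point_of (v : 'I_(2 + 3) -> K) : bipoint K :=
  (\row_i v (lshift 3 i), \row_j v (rshift 2 j)).

Lemma meval_point_of v f : f.@[v] = bieval (point_of v) f.
Proof.
apply: meval_eq => i; rewrite mxE -[in LHS](splitK i).
by case: (split i) => j; rewrite mxE.
Qed.

(** Scaling the second group of variables by [beta j] multiplies [f] by a power of it. Modulo the
    minors, [beta j] times the k-th variable is [beta k] times the j-th, and this second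
    substitution evaluates [f] on the graph, where it is zero. *)
Lemma graph_ideal P n (beta : 'I_3 -> {mpoly K[2]}) d e f j : graded_ideal P ->
  (forall j, beta j \is n.-homog) -> (forall u, u != 0 -> eval_row beta u != 0) ->
  (forall i j, P n 1%N (graph_eq beta i j)) ->
  bihomog d e f -> vanishes_on (graph beta) f ->
  P (e * n + d)%N e (lift_s (beta j) ^+ e * f).
Proof.
move=> Pid bh b0 Pb fh fV.
pose sg (i : 'I_(2 + 3)) : MP := if split i is inr _ then lift_s (beta j) * 'X_i else 'X_i.
pose tau (i : 'I_(2 + 3)) : MP :=
  if split i is inr k then 'X_(rshift 2 j) * lift_s (beta k) else 'X_i.
have sl i : sg (lshift 3 i) = 'X_(lshift 3 i) by rewrite /sg (unsplitK (inl i)).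
have sr k : sg (rshift 2 k) = lift_s (beta j) * 'X_(rshift 2 k).
  by rewrite /sg (unsplitK (inr k)).
have tl i : tau (lshift 3 i) = 'X_(lshift 3 i) by rewrite /tau (unsplitK (inl i)).
have tr k : tau (rshift 2 k) = 'X_(rshift 2 j) * lift_s (beta k).
  by rewrite /tau (unsplitK (inr k)).
have bX i k : bihomog n 1 (lift_s (beta i) * 'X_(rshift 2 k)).
  by have := bihomogM (bihomog_lift_s (bh i)) (@bihomog_rX K k); rewrite addn0 add0n.
have H : P (1 * d + n * e)%N (0 * d + 1 * e)%N
    (mmap (@mpolyC (2 + 3) K) sg f - mmap (@mpolyC (2 + 3) K) tau f).
  apply: mmap_congr => // i.
  - by rewrite sl; exact: bihomog_lX.
  - by rewrite sr.
  - by rewrite tl; exact: bihomog_lX.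
  - by rewrite tr mulrC.
  - by rewrite sl tl subrr; exact: gideal0.
  - by rewrite sr tr (_ : _ - _ = graph_eq beta i j) // /graph_eq; ring.
rewrite (mmap_scale_t _ fh) mul0n add0n !mul1n addnC [(n * e)%N]mulnC in H.
(* At a vector with nonzero first part, [tau] gives a multiple of the point of the graph over it;
   the factor may be zero, which [bieval_scale] allows. *)
have tau0 : mmap (@mpolyC (2 + 3) K) tau f = 0.
  apply: (@mpoly_eq0_generic _ 'X_(lshift 3 0)).
    by rewrite -msize_poly_eq0 msizeX.
  move=> v; rewrite mevalXU => v0; rewrite meval_mmapC meval_point_of.
  pose s : 'rV[K]_2 := \row_i v (lshift 3 i).
  have s0 : s != 0 by apply: contraNneq v0 => /rowP/(_ 0); rewrite !mxE => ->.
  rewrite (_ : point_of _ = (1 *: s, v (rshift 2 j) *: eval_row beta s)).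
    by rewrite (bieval_scale _ _ _ _ fh) (fV _ (graph_point b0 s0)) mulr0.
  congr (_, _); apply/rowP => i; rewrite !mxE.
    by rewrite tl mevalXU mul1r.
  rewrite tr mevalM mevalXU -[_.@[v]]/(lift_s (beta i)).@[v].
  by rewrite meval_mmapC; congr (_ * _); apply: meval_eq => k; rewrite mevalXU mxE.
by rewrite tau0 subr0 in H.
Qed.

Lemma line_ideal P (a : 'rV[K]_2) (h : 'cV[K]_3) (y : 'cV[K]_2) d e f :
  graded_ideal P -> a != 0 -> h != 0 -> y != 0 -> a *m y = 0 ->
  P 1%N 0%N (\sum_i y i 0 *: 'X_(lshift 3 i)) ->
  P 0%N 1%N (\sum_j h j 0 *: 'X_(rshift 2 j)) ->
  bihomog d e f -> vanishes_on (line a h) f -> P d e f.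
Proof.
move=> Pid a0 h0 y0 ay Py Ph fh fV.
set Y := \sum_i _ in Py; set H := \sum_j _ in Ph.
have inv m (z : 'cV[K]_m) : z != 0 -> exists w : 'rV[K]_m, w *m z = 1%:M.
  move=> z0; have [i zi] : exists i, z i 0 != 0 by apply/cV0Pn.
  exists ((z i 0)^-1 *: delta_mx 0 i); rewrite -scalemxAl -rowE.
  by rewrite [row i z]mx11_scalar mxE scale_scalar_mx mulVf.
have [w wy] := inv _ y y0; have [w' w'h] := inv _ h h0.
(* The linear projection onto the kernels of [y] and [h], congruent to the identity modulo the two
   equations of the line; [f] composed with it has to vanish. *)
pose tau (i : 'I_(2 + 3)) : MP := match split i with
  | inl i => 'X_(lshift 3 i) - w 0 i *: Y
  | inr j => 'X_(rshift 2 j) - w' 0 j *: H end.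
have tl i : tau (lshift 3 i) = 'X_(lshift 3 i) - w 0 i *: Y.
  by rewrite /tau (unsplitK (inl i)).
have tr j : tau (rshift 2 j) = 'X_(rshift 2 j) - w' 0 j *: H.
  by rewrite /tau (unsplitK (inr j)).
have Yh : bihomog 1 0 Y by apply: bihomog_sum => i _; apply/bihomogZ/bihomog_lX.
have Hh : bihomog 0 1 H by apply: bihomog_sum => i _; apply/bihomogZ/bihomog_rX.
have : P (1 * d + 0 * e)%N (0 * d + 1 * e)%N
    (mmap (@mpolyC (2 + 3) K) (fun i => 'X_i) f - mmap (@mpolyC (2 + 3) K) tau f).
  apply: mmap_congr => // i.
  - exact: bihomog_lX.
  - exact: bihomog_rX.
  - by rewrite tl; apply: bihomogB; [exact: bihomog_lX|exact: bihomogZ].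
  - by rewrite tr; apply: bihomogB; [exact: bihomog_rX|exact: bihomogZ].
  - by rewrite tl subKr; apply: gidealZ.
  - by rewrite tr subKr; apply: gidealZ.
rewrite mmap_id !mul1n !mul0n addn0 add0n.
pose pr (v : 'I_(2 + 3) -> K) : bipoint K :=
  ((point_of v).1 - ((point_of v).1 *m y) 0 0 *: w,
   (point_of v).2 - ((point_of v).2 *m h) 0 0 *: w').
have YE v : Y.@[v] = ((point_of v).1 *m y) 0 0.
  rewrite rmorph_sum mxE; apply: eq_bigr => i _ /=.
  by rewrite mevalZ mevalXU mxE mulrC.
have HE v : H.@[v] = ((point_of v).2 *m h) 0 0.
  rewrite rmorph_sum mxE; apply: eq_bigr => i _ /=.
  by rewrite mevalZ mevalXU mxE mulrC.
have tauE v : point_of (fun i => (tau i).@[v]) = pr v.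
  congr (_, _); apply/rowP => i; rewrite !mxE.
    by rewrite tl mevalB mevalZ mevalXU YE mulrC !mxE.
  by rewrite tr mevalB mevalZ mevalXU HE mulrC !mxE.
suff -> : mmap (@mpolyC (2 + 3) K) tau f = 0 by rewrite subr0.
have [i ai] : exists i, a 0 i != 0 by apply/rV0Pn.
have [t t0 th] := ker_col_neq0 h0.
have [j tj] : exists j, t 0 j != 0 by apply/rV0Pn.
have prK s u : s *m y = 0 -> u *m h = 0 -> pr (fun i => row_mx s u 0 i) = (s, u).
  move=> sy uh; have -> : pr (fun i => row_mx s u 0 i) =
      (s - (s *m y) 0 0 *: w, u - (u *m h) 0 0 *: w').
    rewrite /pr (_ : (point_of _).1 = s); last by apply/rowP => k; rewrite mxE row_mxEl.
    by rewrite (_ : (point_of _).2 = u) //; apply/rowP => k; rewrite mxE row_mxEr.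
  by rewrite sy uh !mxE !scale0r !subr0.
have tauN k (s : 'rV[K]_2) (u : 'rV[K]_3) : s *m y = 0 -> u *m h = 0 -> row_mx s u 0 k != 0 -> tau k != 0.
  move=> sy uh; apply: contraNneq => tk; apply/eqP.
  pose v i := row_mx s u 0 i.
  have /= <- := congr1 (fun x : bipoint K => row_mx x.1 x.2 0 k)
    (etrans (tauE v) (prK s u sy uh)).
  rewrite mxE -[RHS](meval0 v) -tk -[in RHS](splitK k).
  by case: (split k) => l; rewrite mxE.
(* Where these two coordinates are nonzero the projected pair represents a point of the line. They
   are nonzero forms because the projection fixes [a] and [t]. *)
apply: (@mpoly_eq0_generic _ (tau (lshift 3 i) * tau (rshift 2 j))).
  apply: mulf_neq0.
    by apply: (tauN _ a 0) => //; rewrite ?mul0mx // row_mxEl.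
  by apply: (tauN _ 0 t); rewrite ?mul0mx ?row_mxEr //; apply/sub_kermxP.
move=> v; rewrite mevalM mulf_eq0 negb_or => /andP[vi vj].
rewrite meval_mmapC meval_point_of tauE; apply: fV; rewrite -tauE.
have prl : (pr v).1 *m y = 0.
  by rewrite mulmxBl -scalemxAl wy scalemx1 -mx11_scalar subrr.
have prr : (pr v).2 *m h = 0.
  by rewrite mulmxBl -scalemxAl w'h scalemx1 -mx11_scalar subrr.
split.
- by apply: contraNneq vi => /rowP/(_ i); rewrite !mxE => ->.
- by apply: contraNneq vj => /rowP/(_ j); rewrite !mxE => ->.
- rewrite tauE; move/sub_kermxP: prl => /submx_trans; apply.
  have ak : (a <= kermx y)%MS by apply/sub_kermxP.
  have [_] := mxrank_leqif_sup ak.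
  by rewrite mxrank_ker rank_rV a0 -mxrank_tr rank_rV trmx_eq0 y0 eqxx => <-.
- by rewrite tauE.
Qed.

End GradedIdeals.

(** * Graphs of cross products *)

Section CrossProducts.
Variable K : numClosedFieldType.
Local Notation MP := {mpoly K[2 + 3]}.
Implicit Types (S : set (bipoly K)) (f g : MP).

(* Indices are taken modulo 3. *)
Definition cross (R : comPzRingType) (p q : 'I_3 -> R) (i : 'I_3) : R :=
  p (i + 1) * q (i + 1 + 1) - p (i + 1 + 1) * q (i + 1).

Lemma ord3P (P : 'I_3 -> Prop) : P 0 -> P 1 -> P (1 + 1) -> forall i, P i.
Proof.
move=> P0 P1 P2 [[|[|[|//]]] lt]; [move: P0|move: P1|move: P2]; congr P; exact: val_inj.
Qed.

Lemma ord3_add : (1 + 1 + 1 = 0 :> 'I_3) * (0 + 1 = 1 :> 'I_3).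
Proof. by split; apply: val_inj. Qed.

Lemma big_ord3 (R : nmodType) (F : 'I_3 -> R) : \sum_i F i = F 0 + F 1 + F (1 + 1).
Proof.
rewrite !big_ord_recl big_ord0 addr0 addrA.
by congr (_ + F _ + F _); apply: val_inj.
Qed.

(* The components of (p x q) x t = (p.t) q - (q.t) p. *)
Lemma cross_cross (R : comPzRingType) (p q t : 'I_3 -> R) i j :
  exists (e : int) k, t i * cross p q j - t j * cross p q i =
    (q k * (\sum_l p l * t l) - p k * (\sum_l q l * t l)) *~ e.
Proof.
rewrite !big_ord3; elim/ord3P: i; elim/ord3P: j; rewrite /cross !ord3_add.
- by exists 0, 0; ring.
- by exists (-1), (1 + 1); ring.
- by exists 1, 1; ring.
- by exists 1, (1 + 1); ring.
- by exists 0, 0; ring.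
- by exists (-1), 0; ring.
- by exists (-1), 1; ring.
- by exists 1, 0; ring.
- by exists 0, 0; ring.
Qed.

Lemma dot_cross (R : comPzRingType) (p q : 'I_3 -> R) :
  \sum_l p l * cross p q l = 0 /\ \sum_l q l * cross p q l = 0.
Proof. by rewrite !big_ord3 /cross !ord3_add; split; ring. Qed.

Lemma cross_eq0 (a b : 'I_3 -> K) : (forall i, cross a b i = 0) ->
  exists c d, (c, d) != (0, 0) /\ forall i, c * a i = d * b i.
Proof.
move=> ab0; case: (pselect (exists k, a k != 0)) => [[k ak]|a0]; last first.
  exists 1, 0; split=> [|i]; first by rewrite xpair_eqE oner_eq0.
  by rewrite mul0r mul1r; apply/eqP; apply: contrapT => /negP ai; apply: a0; exists i.
exists (b k), (a k); split=> [|i]; first by rewrite xpair_eqE (negPf ak) andbF.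
have e i' : cross a b i' = 0 := ab0 i'.
have := e 0; have := e 1; have := e (1 + 1); rewrite /cross !ord3_add.
move=> /eqP; rewrite subr_eq0 => /eqP e2 /eqP; rewrite subr_eq0 => /eqP e1 /eqP.
rewrite subr_eq0 => /eqP e0.
have sym i' k' : a i' * b k' = a k' * b i'.
  elim/ord3P: i'; elim/ord3P: k'; first [by []|exact: e0|exact: e1|exact: e2|
    exact: esym e0|exact: esym e1|exact: esym e2].
by rewrite mulrC sym.
Qed.

Definition pairing (p : 'I_3 -> {mpoly K[2]}) : MP :=
  \sum_j lift_s (p j) * 'X_(rshift 2 j).

Lemma bihomog_pairing n p : (forall j, p j \is n.-homog) -> bihomog n 1 (pairing p).
Proof.
move=> ph; apply: bihomog_sum => j _.
by have := bihomogM (bihomog_lift_s (ph j)) (@bihomog_rX K j); rewrite addn0 add0n.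
Qed.

Lemma bieval_pairing x p : bieval x (pairing p) = \sum_j eval_row p x.1 0 j * x.2 0 j.
Proof.
rewrite bieval_sum; apply: eq_bigr => j _.
by rewrite bievalM bieval_lift_s bieval_rX mxE.
Qed.

Lemma lift_sM (p q : {mpoly K[2]}) : lift_s (p * q) = lift_s p * lift_s q.
Proof. exact: rmorphM. Qed.
Lemma lift_sB (p q : {mpoly K[2]}) : lift_s (p - q) = lift_s p - lift_s q.
Proof. exact: rmorphB. Qed.
Lemma lift_sC (c : K) : lift_s c%:MP = c%:MP.
Proof. exact: mmapC. Qed.

Section CrossGraph.
Variables (m n : nat) (p q : 'I_3 -> {mpoly K[2]}).
Hypotheses (ph : forall j, p j \is m.-homog) (qh : forall j, q j \is n.-homog).

Lemma cross_homog j : cross p q j \is (m + n).-homog.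
Proof. by apply: rpredB; [|rewrite addnC mulrC]; apply: dhomogM. Qed.

Lemma eval_cross u j :
  eval_row (cross p q) u 0 j = cross (eval_row p u 0) (eval_row q u 0) j.
Proof. by rewrite mxE mevalB !mevalM /cross !mxE. Qed.

Lemma cross_graph_ideal P i j : graded_ideal P -> P m 1%N (pairing p) ->
  P n 1%N (pairing q) -> P (m + n)%N 1%N (graph_eq (cross p q) i j).
Proof.
move=> Pid Pp Pq.
have [e [k E]] := cross_cross (fun j => lift_s (p j)) (fun j => lift_s (q j))
  (fun j => 'X_(rshift 2 j)) i j.
have -> : graph_eq (cross p q) i j =
    e%:~R *: (lift_s (q k) * pairing p - lift_s (p k) * pairing q).
  by rewrite scaler_int -E /graph_eq !lift_sB !lift_sM.
apply: gidealZ => //; apply: (gidealD Pid).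
  have := gidealM Pid (bihomog_lift_s (qh k)) Pp.
  by rewrite add0n addnC.
rewrite -scaleN1r; apply: gidealZ => //.
by have := gidealM Pid (bihomog_lift_s (ph k)) Pq; rewrite add0n.
Qed.

Hypothesis pq0 : forall u, u != 0 -> eval_row (cross p q) u != 0.

Lemma cross_graphP x : proper_point x -> graph (cross p q) x <->
  bieval x (pairing p) = 0 /\ bieval x (pairing q) = 0.
Proof.
move=> xp; have [x1 x2] := xp; split=> [/(graphP pq0)[_ [_ [c _ xE]]]|[px qx]].
  rewrite !bieval_pairing xE; split; under eq_bigr do rewrite [X in _ * X]mxE eval_cross mulrCA;
    by rewrite -mulr_sumr ?(dot_cross _ _).1 ?(dot_cross _ _).2 mulr0.
apply/(graph_eqP pq0 xp) => i j.
(* The forms vanishing at [x], whatever their bidegree, are a graded ideal, so the identity for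
   ideals also describes the points. *)
apply: (@cross_graph_ideal (fun _ _ f => bieval x f = 0)) => //.
split=> [_ _|_ _ f g fx gx|_ _ _ _ h f _ fx].
- exact: meval0.
- by rewrite bievalD fx gx addr0.
- by rewrite bievalM fx mulr0.
Qed.

(** Some component of the cross product is a unit at V, and after multiplication by a power of it
    every form vanishing on the graph is a combination of the two pairings. *)
Lemma cross_stalk V S d e f : vanishing_prime V -> pad_forms V ->
  (exists2 x, V x & x.1 != 0) ->
  stalk V S m 1 (pairing p) -> stalk V S n 1 (pairing q) ->
  bihomog d e f -> vanishes_on (graph (cross p q)) f -> stalk V S d e f.
Proof.
move=> Vprime Vpad [x Vx x1] Sp Sq fh fV.
have [j bj] : exists j, eval_row (cross p q) x.1 0 j != 0 by apply/rV0Pn/pq0.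
have Pid := stalk_graded S Vprime Vpad.
have bV : ~ vanishes_on V (lift_s (cross p q j) ^+ e).
  move/(_ x Vx)/eqP; rewrite bievalXn expf_eq0 bieval_lift_s.
  by rewrite mxE in bj; rewrite (negPf bj) andbF.
have bh : bihomog (e * (m + n)) 0 (lift_s (cross p q j) ^+ e).
  have := @bihomogXn K _ _ _ e (bihomog_lift_s (cross_homog j)).
  by rewrite muln0.
apply: (stalk_cancel Vprime bh bV fh); rewrite add0n.
apply: (graph_ideal _ Pid cross_homog pq0 _ fh fV) => i k.
exact: cross_graph_ideal.
Qed.

End CrossGraph.

End CrossProducts.

(** * Normal forms of the two equations *)

Section Types.
Variable K : numClosedFieldType.
Local Notation MP := {mpoly K[2 + 3]}.
Implicit Types (V : set (bipoint K)) (S : set (bipoly K)) (f g : MP).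

Definition sform (y : 'cV[K]_2) : MP := \sum_i y i 0 *: 'X_(lshift 3 i).
Definition tform (b : 'cV[K]_3) : MP := \sum_j b j 0 *: 'X_(rshift 2 j).
Definition cst (b : 'cV[K]_3) (j : 'I_3) : {mpoly K[2]} := (b j 0)%:MP.
Definition lin (M : 'M[K]_(2, 3)) (j : 'I_3) : {mpoly K[2]} := \sum_i M i j *: 'X_i.

Lemma bihomog_sform y : bihomog 1 0 (sform y).
Proof. by apply: bihomog_sum => i _; apply/bihomogZ/bihomog_lX. Qed.

Lemma bihomog_tform b : bihomog 0 1 (tform b).
Proof. by apply: bihomog_sum => i _; apply/bihomogZ/bihomog_rX. Qed.

Lemma bihomog_stform y b : bihomog 1 1 (sform y * tform b).
Proof. exact: (bihomogM (@bihomog_sform y) (@bihomog_tform b)). Qed.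

Lemma bieval_sform x y : bieval x (sform y) = (x.1 *m y) 0 0.
Proof.
by rewrite bieval_sum mxE; apply: eq_bigr => i _; rewrite bievalZ bieval_lX mulrC.
Qed.

Lemma bieval_tform x b : bieval x (tform b) = (x.2 *m b) 0 0.
Proof.
by rewrite bieval_sum mxE; apply: eq_bigr => i _; rewrite bievalZ bieval_rX mulrC.
Qed.

Lemma sform_eq0 x y : bieval x (sform y) = 0 <-> x.1 *m y = 0.
Proof.
rewrite bieval_sform; split=> [e|->]; last by rewrite mxE.
by rewrite [LHS]mx11_scalar e raddf0.
Qed.

Lemma tform_eq0 x b : bieval x (tform b) = 0 <-> x.2 *m b = 0.
Proof.
rewrite bieval_tform; split=> [e|->]; last by rewrite mxE.
by rewrite [LHS]mx11_scalar e raddf0.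
Qed.

Lemma pairing_cst b : pairing (cst b) = tform b.
Proof. by apply: eq_bigr => j _; rewrite lift_sC mul_mpolyC. Qed.

Lemma pairing_lin M : pairing (lin M) =
  \sum_i \sum_j M i j *: ('X_(lshift 3 i) * 'X_(rshift 2 j)).
Proof.
rewrite exchange_big; apply: eq_bigr => j _ /=.
rewrite /lift_s rmorph_sum mulr_suml; apply: eq_bigr => i _ /=.
by rewrite mmapZ mmapX mmap1U mul_mpolyC scalerAl.
Qed.

Lemma pairing_lin_outer (y y' : 'cV[K]_2) (b b' : 'cV[K]_3) :
  pairing (lin (y *m b^T + y' *m b'^T)) = sform y * tform b + sform y' * tform b'.
Proof.
rewrite pairing_lin /sform /tform !mulr_suml -big_split; apply: eq_bigr => i _ /=.
rewrite !mulr_sumr -big_split; apply: eq_bigr => j _ /=.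
by rewrite !mxE !big_ord1 !mxE scalerDl -!scalerAl -!scalerAr !scalerA.
Qed.

Lemma cst_homog b j : cst b j \is 0.-homog.
Proof. exact: dhomog_C. Qed.

Lemma lin_homog M j : lin M j \is 1.-homog.
Proof. by apply: rpred_sum => i _; apply: dhomogZ; exact: dhomog_X. Qed.

Lemma eval_cst b u : eval_row (cst b) u = b^T.
Proof. by apply/rowP => j; rewrite !mxE mevalC. Qed.

Lemma eval_lin M u : eval_row (lin M) u = u *m M.
Proof.
apply/rowP => j; rewrite !mxE rmorph_sum /=; apply: eq_bigr => i _.
by rewrite mevalZ mevalXU mulrC.
Qed.

Definition independent m n (a b : 'M[K]_(m, n)) :=
  forall c d, c *: a = d *: b -> c = 0 /\ d = 0.

Lemma cross_neq0 (p q : 'I_3 -> {mpoly K[2]}) u :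
  independent (eval_row p u) (eval_row q u) -> eval_row (cross p q) u != 0.
Proof.
move=> pq; apply/eqP => c0.
have [i|c [d [cd e]]] := @cross_eq0 K (eval_row p u 0) (eval_row q u 0).
  by rewrite -eval_cross c0 mxE.
have [|c0' d0'] := pq c d; first by apply/rowP => i; rewrite [LHS]mxE [RHS]mxE e.
by rewrite c0' d0' eqxx in cd.
Qed.

Lemma independentT m n (a b : 'M[K]_(m, n)) : independent a b -> independent a^T b^T.
Proof.
by move=> ab c d /(congr1 trmx); rewrite !linearZ /= !trmxK => /ab.
Qed.

Lemma independentC m n (a b : 'M[K]_(m, n)) : independent a b -> independent b a.
Proof. by move=> ab c d /esym/ab[]. Qed.

Lemma independent_neq0 m n (a b : 'M[K]_(m, n)) : independent a b -> a != 0.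
Proof.
move=> ab; apply/eqP => a0; have [] := ab 1 0; first by rewrite a0 scaler0 scale0r.
by move=> /eqP; rewrite oner_eq0.
Qed.

Lemma separate (a b : 'cV[K]_3) : independent a b ->
  exists2 t : 'rV[K]_3, t *m b = 0 & t *m a != 0.
Proof.
move=> ab; have nab : ~~ (a^T <= b^T)%MS.
  apply/negP => /sub_rVP[c /(congr1 trmx)]; rewrite linearZ /= !trmxK => E.
  have [] := ab 1 c; first by rewrite scale1r.
  by move=> /eqP; rewrite oner_eq0.
rewrite submxE in nab.
have colM (v : 'rV[K]_3) k : v *m col k (cokermx b^T) = col k (v *m cokermx b^T).
  by rewrite !colE mulmxA.
have [k ck] : exists k, a^T *m col k (cokermx b^T) != 0.
  apply: contrapT => nk; case/eqP: nab; apply/row_matrixP => i; apply/rowP => k.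
  apply/eqP; apply: contrapT => /negP h; apply: nk; exists k.
  apply: contraNneq h => /matrixP/(_ i 0); rewrite colM => h.
  by rewrite !mxE in h *; apply/eqP.
exists (col k (cokermx b^T))^T.
  apply: trmx_inj; rewrite trmx_mul trmxK colM mulmx_coker.
  by apply/matrixP => i j; rewrite !mxE.
by rewrite -trmx_eq0 trmx_mul trmxK.
Qed.

Lemma line_not_sub_graph a b beta : a != 0 -> b != 0 -> ~ line a b `<=` @graph K beta.
Proof.
move=> a0 b0 sub; have rk : (1 < \rank (kermx b))%N by rewrite rank_ker_col.
have [t t0 th] := ker_col_neq0 b0.
have [Q [Qf _ Qh]] := complete_row t0 rk th.
have Qb k : (row k Q <= eval_row beta a)%MS.
  have k0 : row k Q != 0.
    by rewrite rowE mulmx_free_eq0 //; apply/eqP => /rowP/(_ k)/eqP; rewrite !mxE !eqxx oner_eq0.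
  by have [] := sub _ (frame_line a0 Qh k0 (row_sub _ _)).
have : (Q <= eval_row beta a)%MS by apply/row_subP.
by move/mxrankS; rewrite (eqP Qf) leqNgt ltnS rank_leq_row.
Qed.

Lemma graph_not_sub_line a b beta : (forall u, u != 0 -> eval_row beta u != 0) ->
  ~ @graph K beta `<=` line a b.
Proof.
move=> b0 sub.
have : (1%:M <= a)%MS.
  apply/row_subP => k; rewrite row1.
  have k0 : delta_mx 0 k != 0 :> 'rV[K]_2.
    by apply/eqP => /rowP/(_ k)/eqP; rewrite !mxE !eqxx oner_eq0.
  by have [] := sub _ (graph_point b0 k0).
by move/mxrankS; rewrite mxrank1 leqNgt ltnS rank_leq_row.
Qed.

Lemma line_not_sub_line a a' b b' : b != 0 -> independent a a' ->
  ~ line a b `<=` @line K a' b'.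
Proof.
move=> b0 aa' sub.
have [t t0 th] := ker_col_neq0 b0.
have [] := sub (a, t).
  by split=> //=; [exact: independent_neq0 aa'|exact/sub_kermxP].
move=> _ _ /sub_rVP[c /= ac] _; have [] := aa' 1 c; first by rewrite scale1r.
by move/eqP; rewrite oner_eq0.
Qed.

Lemma line_stalk V S (a : 'rV[K]_2) (y : 'cV[K]_2) (b : 'cV[K]_3) d e f :
  vanishing_prime V -> pad_forms V -> a != 0 -> b != 0 -> y != 0 -> a *m y = 0 ->
  stalk V S 1 0 (sform y) -> stalk V S 0 1 (tform b) ->
  bihomog d e f -> vanishes_on (line a b) f -> stalk V S d e f.
Proof.
move=> Vprime Vpad a0 b0 y0 ay Sy Sb fh fV.
exact: (line_ideal (stalk_graded S Vprime Vpad) a0 b0 y0 ay Sy Sb fh fV).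
Qed.

Lemma irreducible_pad V : irreducible_closed V -> pad_forms V.
Proof.
by move=> [Vc [x Vx] _]; apply: (point_pad Vx); exact: closed_proper Vx.
Qed.

Lemma stalk_mull V S d e d' e' h f : irreducible_closed V -> bihomog d' e' h ->
  ~ vanishes_on V h -> bihomog d e f -> stalk V S (d' + d) (e' + e) (h * f) ->
  stalk V S d e f.
Proof. by move=> Vi; apply: stalk_cancel; exact: irreducible_prime. Qed.

Lemma stalkN V S d e f : irreducible_closed V -> stalk V S d e f -> stalk V S d e (- f).
Proof.
move=> Vi; rewrite -scaleN1r; apply: gidealZ; apply: stalk_graded.
  exact: irreducible_prime.
exact: irreducible_pad.
Qed.

Lemma nonvanishing V f x : V x -> bieval x f <> 0 -> ~ vanishes_on V f.
Proof. by move=> Vx fx /(_ x Vx). Qed.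

Section Frame.
Variables (u0 u1 : 'rV[K]_2) (xi eta : 'cV[K]_2).
Hypothesis frame : [/\ u0 *m xi = 1%:M, u0 *m eta = 0, u1 *m xi = 0 & u1 *m eta = 1%:M].
Hypothesis frameE : forall s : 'rV[K]_2,
  s = (s *m xi) 0 0 *: u0 + (s *m eta) 0 0 *: u1.

Let one_neq0 : (1%:M : 'M[K]_1) <> 0.
Proof. by move/matrixP/(_ 0 0)/eqP; rewrite !mxE oner_eq0. Qed.

Let mx00 : (0 : 'M[K]_1) 0 0 = 0.
Proof. by rewrite mxE. Qed.

Lemma frame_neq0 : [/\ u0 != 0, u1 != 0, xi != 0 & eta != 0].
Proof.
have [e1 e2 e3 e4] := frame; split; apply/eqP => e.
- by apply: one_neq0; rewrite -e1 e mul0mx.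
- by apply: one_neq0; rewrite -e4 e mul0mx.
- by apply: one_neq0; rewrite -e1 e mulmx0.
- by apply: one_neq0; rewrite -e4 e mulmx0.
Qed.

Lemma frame_independent : independent u0 u1.
Proof.
have [e1 e2 e3 e4] := frame; move=> c d e; split.
  have := congr1 (fun x : 'rV_2 => (x *m xi) 0 0) e.
  by rewrite -!scalemxAl e1 e3 !mxE mulr1 mulr0.
have := congr1 (fun x : 'rV_2 => (x *m eta) 0 0) e.
by rewrite -!scalemxAl e2 e4 !mxE mulr1 mulr0.
Qed.

Lemma sub_u0 (s : 'rV[K]_2) : s *m eta = 0 -> (s <= u0)%MS.
Proof. by move=> se; rewrite [s]frameE se mx00 scale0r addr0 scalemx_sub. Qed.

Lemma sub_u1 (s : 'rV[K]_2) : s *m xi = 0 -> (s <= u1)%MS.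
Proof. by move=> se; rewrite [s]frameE se mx00 scale0r add0r scalemx_sub. Qed.

Lemma xi_eta (s : 'rV[K]_2) : s *m xi = 0 -> s *m eta = 0 -> s = 0.
Proof. by move=> sx sy; rewrite [s]frameE sx sy mx00 !scale0r addr0. Qed.

Lemma line_u0P x b : line u0 b x <->
  proper_point x /\ bieval x (sform eta) = 0 /\ bieval x (tform b) = 0.
Proof.
have [e1 e2 e3 e4] := frame; rewrite sform_eq0 tform_eq0.
split=> [[x1 x2 /sub_rVP[c xE] xb]|[[x1 x2] [xe xb]]].
  by split=> //; split=> //; rewrite xE -scalemxAl e2 scaler0.
by split=> //; exact: sub_u0.
Qed.

Lemma line_u1P x b : line u1 b x <->
  proper_point x /\ bieval x (sform xi) = 0 /\ bieval x (tform b) = 0.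
Proof.
have [e1 e2 e3 e4] := frame; rewrite sform_eq0 tform_eq0.
split=> [[x1 x2 /sub_rVP[c xE] xb]|[[x1 x2] [xe xb]]].
  by split=> //; split=> //; rewrite xE -scalemxAl e3 scaler0.
by split=> //; exact: sub_u1.
Qed.

End Frame.

End Types.

(** * Components and multiplicities of the four configurations *)

Section SchemesByType.
Variable K : numClosedFieldType.
Local Notation MP := {mpoly K[2 + 3]}.
Implicit Types (V : set (bipoint K)) (S : set (bipoly K)) (f g : MP).

Lemma components2 (V1 V2 Z : set (bipoint K)) :
  irreducible_closed V1 -> irreducible_closed V2 ->
  ~ V1 `<=` V2 -> ~ V2 `<=` V1 -> Z = V1 `|` V2 ->
  components Z = [set` [:: V1; V2]].
Proof.
move=> i1 i2 n12 n21 ->; apply: components_list => [V|V W|].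
- by rewrite !inE => /orP[] /eqP ->.
- by rewrite !inE => /orP[] /eqP -> /orP[] /eqP ->.
apply/seteqP; split=> x.
  by case=> Vx; [exists V1|exists V2]; rewrite // !inE eqxx ?orbT.
by move=> [V]; rewrite !inE => /orP[] /eqP ->; [left|right].
Qed.

Lemma components3 (V1 V2 V3 Z : set (bipoint K)) :
  irreducible_closed V1 -> irreducible_closed V2 -> irreducible_closed V3 ->
  ~ V1 `<=` V2 -> ~ V2 `<=` V1 -> ~ V1 `<=` V3 -> ~ V3 `<=` V1 ->
  ~ V2 `<=` V3 -> ~ V3 `<=` V2 -> Z = V1 `|` V2 `|` V3 ->
  components Z = [set` [:: V1; V2; V3]].
Proof.
move=> i1 i2 i3 n12 n21 n13 n31 n23 n32 ->; apply: components_list => [V|V W|].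
- by rewrite !inE => /or3P[] /eqP ->.
- by rewrite !inE => /or3P[] /eqP -> /or3P[] /eqP ->.
apply/seteqP; split=> x.
  by case=> [[]|] Vx; [exists V1|exists V2|exists V3]; rewrite // !inE eqxx ?orbT.
by move=> [V]; rewrite !inE => /or3P[] /eqP ->; [left; left|left; right|right].
Qed.

Lemma uniq2 (V1 V2 : set (bipoint K)) : V1 <> V2 -> uniq [:: V1; V2].
Proof. by move=> /eqP n12; rewrite cons_uniq in_cons in_nil orbF n12. Qed.

Lemma uniq3 (V1 V2 V3 : set (bipoint K)) : V1 <> V2 -> V1 <> V3 -> V2 <> V3 ->
  uniq [:: V1; V2; V3].
Proof.
move=> /eqP n12 /eqP n13 /eqP n23.
by rewrite cons_uniq uniq2 ?andbT //; [rewrite !in_cons in_nil orbF negb_or n12|exact/eqP].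
Qed.

Lemma mulf_zero (x y : K) : x * y = 0 -> x = 0 \/ y = 0.
Proof. by move=> /eqP; rewrite mulf_eq0 => /orP[] /eqP; [left|right]. Qed.

Lemma zeros2P (G1 G2 : MP) x : zeros [set G1; G2] x <->
  proper_point x /\ bieval x G1 = 0 /\ bieval x G2 = 0.
Proof.
split=> [[x1 x2 xG]|[[x1 x2] [g1 g2]]].
  by split=> //; split; apply: xG; [left|right].
by split=> // f [] ->.
Qed.

Lemma sub_zeros V S : V `<=` zeros S -> forall f, S f -> vanishes_on V f.
Proof. by move=> VS f Sf x /VS[_ _]; apply. Qed.

Lemma cst_cross_neq0 (a b : 'cV[K]_3) u :
  independent a b -> eval_row (cross (cst a) (cst b)) u != 0.
Proof. by move=> ab; apply: cross_neq0; rewrite !eval_cst; exact: independentT. Qed.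

(** The forms whose local sections lie in the ideal [J]. Regarding them as equations lets the
    calculus of [stalk] apply to [J] itself. *)
Definition local_forms V (J : set {fraction MP}) : set (bipoly K) :=
  [set f | exists d e, bihomog d e f /\
     forall g, bihomog d e g -> ~ vanishes_on V g -> J (tofrac f / tofrac g)].

Lemma local_forms_scheme V J : local_ideal V J ->
  scheme_local_ideals (local_forms V J) V J.
Proof.
move=> JV; split=> // d e f g [d' [e' [fh' fJ]]] fh gh gV.
have [f0|f0] := eqVneq f 0; last first.
  have [dE eE] := bihomog_uniq f0 fh fh'; apply: fJ => //.
  by rewrite -dE -eE.
by rewrite f0 tofrac0 mul0r; case: JV.
Qed.

Lemma local_formsP V J d e f g : vanishing_prime V -> local_ideal V J ->
  bihomog d e f -> bihomog d e g -> ~ vanishes_on V g ->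
  J (tofrac f / tofrac g) -> local_forms V J f.
Proof.
move=> Vprime JV fh gh gV Jfg; exists d, e; split=> // g' gh' gV'.
have g0 := tofrac_nonvanishing gV; have g0' := tofrac_nonvanishing gV'.
have -> : tofrac f / tofrac g' = tofrac g / tofrac g' * (tofrac f / tofrac g).
  by rewrite [RHS]mulrC mulrA (divfK g0).
by apply: (local_idealM JV) => //; exists d, e, g, g'.
Qed.

Lemma stalk_sub V S T d e f : S `<=` T -> stalk V S d e f -> stalk V T d e f.
Proof.
move=> ST [fh fJ]; split=> // J [JV JT]; apply: fJ; split=> // d' e' h g Sh.
by apply: JT; exact: ST.
Qed.

Section Frame.
Variables (u0 u1 : 'rV[K]_2) (xi eta : 'cV[K]_2).
Hypothesis frame : [/\ u0 *m xi = 1%:M, u0 *m eta = 0, u1 *m xi = 0 & u1 *m eta = 1%:M].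
Hypothesis frameE : forall s : 'rV[K]_2,
  s = (s *m xi) 0 0 *: u0 + (s *m eta) 0 0 *: u1.

Let u00 : u0 != 0. Proof. by have [] := frame_neq0 frame. Qed.
Let u10 : u1 != 0. Proof. by have [] := frame_neq0 frame. Qed.
Let xi0 : xi != 0. Proof. by have [] := frame_neq0 frame. Qed.
Let eta0 : eta != 0. Proof. by have [] := frame_neq0 frame. Qed.

Let xi_u0 t : bieval (u0, t) (sform xi) = 1.
Proof. by rewrite bieval_sform /=; have [-> _ _ _] := frame; rewrite mxE. Qed.
Let eta_u1 t : bieval (u1, t) (sform eta) = 1.
Proof. by rewrite bieval_sform /=; have [_ _ _ ->] := frame; rewrite mxE. Qed.

Lemma line_nonvanishing (a : 'rV[K]_2) (b b' : 'cV[K]_3) : a != 0 ->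
  independent b' b -> ~ vanishes_on (line a b) (tform b').
Proof.
move=> a0 bb'; have [t tb tb'] := separate bb'.
apply: (@nonvanishing _ _ _ (a, t)).
  by split=> //=; apply: contraNneq tb' => ->; rewrite mul0mx.
by move/tform_eq0/eqP; apply/negP.
Qed.

Lemma line_s_nonvanishing (a : 'rV[K]_2) (b : 'cV[K]_3) y : a != 0 -> b != 0 ->
  (forall t, bieval (a, t) (sform y) = 1) -> ~ vanishes_on (line a b) (sform y).
Proof.
move=> a0 b0 ay; have [t t0 th] := ker_col_neq0 b0.
apply: (@nonvanishing _ _ _ (a, t)); first by split=> //=; exact/sub_kermxP.
by rewrite ay => /eqP; rewrite oner_eq0.
Qed.

(** * The secant case: two lines in fibers and a fiber of the second projection *)

Section CrossingLines.
Variables (a1 b0 : 'cV[K]_3).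
Hypothesis ab : independent a1 b0.

Let G1 := sform eta * tform a1.
Let G2 := sform xi * tform b0.
Let S : set (bipoly K) := [set G1; G2].
Let V1 := line u0 b0.
Let V2 := line u1 a1.
Let V3 := graph (cross (cst a1) (cst b0)).

Let a10 : a1 != 0. Proof. exact: independent_neq0 ab. Qed.
Let b00 : b0 != 0. Proof. exact: independent_neq0 (independentC ab). Qed.
Let V30 u : u != 0 -> eval_row (cross (cst a1) (cst b0)) u != 0.
Proof. by move=> _; exact: cst_cross_neq0. Qed.
Let V3h := cross_homog (cst_homog a1) (cst_homog b0).

Let S1 V : stalk V S 1 1 G1.
Proof. by apply: stalk_gen; [left|exact: bihomog_stform]. Qed.
Let S2 V : stalk V S 1 1 G2.
Proof. by apply: stalk_gen; [right|exact: bihomog_stform]. Qed.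

Lemma crossing_lines_zeros : zeros S = V1 `|` V2 `|` V3.
Proof.
have V3P := cross_graphP (cst_homog a1) (cst_homog b0) V30.
have V1P := line_u0P frame frameE; have V2P := line_u1P frame frameE.
apply/seteqP; split=> x.
  move=> /zeros2P[xp [/[!bievalM]/mulf_zero[y0|a0] /mulf_zero[x0|b0']]].
  - case: xp => /eqP[]; apply: (xi_eta frameE); exact/sform_eq0.
  - by left; left; apply/V1P.
  - by left; right; apply/V2P.
  - by right; apply/(V3P _ xp); rewrite !pairing_cst.
case=> [[/V1P|/V2P]|xV] => [[xp [y0 b0']]|[xp [x0 a0]]|]; apply/zeros2P.
- by rewrite !bievalM y0 b0' mul0r mulr0.
- by rewrite !bievalM x0 a0 mul0r mulr0.
- have xp : proper_point x by case: xV.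
  have [a0 b0'] := iffLR (V3P x xp) xV; rewrite !pairing_cst in a0 b0'.
  by rewrite !bievalM a0 b0' !mulr0.
Qed.

(** On each component one factor of [G1] and one factor of [G2] are units, and the two remaining
    factors are the equations of that component. *)
Lemma crossing_lines : [/\ components (zeros S) = [set` [:: V1; V2; V3]],
  uniq [:: V1; V2; V3], multiplicity S V1 1, multiplicity S V2 1 &
  multiplicity S V3 1].
Proof.
have i1 : irreducible_closed V1 := param_curve_irreducible (line_param_curve u00 b00).
have i2 : irreducible_closed V2 := param_curve_irreducible (line_param_curve u10 a10).
have i3 : irreducible_closed V3 := param_curve_irreducible (graph_param_curve V3h V30).
have n12 : ~ V1 `<=` V2 := line_not_sub_line b00 (frame_independent frame).
have n21 : ~ V2 `<=` V1 := line_not_sub_line a10 (independentC (frame_independent frame)).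
have n13 : ~ V1 `<=` V3 := line_not_sub_graph u00 b00.
have n31 : ~ V3 `<=` V1 := graph_not_sub_line V30.
have n23 : ~ V2 `<=` V3 := line_not_sub_graph u10 a10.
have n32 : ~ V3 `<=` V2 := graph_not_sub_line V30.
have ZE := crossing_lines_zeros.
have [_ e2 e3 _] := frame.
split.
- exact: components3.
- by apply: uniq3 => E; [apply: n12|apply: n13|apply: n23]; rewrite E.
- apply: (multiplicity1 i1) => [|d e f]; first by apply: sub_zeros; rewrite ZE => x; left; left.
  have pr := irreducible_prime i1; have pd := irreducible_pad i1.
  apply: (line_stalk pr pd u00 b00 eta0 e2).
    apply: (stalk_mull i1 (@bihomog_tform K a1) _ (@bihomog_sform K eta)).
      exact: line_nonvanishing.
    by rewrite mulrC.
  apply: (stalk_mull i1 (@bihomog_sform K xi) _ (@bihomog_tform K b0)) => //.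
  exact: line_s_nonvanishing.
- apply: (multiplicity1 i2) => [|d e f]; first by apply: sub_zeros; rewrite ZE => x; left; right.
  have pr := irreducible_prime i2; have pd := irreducible_pad i2.
  apply: (line_stalk pr pd u10 a10 xi0 e3).
    apply: (stalk_mull i2 (@bihomog_tform K b0) _ (@bihomog_sform K xi)).
      exact/line_nonvanishing/independentC.
    by rewrite mulrC.
  apply: (stalk_mull i2 (@bihomog_sform K eta) _ (@bihomog_tform K a1)) => //.
  exact: line_s_nonvanishing.
- apply: (multiplicity1 i3) => [|d e f]; first by apply: sub_zeros; rewrite ZE => x; right.
  have pr := irreducible_prime i3; have pd := irreducible_pad i3.
  apply: (cross_stalk (cst_homog a1) (cst_homog b0) V30 pr pd).
  + by exists (u0, eval_row (cross (cst a1) (cst b0)) u0); [exact: graph_point|].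
  + rewrite pairing_cst.
    apply: (stalk_mull i3 (@bihomog_sform K eta) _ (@bihomog_tform K a1)) => //.
    apply: (nonvanishing (graph_point V30 u10)).
    by rewrite eta_u1 => /eqP; rewrite oner_eq0.
  + rewrite pairing_cst.
    apply: (stalk_mull i3 (@bihomog_sform K xi) _ (@bihomog_tform K b0)) => //.
    apply: (nonvanishing (graph_point V30 u00)).
    by rewrite xi_u0 => /eqP; rewrite oner_eq0.
Qed.

End CrossingLines.

(** * The transversal case: a line and a graph of bidegree (1,1) *)

Section LineAndGraph.
Variables (a1 b0 b1 : 'cV[K]_3).
Hypothesis ab : forall c d e : K,
  c *: a1 = d *: b0 + e *: b1 -> [/\ c = 0, d = 0 & e = 0].

Let M := xi *m b0^T + eta *m b1^T.
Let G1 := sform eta * tform a1.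
Let G2 := sform xi * tform b0 + sform eta * tform b1.
Let S : set (bipoly K) := [set G1; G2].
Let V1 := line u0 b0.
Let V2 := graph (cross (cst a1) (lin M)).

Let ab0 : independent a1 b0.
Proof.
by move=> c d e; have [] := @ab c d 0; rewrite ?scale0r ?addr0.
Qed.
Let a10 : a1 != 0. Proof. exact: independent_neq0 ab0. Qed.
Let b00 : b0 != 0. Proof. exact: independent_neq0 (independentC ab0). Qed.

Lemma line_and_graph_neq0 u : u != 0 -> eval_row (cross (cst a1) (lin M)) u != 0.
Proof.
move=> u_neq0; apply: cross_neq0; rewrite eval_cst eval_lin => c d.
rewrite mulmxDr !mulmxA [u *m xi]mx11_scalar [u *m eta]mx11_scalar !mul_scalar_mx.
move=> /(congr1 trmx); rewrite !linearZ !linearD /= !linearZ /= !trmxK scalerDr !scalerA.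
move=> /ab[-> dx dy]; split=> //; apply/eqP; apply: contraNT u_neq0 => d0.
have z (v : 'M[K]_1) : d * v 0 0 = 0 -> v = 0.
  move/eqP; rewrite mulf_eq0 (negPf d0) => /eqP v0.
  by rewrite [v]mx11_scalar v0 raddf0.
by apply/eqP/(xi_eta frameE); exact: z.
Qed.
Let V20 := line_and_graph_neq0.
Let V2h := cross_homog (cst_homog a1) (lin_homog M).

Let G2E : pairing (lin M) = G2. Proof. exact: pairing_lin_outer. Qed.

Let bihomog_G2 : bihomog 1 1 G2.
Proof. by apply: bihomogD; exact: bihomog_stform. Qed.

Let S1 V : stalk V S 1 1 G1.
Proof. by apply: stalk_gen; [left|exact: bihomog_stform]. Qed.
Let S2 V : stalk V S 1 1 G2.
Proof. by apply: stalk_gen; [right|]. Qed.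

Lemma line_and_graph_zeros : zeros S = V1 `|` V2.
Proof.
have V2P := cross_graphP (cst_homog a1) (lin_homog M) V20.
have V1P := line_u0P frame frameE.
apply/seteqP; split=> x.
  move=> /zeros2P[xp [/[!bievalM]/mulf_zero y0 g2]].
  have [ye|/eqP ye] := pselect (bieval x (sform eta) = 0); last first.
    right; apply/(V2P _ xp); rewrite pairing_cst G2E; split=> //.
    by case: y0 => // y0; rewrite y0 eqxx in ye.
  left; apply/V1P; split=> //; split=> //.
  move: g2; rewrite bievalD !bievalM ye mul0r addr0 => /mulf_zero[] // x0.
  by case: xp => /eqP[]; apply: (xi_eta frameE); exact/sform_eq0.
case=> [/V1P[xp [y0 b0']]|xV]; apply/zeros2P.
  by rewrite bievalD !bievalM y0 b0' !mul0r mulr0 addr0.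
have xp : proper_point x by case: xV.
have [a0 b0'] := iffLR (V2P x xp) xV; rewrite pairing_cst G2E in a0 b0'.
by rewrite b0' bievalM a0 mulr0.
Qed.

(** Along V1 the form [tform a1] is a unit, so [sform eta] is a local equation, and [G2] reduces to
    [tform b0] times the unit [sform xi]. Along V2 it is [sform eta] that is a unit, leaving
    [tform a1] and [G2]. *)
Lemma line_and_graph : [/\ components (zeros S) = [set` [:: V1; V2]],
  uniq [:: V1; V2], multiplicity S V1 1 & multiplicity S V2 1].
Proof.
have i1 : irreducible_closed V1 := param_curve_irreducible (line_param_curve u00 b00).
have i2 : irreducible_closed V2 := param_curve_irreducible (graph_param_curve V2h V20).
have n12 : ~ V1 `<=` V2 := line_not_sub_graph u00 b00.
have n21 : ~ V2 `<=` V1 := graph_not_sub_line V20.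
have ZE := line_and_graph_zeros.
have [_ e2 e3 _] := frame.
split.
- exact: components2.
- by apply: uniq2 => E; apply: n12; rewrite E.
- apply: (multiplicity1 i1) => [|d e f]; first by apply: sub_zeros; rewrite ZE => x; left.
  have pr := irreducible_prime i1; have pd := irreducible_pad i1.
  have Sy : stalk V1 S 1 0 (sform eta).
    apply: (stalk_mull i1 (@bihomog_tform K a1) _ (@bihomog_sform K eta)).
      exact: line_nonvanishing.
    by rewrite mulrC.
  apply: (line_stalk pr pd u00 b00 eta0 e2) => //.
  apply: (stalk_mull i1 (@bihomog_sform K xi) _ (@bihomog_tform K b0)).
    exact: line_s_nonvanishing.
  rewrite (_ : _ * _ = G2 - tform b1 * sform eta); last by rewrite /G2; ring.
  apply: stalkD; first exact: S2.
  by apply: stalkN => //; apply: (stalkM pd (@bihomog_tform K b1) Sy).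
- apply: (multiplicity1 i2) => [|d e f]; first by apply: sub_zeros; rewrite ZE => x; right.
  have pr := irreducible_prime i2; have pd := irreducible_pad i2.
  apply: (cross_stalk (cst_homog a1) (lin_homog M) V20 pr pd).
  + by exists (u0, eval_row (cross (cst a1) (lin M)) u0); [exact: graph_point|].
  + rewrite pairing_cst.
    apply: (stalk_mull i2 (@bihomog_sform K eta) _ (@bihomog_tform K a1)) => //.
    apply: (nonvanishing (graph_point V20 u10)).
    by rewrite eta_u1 => /eqP; rewrite oner_eq0.
  + by rewrite G2E.
Qed.

End LineAndGraph.

(** * The tangent case: a double line and a fiber of the second projection *)

Section DoubleLine.
Variables b0 b1 : 'cV[K]_3.
Hypothesis bb : independent b0 b1.

Let G1 := sform eta * tform b0.
Let G2 := sform xi * tform b0 + sform eta * tform b1.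
Let S : set (bipoly K) := [set G1; G2].
Let V1 := line u0 b0.
Let V2 := graph (cross (cst b0) (cst b1)).

Let b00 : b0 != 0. Proof. exact: independent_neq0 bb. Qed.
Let V20 u : u != 0 -> eval_row (cross (cst b0) (cst b1)) u != 0.
Proof. by move=> _; exact: cst_cross_neq0. Qed.
Let V2h := cross_homog (cst_homog b0) (cst_homog b1).

Let bihomog_G2 : bihomog 1 1 G2.
Proof. by apply: bihomogD; exact: bihomog_stform. Qed.

Let S1 V : stalk V S 1 1 G1.
Proof. by apply: stalk_gen; [left|exact: bihomog_stform]. Qed.
Let S2 V : stalk V S 1 1 G2.
Proof. by apply: stalk_gen; [right|]. Qed.

Let V1ab : param_curve V1 0 1. Proof. exact: line_param_curve. Qed.
Let i1 : irreducible_closed V1. Proof. exact: param_curve_irreducible V1ab. Qed.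
Let i2 : irreducible_closed V2.
Proof. exact: param_curve_irreducible (graph_param_curve V2h V20). Qed.
Let pr1 := irreducible_prime i1.
Let pd1 := irreducible_pad i1.

Let xi_V1 : ~ vanishes_on V1 (sform xi).
Proof. exact: line_s_nonvanishing. Qed.
Let b1_V1 : ~ vanishes_on V1 (tform b1).
Proof. exact/line_nonvanishing/independentC. Qed.

Lemma double_line_zeros : zeros S = V1 `|` V2.
Proof.
have V2P := cross_graphP (cst_homog b0) (cst_homog b1) V20.
have V1P := line_u0P frame frameE.
apply/seteqP; split=> x.
  move=> /zeros2P[xp [/[!bievalM]/mulf_zero y0 g2]].
  have [ye|/eqP ye] := pselect (bieval x (sform eta) = 0).
    left; apply/V1P; split=> //; split=> //.
    move: g2; rewrite bievalD !bievalM ye mul0r addr0 => /mulf_zero[] // x0.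
    by case: xp => /eqP[]; apply: (xi_eta frameE); exact/sform_eq0.
  have z0 : bieval x (tform b0) = 0 by case: y0 => // y0; rewrite y0 eqxx in ye.
  right; apply/(V2P _ xp); rewrite !pairing_cst; split=> //.
  move: g2; rewrite bievalD !bievalM z0 mulr0 add0r => /mulf_zero[] // y1.
  by rewrite y1 eqxx in ye.
case=> [/V1P[xp [y0 z0]]|xV]; apply/zeros2P.
  by rewrite bievalD !bievalM y0 z0 !mul0r mulr0 addr0.
have xp : proper_point x by case: xV.
have [z0 z1] := iffLR (V2P x xp) xV; rewrite !pairing_cst in z0 z1.
by rewrite bievalD !bievalM z0 z1 !mulr0 addr0.
Qed.

Section Tangent.
Variables (c : curve_chart V1 0 1) (w : 'rV[K]_3).
Hypothesis wb0 : w *m b0 = 1%:M.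

(* The derivative along the first-order thickening of V1 inside Z: the        *)
(* direction moves eta by [xi] and [tform b0] by [- tform b1].                *)
Let tau (i : 'I_(2 + 3)) : {poly K} := match split i with
  | inl i => pull c (sform xi) * (u1 0 i)%:P
  | inr j => - pull c (tform b1) * (w 0 j)%:P
  end.

Definition tangent_derivation (f : MP) := \sum_i pull c (mderiv i f) * tau i.
Local Notation D := tangent_derivation.

Lemma tangent_derivationD f g : D (f + g) = D f + D g.
Proof.
by rewrite -big_split; apply: eq_bigr => i _; rewrite mderivD pullD mulrDl.
Qed.

Lemma tangent_derivationZ k f : D (k *: f) = k *: D f.
Proof.
by rewrite scaler_sumr; apply: eq_bigr => i _; rewrite mderivZ pullZ scalerAl.
Qed.

Lemma tangent_derivationM f g : D (f * g) = pull c f * D g + pull c g * D f.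
Proof.
rewrite !mulr_sumr -big_split; apply: eq_bigr => i _ /=.
by rewrite mderivM pullD !pullM; ring.
Qed.

Lemma tangent_derivationX k : D 'X_k = tau k.
Proof.
rewrite /D (bigD1 k) //= big1 => [|i ik].
  rewrite mderivX mnm1E eqxx scale1r (_ : _ - _ = 0)%MM ?mpolyX0 ?pull1 ?mul1r ?addr0 //.
  by apply/mnmP => j; rewrite mnmBE subnn mnm0E.
by rewrite mderivX mnm1E eq_sym (negPf ik) scale0r pull0 mul0r.
Qed.

Lemma tangent_derivation_sum (I : Type) (r : seq I) (F : I -> MP) :
  D (\sum_(i <- r) F i) = \sum_(i <- r) D (F i).
Proof.
elim: r => [|i r IH]; last by rewrite !big_cons tangent_derivationD IH.
by rewrite !big_nil -[0 in LHS](scale0r 0) tangent_derivationZ scale0r.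
Qed.

Lemma tangent_derivation_sform y :
  D (sform y) = ((u1 *m y) 0 0) *: pull c (sform xi).
Proof.
rewrite tangent_derivation_sum mxE scaler_suml; apply: eq_bigr => i _.
rewrite tangent_derivationZ tangent_derivationX /tau (unsplitK (inl i)).
by rewrite mulrC mul_polyC scalerA mulrC.
Qed.

Lemma tangent_derivation_tform b :
  D (tform b) = - ((w *m b) 0 0) *: pull c (tform b1).
Proof.
rewrite tangent_derivation_sum mxE -sumrN scaler_suml; apply: eq_bigr => i _.
rewrite tangent_derivationZ tangent_derivationX /tau (unsplitK (inr i)).
by rewrite mulNr scalerN [pull c _ * _]mulrC mul_polyC scalerA scaleNr mulrC.
Qed.

(** The forms vanishing on V1 to first order along the chosen normal direction. *)
Definition tangent_ideal (f : MP) : Prop := pull c f = 0 /\ D f = 0.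

Lemma pull_eta : pull c (sform eta) = 0.
Proof.
apply/(pull_vanish c (@bihomog_sform K eta)) => x xV.
by have [_ []] := iffLR (line_u0P frame frameE x b0) xV.
Qed.

Lemma pull_b0 : pull c (tform b0) = 0.
Proof.
apply/(pull_vanish c (@bihomog_tform K b0)) => x xV.
by have [_ []] := iffLR (line_u0P frame frameE x b0) xV.
Qed.

Lemma tangent_ideal_gen f : S f -> tangent_ideal f.
Proof.
have [e1 e2 e3 e4] := frame.
have De : D (sform eta) = pull c (sform xi).
  by rewrite tangent_derivation_sform e4 mxE scale1r.
have Db : D (tform b0) = - pull c (tform b1).
  by rewrite tangent_derivation_tform wb0 mxE scaleN1r.
case=> ->; split.
- by rewrite pullM pull_eta mul0r.
- by rewrite tangent_derivationM pull_eta pull_b0 !mul0r addr0.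
- by rewrite pullD !pullM pull_eta pull_b0 mulr0 mul0r addr0.
(* The two surviving terms are the product of [sform xi] and [tform b1] with opposite signs, by the
   choice of [tau]. *)
- rewrite tangent_derivationD !tangent_derivationM pull_eta pull_b0 De Db.
  by ring.
Qed.

Lemma tangent_scheme_ideal : scheme_local_ideals S V1 (num_ideal V1 tangent_ideal).
Proof.
apply: (num_ideal_scheme pr1 pd1).
- by split; rewrite ?pull0 // -[0 in LHS](scale0r 0) tangent_derivationZ scale0r.
- by move=> f g [f0 Df] [g0 Dg]; split; rewrite ?pullD ?tangent_derivationD ?f0 ?g0 ?Df ?Dg addr0.
- by move=> f g [f0 Df]; split; rewrite ?pullM ?tangent_derivationM f0 ?Df ?mul0r ?mulr0 ?addr0.
- exact: tangent_ideal_gen.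
Qed.

Lemma tangent_idealP d e f g : bihomog d e f -> bihomog d e g ->
  ~ vanishes_on V1 g -> num_ideal V1 tangent_ideal (tofrac f / tofrac g) ->
  tangent_ideal f.
Proof.
move=> fh gh gV; apply: (@num_idealP K V1 tangent_ideal _ _ _ _ _ _ fh gh gV).
  move=> d1 e1 d2 e2 f1 g1 f1h g1h g1V [fg0 Dfg].
  have g10 : pull c g1 != 0 by apply/eqP => /(pull_vanish c g1h).
  have f10 : pull c f1 = 0.
    by move/eqP: fg0; rewrite pullM mulf_eq0 (negPf g10) orbF => /eqP.
  split=> //; move/eqP: Dfg; rewrite tangent_derivationM f10 mul0r add0r mulf_eq0.
  by rewrite (negPf g10) => /eqP.
by move=> f1 g1 [f0 Df]; split; rewrite ?pullM ?tangent_derivationM f0 ?Df ?mul0r ?mulr0 ?addr0.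
Qed.

(** The length is at least 2: [tform b0] vanishes on V1 but its derivative [- tform b1] does not, so
    it separates the tangent ideal from the ideal of V1. *)
Lemma tangent_chain : has_chain (scheme_local_ideals S V1) 2.
Proof.
exists (fun i => match i with
  | 0%N => num_ideal V1 tangent_ideal
  | 1%N => num_ideal V1 (vanishes_on V1)
  | _ => num_ideal V1 setT end).
split=> [[|[|i]] _|[|[|//]] _].
- exact: tangent_scheme_ideal.
- apply: (num_ideal_vanishing pr1 pd1); apply: sub_zeros.
  by rewrite double_line_zeros => x; left.
- exact: (num_ideal_scheme pr1 pd1).
- split=> [q [d [e [f [g [fh gh gV [f0 _] ->]]]]]|].
    by exists d, e, f, g; split=> //; exact/(pull_vanish c fh).
  have [h hh hV] := pd1 0%N 1%N.
  move=> /(_ (tofrac (tform b0) / tofrac h)) H.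
  have b0h := @bihomog_tform K b0.
  have [|_ Db] := tangent_idealP b0h hh hV _.
    by apply: H; exists 0%N, 1%N, (tform b0), h; split=> //; exact/(pull_vanish c b0h)/pull_b0.
  move/eqP: Db; rewrite tangent_derivation_tform wb0 mxE scaleN1r oppr_eq0 => /eqP.
  by move/(pull_vanish c (@bihomog_tform K b1)).
- exact: (num_ideal_vanishingT pr1 pd1).
Qed.

End Tangent.

(* Contains the equations of V1, so [tform b0] generates the maximal ideal of *)
(* the local ring of Z at V1; as the square of [tform b0] is zero there, the  *)
(* length is at most 2.                                                       *)
Let mod_b0 T d e f := bihomog d e f /\ exists D E E' g p,
  [/\ bihomog D E g, ~ vanishes_on V1 g, bihomog (D + d) E' p, E'.+1 = (E + e)%N &
     stalk V1 T (D + d) (E + e) (g * f - p * tform b0)].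

Let mod_b0_graded T : graded_ideal (mod_b0 T).
Proof.
have Sid := stalk_graded T pr1 pd1.
split=> [d e|d e f f' [fh [D [E [E' [g [p [gh gV ph EE Sf]]]]]]]
    [fh' [D' [F [F' [g' [p' [gh' gV' ph' FF Sf']]]]]]]|d e d' e' h f hh
    [fh [D [E [E' [g [p [gh gV ph EE Sf]]]]]]]].
- split; first exact: bihomog0.
  have [g gh gV] := pd1 0%N 1%N; exists 0%N, 1%N, e, g, 0; split=> //.
    exact: bihomog0.
  by rewrite mulr0 mul0r subrr; apply: gideal0.
- split; first exact: bihomogD.
  exists (D' + D)%N, (F + E)%N, (F + E')%N, (g' * g), (g' * p + g * p'); split.
  + exact: bihomogM.
  + exact: pr1 gh' gh gV' gV.
  + apply: bihomogD; first by rewrite -addnA; apply: bihomogM.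
    have -> : (D' + D + d = D + (D' + d))%N by lia.
    have -> : (F + E' = E + F')%N by lia.
    exact: bihomogM.
  + by lia.
  + have -> : g' * g * (f + f') - (g' * p + g * p') * tform b0 =
        g' * (g * f - p * tform b0) + g * (g' * f' - p' * tform b0) by ring.
    apply: (gidealD Sid); first by rewrite -!addnA; apply: (gidealM Sid gh' Sf).
    have -> : (D' + D + d = D + (D' + d))%N by lia.
    have -> : (F + E + e = E + (F + e))%N by lia.
    exact: (gidealM Sid gh Sf').
- split; first exact: bihomogM.
  exists D, E, (e' + E')%N, g, (h * p); split=> //.
  + by rewrite addnCA; apply: bihomogM.
  + by lia.
  + have -> : g * (h * f) - h * p * tform b0 = h * (g * f - p * tform b0) by ring.
    by rewrite addnCA [(E + _)%N]addnCA; apply: (gidealM Sid hh Sf).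
Qed.

(** [G2] expresses [tform b1 * sform eta] as a multiple of [tform b0], and [tform b1] is a unit
    along V1; thus both equations of V1 are local multiples of [tform b0]. *)
Let mod_b0_vanishing T d e f : S `<=` T -> bihomog d e f -> vanishes_on V1 f ->
  mod_b0 T d e f.
Proof.
move=> ST fh fV; have [e1 e2 e3 e4] := frame.
have T2 : stalk V1 T 1 1 G2 by apply: stalk_gen; [apply: ST; right|].
apply: (line_ideal (mod_b0_graded T) u00 b00 eta0 e2) fh fV.
  split; first exact: bihomog_sform.
  exists 0%N, 1%N, 0%N, (tform b1), (- sform xi); split=> //.
  - exact: bihomog_tform.
  - by apply/bihomogN/bihomog_sform.
  - by have -> : tform b1 * sform eta - - sform xi * tform b0 = G2 by rewrite /G2; ring.
split; first exact: bihomog_tform.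
exists 0%N, 0%N, 0%N, 1, 1; split=> //; first exact: bihomog1.
- exact: nonvanishing1.
- exact: bihomog1.
- by rewrite subrr; apply: stalk0.
Qed.

(** Eliminating [sform eta] from [G1] and [G2] leaves [sform xi] times the square, and [sform xi] is
    a unit along V1. *)
Let b0_square : stalk V1 S 0 2 (tform b0 * tform b0).
Proof.
apply: (stalk_mull i1 (@bihomog_sform K xi) xi_V1).
  exact: (bihomogM (@bihomog_tform K b0) (@bihomog_tform K b0)).
have -> : sform xi * (tform b0 * tform b0) = tform b0 * G2 - tform b1 * G1.
  by rewrite /G1 /G2; ring.
apply: stalkD; first exact: (stalkM pd1 (@bihomog_tform K b0) (S2 V1)).
by apply: stalkN => //; apply: (stalkM pd1 (@bihomog_tform K b1) (S1 V1)).
Qed.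

(** If the coefficient [p] of [tform b0] vanishes on V1, it is itself a multiple of [tform b0], and
    the square is zero. *)
Let stalk_of_mod_b0 d e f D E E' g p : bihomog d e f -> bihomog D E g ->
  ~ vanishes_on V1 g -> bihomog (D + d) E' p -> E'.+1 = (E + e)%N ->
  stalk V1 S (D + d) (E + e) (g * f - p * tform b0) -> vanishes_on V1 p ->
  stalk V1 S d e f.
Proof.
move=> fh gh gV ph EE Sf pV.
have [_ [D' [F [F' [g' [p' [gh' gV' ph' FF Sp]]]]]]] :=
  mod_b0_vanishing (@subset_refl _ S) ph pV.
apply: (stalk_mull i1 gh gV fh).
have gfh : bihomog (D + d) (E + e) (g * f) by exact: bihomogM.
apply: (stalk_mull i1 gh' gV' gfh).
have -> : g' * (g * f) = g' * (g * f - p * tform b0) +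
    (tform b0 * (g' * p - p' * tform b0) + p' * (tform b0 * tform b0)) by ring.
have Sid := stalk_graded S pr1 pd1.
apply: (gidealD Sid); first exact: (gidealM Sid gh' Sf).
apply: (gidealD Sid).
  have := gidealM Sid (@bihomog_tform K b0) Sp; rewrite add0n.
  by have -> : (1 + (F + E') = F + (E + e))%N by lia.
have := gidealM Sid ph' b0_square; rewrite addn0.
by have -> : (F' + 2 = F + (E + e))%N by lia.
Qed.

(** An element of [F 1] outside [F 0] is a unit, or a unit times [tform b0]; so [F 1] contains the
    maximal ideal, [F 2] is the whole local ring, and nothing is left for [F 3]. *)
Lemma double_line_length : ~ has_chain (scheme_local_ideals S V1) 3.
Proof.
move=> [F [FS Flt]].
have Fmax : num_ideal V1 (vanishes_on V1) `<=` F 1%N.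
  have [_ /existsNP[q /not_implyP[F1q F0q]]] := Flt 0%N isT.
  have SF := FS 1%N isT; have [JV JS] := SF.
  have [/(_ q F1q)[d [e [f [g [fh gh gV qE]]]]] _ _ _] := JV.
  have one : ~ vanishes_on V1 1 := nonvanishing1 pd1.
  (* [T], the forms belonging to [F 1], contains [S] and the new numerator [f]; from it [tform b0]
     is recovered by cancelling units. *)
  have JT : scheme_local_ideals (local_forms V1 (F 1%N)) V1 (F 1%N).
    exact: local_forms_scheme.
  have Tf : stalk V1 (local_forms V1 (F 1%N)) d e f.
    apply: stalk_gen => //; apply: (local_formsP pr1 JV fh gh gV).
    by rewrite -qE.
  have ST : S `<=` local_forms V1 (F 1%N).
    move=> h Sh; have hh : bihomog 1 1 h by case: Sh => ->; [exact: bihomog_stform|].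
    by exists 1%N, 1%N; split=> // l lh lV; apply: JS Sh hh lh lV.
  set T := local_forms V1 (F 1%N) in JT Tf ST.
  case: (pselect (vanishes_on V1 f)) => fV; last first.
    move=> r [d' [e' [f' [g' [fh' gh' gV' _ ->]]]]].
    by apply: (local_ideal_unit JV fh gh fV gV); [rewrite -qE|exists d', e', f', g'].
  have [_ [D [E [E' [k [p [kh kV ph EE Sp]]]]]]] :=
    mod_b0_vanishing (@subset_refl _ S) fh fV.
  case: (pselect (vanishes_on V1 p)) => pV.
    have [_ fJ] := stalk_of_mod_b0 fh kh kV ph EE Sp pV.
    by case: F0q; rewrite qE; apply: (fJ _ (FS 0%N isT)).
  have Tid := stalk_graded T pr1 pd1.
  have ST' := stalk_sub ST.
  have Tb0 : stalk V1 T 0 1 (tform b0).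
    apply: (stalk_mull i1 ph pV (@bihomog_tform K b0)).
    rewrite addn0 addn1 EE.
    have -> : p * tform b0 = k * f - (k * f - p * tform b0) by ring.
    apply: stalkD; first exact: (gidealM Tid kh Tf).
    by apply: stalkN => //; exact: ST'.
  move=> _ [d' [e' [f' [g' [fh' gh' gV' fV' ->]]]]].
  have [_ [D' [F0 [F' [k' [p' [kh' kV' ph' FF Sp']]]]]]] :=
    mod_b0_vanishing (@subset_refl _ S) fh' fV'.
  have [_ +] : stalk V1 T d' e' f'; last by apply.
  apply: (stalk_mull i1 kh' kV' fh').
  have -> : k' * f' = (k' * f' - p' * tform b0) + p' * tform b0 by ring.
  apply: (gidealD Tid); first exact: ST'.
  by have := gidealM Tid ph' Tb0; rewrite addn0 addn1 FF.
have [_ /existsNP[q /not_implyP[F2q F1q]]] := Flt 1%N isT.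
have [JV JS] := FS 2%N isT.
have [/(_ q F2q)[d [e [f [g [fh gh gV qE]]]]] _ _ _] := JV.
have fV : ~ vanishes_on V1 f.
  by move=> fV; apply: F1q; apply: Fmax; exists d, e, f, g.
have F2 : local_ring V1 `<=` F 2%N.
  by apply: (local_ideal_unit JV fh gh fV gV); rewrite -qE.
have [_ /existsNP[r /not_implyP[F3r F2r]]] := Flt 2%N isT.
by apply/F2r/F2; have [[F3V _ _ _] _] := FS 3%N isT; apply: F3V.
Qed.

Lemma double_line : [/\ components (zeros S) = [set` [:: V1; V2]],
  uniq [:: V1; V2], multiplicity S V1 2 & multiplicity S V2 1].
Proof.
have n12 : ~ V1 `<=` V2 := line_not_sub_graph u00 b00.
have n21 : ~ V2 `<=` V1 := graph_not_sub_line V20.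
have ZE := double_line_zeros.
split.
- exact: components2.
- by apply: uniq2 => E; apply: n12; rewrite E.
- split; last exact: double_line_length.
  have [c _] := param_curve_chart V1ab.
  have [t tb1 tb0] := separate bb.
  apply: (@tangent_chain c (((t *m b0) 0 0)^-1 *: t)).
  rewrite -scalemxAl [t *m b0]mx11_scalar mxE eqxx mulr1n scale_scalar_mx mulVf //.
  apply: contraNneq tb0 => e; rewrite [t *m b0]mx11_scalar e raddf0 //.
- apply: (multiplicity1 i2) => [|d e f]; first by apply: sub_zeros; rewrite ZE => x; right.
  have pr := irreducible_prime i2; have pd := irreducible_pad i2.
  have Sb0 : stalk V2 S 0 1 (tform b0).
    apply: (stalk_mull i2 (@bihomog_sform K eta) _ (@bihomog_tform K b0)) => //.
    apply: (nonvanishing (graph_point V20 u10)).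
    by rewrite eta_u1 => /eqP; rewrite oner_eq0.
  apply: (cross_stalk (cst_homog b0) (cst_homog b1) V20 pr pd).
  + by exists (u0, eval_row (cross (cst b0) (cst b1)) u0); [exact: graph_point|].
  + by rewrite pairing_cst.
  + rewrite pairing_cst.
    apply: (stalk_mull i2 (@bihomog_sform K eta) _ (@bihomog_tform K b1)) => //.
      apply: (nonvanishing (graph_point V20 u10)).
      by rewrite eta_u1 => /eqP; rewrite oner_eq0.
    have -> : sform eta * tform b1 = G2 - sform xi * tform b0 by rewrite /G2; ring.
    apply: stalkD; first exact: S2.
    by apply: stalkN => //; apply: (stalkM pd (@bihomog_sform K xi) Sb0).
Qed.

End DoubleLine.
End Frame.

(** * The case of a line missing the conic: a graph of bidegree (1,2) *)

Section SmoothGraph.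
Variables M M' : 'M[K]_(2, 3).
Hypothesis MM' : forall u : 'rV[K]_2, u != 0 -> independent (u *m M) (u *m M').

Let S : set (bipoly K) := [set pairing (lin M); pairing (lin M')].
Let V := graph (cross (lin M) (lin M')).

Let V0 u : u != 0 -> eval_row (cross (lin M) (lin M')) u != 0.
Proof. by move=> u0; apply: cross_neq0; rewrite !eval_lin; exact: MM'. Qed.
Let Vh := cross_homog (lin_homog M) (lin_homog M').

Lemma smooth_graph_zeros : zeros S = V.
Proof.
have VP := cross_graphP (lin_homog M) (lin_homog M') V0.
apply/seteqP; split=> x; first by move=> /zeros2P[xp ?]; exact/(VP _ xp).
move=> xV; have xp : proper_point x by case: xV.
by apply/zeros2P; split=> //; apply/(VP _ xp).
Qed.

Let smooth_graph_stalk V' d e f : vanishing_prime V' -> pad_forms V' ->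
  (exists2 x, V' x & x.1 != 0) -> bihomog d e f -> vanishes_on V f ->
  stalk V' S d e f.
Proof.
move=> pr pd xV'; apply: (cross_stalk (lin_homog M) (lin_homog M') V0 pr pd xV').
  by apply: stalk_gen; [left|exact: bihomog_pairing (lin_homog M)].
by apply: stalk_gen; [right|exact: bihomog_pairing (lin_homog M')].
Qed.

Let Vi : irreducible_closed V := param_curve_irreducible (graph_param_curve Vh V0).

Lemma smooth_graph : components (zeros S) = [set` [:: V]] /\ multiplicity S V 1.
Proof.
split.
  rewrite smooth_graph_zeros; apply: components_list => [W|W W'|].
  - by rewrite mem_seq1 => /eqP ->.
  - by rewrite !mem_seq1 => /eqP -> /eqP ->.
  apply/seteqP; split=> x; first by move=> Vx; exists V; rewrite ?mem_seq1.
  by move=> [W]; rewrite mem_seq1 => /eqP ->.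
apply: (multiplicity1 Vi) => [|d e f fh fV].
  by apply: sub_zeros; rewrite smooth_graph_zeros.
apply: smooth_graph_stalk fh fV; [exact: irreducible_prime|exact: irreducible_pad|].
have [Vc [x Vx] _] := Vi; exists x => //; exact: (closed_proper Vc Vx).1.
Qed.

(** Even at closed points the two equations generate all forms vanishing on V, and vanishing on V is
    insensitive to taking powers; the hypothesis on the power is tested on the ideal of numerators
    vanishing on V. *)
Lemma smooth_graph_reduced : scheme_isomorphic_P1 S.
Proof.
split; last by rewrite smooth_graph_zeros; exact: graph_isomorphic Vh V0.
move=> x xZ q k [d [e [f [g [fh gh gx qE]]]]] qk J SJ.
have xp : proper_point x by have [] := iffLR (zeros2P _ _ x) xZ.
have Vx : V x by rewrite -smooth_graph_zeros.
have [c _] := param_curve_chart (graph_param_curve Vh V0).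
have pr : vanishing_prime [set x] := @point_prime _ x.
have pd : pad_forms [set x] := @point_pad _ [set x] x erefl xp.
have SV0 : scheme_local_ideals S [set x] (num_ideal [set x] (vanishes_on V)).
  apply: (num_ideal_vanishing pr pd); apply: sub_zeros.
  by rewrite smooth_graph_zeros.
have nV d' e' (h : MP) : bihomog d' e' h -> ~ vanishes_on [set x] h -> ~ vanishes_on V h.
  by move=> hh hx hV; apply: hx => _ ->; exact: hV.
have fkV : vanishes_on V (f ^+ k).
  have gkx : ~ vanishes_on [set x] (g ^+ k).
    move=> /(_ x erefl)/eqP; rewrite bievalXn expf_eq0 => /andP[_ /eqP gx0].
    by apply: gx => _ ->.
  have := qk _ SV0; rewrite qE expr_div_n -!tofracXn.
  apply: (@num_idealP K [set x] (vanishes_on V) _ _ _ _ _ _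
    (@bihomogXn K _ _ _ k fh) (@bihomogXn K _ _ _ k gh) gkx).
    move=> d1 e1 d2 e2 f1 f2 f1h f2h f2x f12.
    apply: contrapT => f1V; apply: (irreducible_prime Vi f1h f2h f1V) => //.
    exact: nV f2h f2x.
  by move=> f1 f2 f1V y Vy; rewrite bievalM f1V // mul0r.
have fV : vanishes_on V f.
  move=> y Vy; have /eqP := fkV y Vy; rewrite bievalXn expf_eq0 => /andP[_].
  by move/eqP.
have [_ fJ] : stalk [set x] S d e f.
  by apply: smooth_graph_stalk => //; exists x => //; case: xp.
by rewrite qE; exact: fJ.
Qed.

End SmoothGraph.

End SchemesByType.

(** * Cycle classes and independence of the basis of the pencil *)

Section SchemeInvariance.
Variable K : numClosedFieldType.
Local Notation MP := {mpoly K[2 + 3]}.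
Implicit Types (V L : set (bipoint K)) (S : set (bipoly K)) (f g : MP).

Lemma L1_neq_L2 L1 L2 : fiber_line L1 -> fiber_pr2 L2 -> L1 <> L2.
Proof.
move=> [a [h [a0 h0 ->]]] [b b0 ->]; rewrite fiber_pr2_graph -/(line a h) => E.
by apply: (@line_not_sub_graph K a h (fun j => (b 0 j)%:MP) a0 h0); rewrite E.
Qed.

Lemma fiber_line_param L : fiber_line L -> param_curve L 0 1.
Proof. by move=> [a [h [a0 h0 ->]]]; apply: line_param_curve. Qed.

Lemma fiber_pr2_param L : fiber_pr2 L -> param_curve L 1 0.
Proof.
move=> [b b0 ->]; rewrite fiber_pr2_graph.
apply: (@graph_param_curve K 0) => [j|u u0]; first exact: dhomog_C.
by rewrite (_ : eval_row _ _ = b) //; apply/rowP => j; rewrite mxE mevalC.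
Qed.

Lemma num_equiv_single V V' a b : param_curve V a b -> param_curve V' a b ->
  num_equiv [:: (1, V)] [:: (1, V')].
Proof.
move=> Vab Vab'.
apply: (@num_equiv_classes _ _ _ (fun=> (a, b)) (fun=> (a, b))) => [t|t||].
- by rewrite mem_seq1 => /eqP ->.
- by rewrite mem_seq1 => /eqP ->.
- by rewrite !big_seq1.
- by rewrite !big_seq1.
Qed.

Definition two_classes (V : set (bipoint K)) (k l : nat * nat) W :=
  if pselect (W = V) then k else l.

Lemma two_classesE V V' k l : V <> V' ->
  two_classes V k l V = k /\ two_classes V k l V' = l.
Proof.
move=> n12; rewrite /two_classes; split; first by case: pselect => [//|h]; case: h.
by case: pselect => // e; case: n12.
Qed.

Lemma num_equiv_combination (c : Defs.cycle K) (kl : set (bipoint K) -> nat * nat)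
    (k l : int) L1 L2 : fiber_line L1 -> fiber_pr2 L2 ->
  (forall t, t \in c -> param_curve t.2 (kl t.2).1 (kl t.2).2) ->
  \sum_(t <- c) t.1 * ((kl t.2).1)%:Z = l ->
  \sum_(t <- c) t.1 * ((kl t.2).2)%:Z = k ->
  num_equiv c [:: (k, L1); (l, L2)].
Proof.
move=> L1f L2f cP s1 s2; have [e1 e2] := two_classesE (0, 1)%N (1, 0)%N (L1_neq_L2 L1f L2f).
apply: (num_equiv_classes cP (kl' := two_classes L1 (0, 1)%N (1, 0)%N)) => [t||].
- rewrite !inE => /orP[] /eqP -> /=; [rewrite e1|rewrite e2].
    exact: fiber_line_param.
  exact: fiber_pr2_param.
- by rewrite s1 !big_cons big_nil /= e1 e2 mulr0 mulr1 add0r addr0.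
- by rewrite s2 !big_cons big_nil /= e1 e2 mulr0 mulr1 !addr0.
Qed.

(* The class (a, b) of a curve, i.e. its intersection numbers with the two    *)
(* rulings, corresponds to a [L2] + b [L1].                                   *)
Lemma pure_dim_cycle S (c : Defs.cycle K) (kl : set (bipoint K) -> nat * nat) L1 L2 :
  fiber_line L1 -> fiber_pr2 L2 -> c != [::] -> uniq [seq t.2 | t <- c] ->
  components (zeros S) = [set` [seq t.2 | t <- c]] ->
  (forall t, t \in c -> param_curve t.2 (kl t.2).1 (kl t.2).2) ->
  (forall t, t \in c -> exists2 n : nat, multiplicity S t.2 n & t.1 = n%:Z) ->
  \sum_(t <- c) t.1 * ((kl t.2).1)%:Z = 1 ->
  \sum_(t <- c) t.1 * ((kl t.2).2)%:Z = 2 ->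
  pure_dim (zeros S) 1 /\
  exists2 c, fundamental_cycle S c & num_equiv c [:: (2, L1); (1, L2)].
Proof.
move=> L1f L2f c0 cu ZE cP cM s1 s2.
have cZ V : V \in [seq t.2 | t <- c] -> components (zeros S) V by rewrite ZE.
split; last first.
  exists c; last exact: num_equiv_combination s1 s2.
  by split=> // V; rewrite ZE.
split.
  have [t tc] : exists t, t \in c.
    by case: (c) c0 => // t r _; exists t; rewrite mem_head.
  have [[_ [x Vx] _] VZ _] := cZ t.2 (map_f _ tc).
  by exists x; exact: VZ.
by move=> V; rewrite ZE => /mapP[t tc ->]; exact: param_curve_krull_dim (cP t tc).
Qed.

(** Equality of all data from which components and multiplicities are computed, although the
    generating sets differ. *)
Definition scheme_eq S S' := zeros S = zeros S' /\
  scheme_local_ideals S = scheme_local_ideals S'.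

Lemma multiplicity_eq S S' V n : scheme_eq S S' ->
  multiplicity S V n = multiplicity S' V n.
Proof. by move=> [_ E]; rewrite /multiplicity E. Qed.

Lemma combination_zeros (F G : MP) S :
  (forall f, S f -> exists l m, f = l *: F + m *: G) ->
  zeros [set F; G] `<=` zeros S.
Proof.
move=> SFG x /zeros2P[[x1 x2] [xF xG]]; split=> // f /SFG[l [m ->]].
by rewrite bievalD !bievalZ xF xG !mulr0 addr0.
Qed.

Lemma combination_ideals d0 e0 (F G : MP) S V J : bihomog d0 e0 F -> bihomog d0 e0 G ->
  (forall f, S f -> exists l m, f = l *: F + m *: G) ->
  scheme_local_ideals [set F; G] V J -> scheme_local_ideals S V J.
Proof.
move=> Fh Gh SFG [JV JFG]; split=> // d e f g /SFG[l [m fE]] fh gh gV.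
have [f0|f0] := eqVneq f 0; first by rewrite f0 tofrac0 mul0r; case: JV.
have fh' : bihomog d0 e0 f by rewrite fE; apply: bihomogD; exact: bihomogZ.
have [dE eE] := bihomog_uniq f0 fh fh'; move: gh; rewrite dE eE => gh.
have one : ~ vanishes_on V 1.
  move=> V1; apply: gV => x /V1/eqP; rewrite bieval1 oner_eq0 //.
have ZJ (k : K) (h : MP) : J (tofrac h / tofrac g) -> J (tofrac (k *: h) / tofrac g).
  move=> Jh; rewrite -mul_mpolyC tofracM -mulrA; apply: (local_idealM JV) => //.
  rewrite -[tofrac _]divr1 -tofrac1; exists 0%N, 0%N, k%:MP, 1; split=> //.
    exact: bihomogC.
  exact: bihomog1.
rewrite fE tofracD mulrDl; apply: (local_idealD JV); apply: ZJ.
  by apply: JFG Fh gh gV; left.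
by apply: JFG Gh gh gV; right.
Qed.

Lemma combine (F G : MP) (a b l m l' m' : K) :
  a *: (l *: F - m *: G) + b *: (l' *: F - m' *: G) =
  (a * l + b * l') *: F - (a * m + b * m') *: G.
Proof. by rewrite !scalerBr !scalerA !scalerDl opprD addrACA. Qed.

(** Each pair of equations is a combination of the other, the inverse coefficients being given by
    Cramer's rule. *)
Lemma scheme_eq_pencil d e (F G : MP) (l m l' m' : K) :
  bihomog d e F -> bihomog d e G -> l * m' - l' * m != 0 ->
  scheme_eq [set F; G] [set l *: F - m *: G; l' *: F - m' *: G].
Proof.
move=> Fh Gh det; pose D := l * m' - l' * m; set F' := l *: F - m *: G; set G' := l' *: F - m' *: G.
have S' f : [set F'; G'] f -> exists l m, f = l *: F + m *: G.
  by case=> ->; [exists l, (- m)|exists l', (- m')]; rewrite scaleNr.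
have S f : [set F; G] f -> exists l m, f = l *: F' + m *: G'.
  case=> ->.
    exists (m' / D), (- (m / D)); rewrite combine.
    have -> : m' / D * l + - (m / D) * l' = 1 by rewrite /D; field.
    have -> : m' / D * m + - (m / D) * m' = 0 by rewrite /D; field.
    by rewrite scale1r scale0r subr0.
  exists (l' / D), (- (l / D)); rewrite combine.
  have -> : l' / D * l + - (l / D) * l' = 0 by rewrite /D; field.
  have -> : l' / D * m + - (l / D) * m' = -1 by rewrite /D; field.
  by rewrite scaleN1r scale0r sub0r opprK.
have F'h : bihomog d e F' by apply: bihomogB; exact: bihomogZ.
have G'h : bihomog d e G' by apply: bihomogB; exact: bihomogZ.
split; first by apply/seteqP; split; exact: combination_zeros.
apply/funext => V; apply/seteqP; split=> J.
  exact: combination_ideals Fh Gh S'.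
exact: combination_ideals F'h G'h S.
Qed.

Definition P1_curve V a b := param_curve V a b /\ isomorphic (@P1 K) V.

Lemma P1_curve_rational V a b : P1_curve V a b -> rational_curve V.
Proof. by move=> [[V0 _] Viso]; exact: isomorphic_rational. Qed.

Definition double_line_type S := exists V1 V2,
  [/\ components (zeros S) = [set` [:: V1; V2]], uniq [:: V1; V2],
      P1_curve V1 0 1 /\ P1_curve V2 1 0, multiplicity S V1 2 & multiplicity S V2 1].

Definition crossing_lines_type S := exists V1 V2 V3,
  [/\ components (zeros S) = [set` [:: V1; V2; V3]], uniq [:: V1; V2; V3],
      [/\ P1_curve V1 0 1, P1_curve V2 0 1 & P1_curve V3 1 0] &
      [/\ multiplicity S V1 1, multiplicity S V2 1 & multiplicity S V3 1]].

Definition line_and_graph_type S := exists V1 V2,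
  [/\ components (zeros S) = [set` [:: V1; V2]], uniq [:: V1; V2],
      P1_curve V1 0 1 /\ P1_curve V2 1 1, multiplicity S V1 1 & multiplicity S V2 1].

Definition smooth_graph_type S := scheme_isomorphic_P1 S /\ exists V,
  [/\ components (zeros S) = [set` [:: V]], P1_curve V 1 2 & multiplicity S V 1].

Section Transport.
Variables S S' : set (bipoly K).
Hypothesis SS' : scheme_eq S S'.

Lemma double_line_type_eq : double_line_type S' -> double_line_type S.
Proof.
move=> [V1 [V2 [ZE u c m1 m2]]]; exists V1, V2.
by rewrite !(multiplicity_eq _ _ SS') SS'.1.
Qed.

Lemma crossing_lines_type_eq : crossing_lines_type S' -> crossing_lines_type S.
Proof.
move=> [V1 [V2 [V3 [ZE u c m]]]]; exists V1, V2, V3.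
by rewrite !(multiplicity_eq _ _ SS') SS'.1.
Qed.

Lemma line_and_graph_type_eq : line_and_graph_type S' -> line_and_graph_type S.
Proof.
move=> [V1 [V2 [ZE u c m1 m2]]]; exists V1, V2.
by rewrite !(multiplicity_eq _ _ SS') SS'.1.
Qed.

End Transport.

Section Cycles.
Variables (S : set (bipoly K)) (L1 L2 : set (bipoint K)).
Hypotheses (L1f : fiber_line L1) (L2f : fiber_pr2 L2).

Let goal := pure_dim (zeros S) 1 /\
  exists2 c, fundamental_cycle S c & num_equiv c [:: (2, L1); (1, L2)].

Let uniqN V V' : uniq [:: V; V'] -> V <> V'.
Proof. by rewrite cons_uniq mem_seq1 => /andP[/eqP]. Qed.

Lemma double_line_cycle : double_line_type S -> goal.
Proof.
move=> [V1 [V2 [ZE u [[c1 _] [c2 _]] m1 m2]]].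
have [e1 e2] := two_classesE (0, 1)%N (1, 0)%N (uniqN u).
apply: (@pure_dim_cycle S [:: (2, V1); (1, V2)] (two_classes V1 (0, 1)%N (1, 0)%N)) => //.
- by move=> t; rewrite !inE => /orP[] /eqP -> /=; rewrite ?e1 ?e2.
- by move=> t; rewrite !inE => /orP[] /eqP -> /=; [exists 2%N|exists 1%N].
- by rewrite !big_cons big_nil /= e1 e2.
- by rewrite !big_cons big_nil /= e1 e2.
Qed.

Lemma line_and_graph_cycle : line_and_graph_type S -> goal.
Proof.
move=> [V1 [V2 [ZE u [[c1 _] [c2 _]] m1 m2]]].
have [e1 e2] := two_classesE (0, 1)%N (1, 1)%N (uniqN u).
apply: (@pure_dim_cycle S [:: (1, V1); (1, V2)] (two_classes V1 (0, 1)%N (1, 1)%N)) => //.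
- by move=> t; rewrite !inE => /orP[] /eqP -> /=; rewrite ?e1 ?e2.
- by move=> t; rewrite !inE => /orP[] /eqP -> /=; exists 1%N.
- by rewrite !big_cons big_nil /= e1 e2.
- by rewrite !big_cons big_nil /= e1 e2.
Qed.

Lemma crossing_lines_cycle : crossing_lines_type S -> goal.
Proof.
move=> [V1 [V2 [V3 [ZE u [[c1 _] [c2 _] [c3 _]] [m1 m2 m3]]]]].
have [n1 n2] : V3 <> V1 /\ V3 <> V2.
  move: u; rewrite !cons_uniq !in_cons in_nil !orbF negb_or.
  by case/andP => /andP[_ /eqP n13] /andP[/eqP n23 _]; split; apply: nesym.
have [e3 e1] := two_classesE (1, 0)%N (0, 1)%N n1.
have e2 : two_classes V3 (1, 0)%N (0, 1)%N V2 = (0, 1)%N by case: (two_classesE (1, 0)%N (0, 1)%N n2).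
apply: (@pure_dim_cycle S [:: (1, V1); (1, V2); (1, V3)] (two_classes V3 (1, 0)%N (0, 1)%N)) => //.
- by move=> t; rewrite !inE => /or3P[] /eqP -> /=; rewrite ?e1 ?e2 ?e3.
- by move=> t; rewrite !inE => /or3P[] /eqP -> /=; exists 1%N.
- by rewrite !big_cons big_nil /= e1 e2 e3.
- by rewrite !big_cons big_nil /= e1 e2 e3.
Qed.

Lemma smooth_graph_cycle : smooth_graph_type S -> goal.
Proof.
move=> [_ [V [ZE [c _] m]]].
apply: (@pure_dim_cycle S [:: (1, V)] (fun=> (1, 2)%N)) => //.
- by move=> t; rewrite mem_seq1 => /eqP ->.
- by move=> t; rewrite mem_seq1 => /eqP ->; exists 1%N.
- by rewrite big_seq1.
- by rewrite big_seq1.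
Qed.

End Cycles.
End SchemeInvariance.

(** * Pencils of skew forms *)

Section SkewPencils.
Variable K : numClosedFieldType.

Lemma tr_mx11 (x : 'M[K]_1) : x^T = x.
Proof. by rewrite [x]mx11_scalar tr_scalar_mx. Qed.

Lemma skew_swap n (M : 'M[K]_n) (p q : 'rV[K]_n) : M^T = - M ->
  q *m M *m p^T = - (p *m M *m q^T).
Proof.
by move=> Ms; rewrite -[RHS]tr_mx11 linearN /= !trmx_mul trmxK Ms mulNmx mulmxN opprK mulmxA.
Qed.

Lemma eq_oppmx m n (x : 'M[K]_(m, n)) : x = - x -> x = 0.
Proof.
move=> xx; apply/matrixP => i j; rewrite mxE; apply/eqP.
have /matrixP/(_ i j) := xx; rewrite !mxE => /eqP.
by rewrite -subr_eq0 opprK -mulr2n Num.Theory.mulrn_eq0.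
Qed.

Lemma skew_diag n (M : 'M[K]_n) (p : 'rV[K]_n) : M^T = - M -> p *m M *m p^T = 0.
Proof. by move=> Ms; apply: eq_oppmx; exact: skew_swap. Qed.

(** M is congruent, through a row basis [Q], to a skew matrix [S] of size [\rank M]. An odd size
    would make the determinant of [S] zero, and then M would have smaller rank. *)
Lemma skew_rank_even n (M : 'M[K]_n) : M^T = - M -> ~~ odd (\rank M).
Proof.
move=> Ms; apply/negP => rodd.
have [r [X [Q [rE ME Qf]]]] : exists r (X : 'M[K]_(n, r)) (Q : 'M[K]_(r, n)),
    [/\ \rank M = r, M = X *m Q & row_free Q].
  exists (\rank M), (col_base M), (row_base M).
  by split; rewrite ?mulmx_base ?row_base_free.
have [Z QZ] : exists Z, Q *m Z = 1%:M by apply/row_freeP.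
have MZ : M *m Z *m Q = M by rewrite ME -!mulmxA (mulmxA Q) QZ mul1mx.
pose S := Z^T *m M *m Z.
have Ss : S^T = - S by rewrite /S !trmx_mul trmxK Ms mulmxA mulmxN mulNmx.
have MZT : Q^T *m Z^T *m M = M.
  apply: oppr_inj; rewrite -mulmxN -Ms -!mulmxA -!trmx_mul.
  by rewrite MZ.
have S0 : \det S = 0.
  have := det_tr S; rewrite rE in rodd.
  rewrite Ss -scaleN1r detZ -signr_odd rodd expr1 mulN1r => /eqP.
  by rewrite eq_sym -subr_eq0 opprK -mulr2n Num.Theory.mulrn_eq0 => /eqP.
have : S \notin unitmx by rewrite unitmxE S0 unitr0.
rewrite -row_free_unit -row_leq_rank -ltnNge => rS.
suff : (\rank M <= \rank S)%N by rewrite rE leqNgt rS.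
have -> : M = Q^T *m S *m Q.
  by rewrite /S !mulmxA MZT MZ.
by apply: leq_trans (mxrankM_maxl _ _) (mxrankM_maxr _ _).
Qed.

Definition pencil4 (A B : 'M[K]_5) := [/\ A^T = - A, B^T = - B &
  forall l m : K, (l, m) != (0, 0) -> \rank (l *: A - m *: B) = 4%N].

Lemma skew_combination n (A B : 'M[K]_n) l m : A^T = - A -> B^T = - B ->
  (l *: A - m *: B)^T = - (l *: A - m *: B).
Proof. by move=> As Bs; rewrite linearB !linearZ /= As Bs !scalerN opprB opprK addrC. Qed.

Lemma general_pencil4 A B : general_section A B -> pencil4 A B.
Proof.
move=> [As Bs ind rk]; split=> // l m lm.
have ne : l *: A - m *: B != 0.
  apply: contra_neq lm => e.
  have [-> /eqP] := ind l (- m) (etrans (congr1 _ (scaleNr _ _)) e).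
  by rewrite oppr_eq0 => /eqP ->.
have := skew_rank_even (skew_combination l m As Bs).
have := rk l m ne; have := rank_leq_row (l *: A - m *: B).
by case: (\rank _) => [|[|[|[|[|[|]]]]]].
Qed.

Lemma pencil4_rank A B : pencil4 A B -> \rank A = 4%N.
Proof.
move=> [_ _ /(_ 1 0)]; rewrite scale1r scale0r subr0; apply.
by rewrite xpair_eqE oner_eq0.
Qed.

Lemma pencil_combination (A B : 'M[K]_5) (x y l m l' m' : K) :
  x *: (l *: A - m *: B) - y *: (l' *: A - m' *: B) =
  (x * l - y * l') *: A - (x * m - y * m') *: B.
Proof.
rewrite !scalerBr !scalerA !scalerBl !opprB.
by rewrite [X in _ + X = _]addrC addrACA [X in _ + X = _]addrC.
Qed.

Lemma change_neq0 (x y l m l' m' : K) : l * m' - l' * m != 0 -> (x, y) != (0, 0) ->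
  (x * l - y * l', x * m - y * m') != (0, 0).
Proof.
move=> det; apply: contra_neq => -[e1 e2].
have : (l * m' - l' * m) * x = 0.
  have -> : (l * m' - l' * m) * x = m' * (x * l - y * l') - l' * (x * m - y * m') by ring.
  by rewrite e1 e2 !mulr0 subr0.
have : (l * m' - l' * m) * y = 0.
  have -> : (l * m' - l' * m) * y = m * (x * l - y * l') - l * (x * m - y * m') by ring.
  by rewrite e1 e2 !mulr0 subr0.
by move=> /eqP + /eqP; rewrite !mulf_eq0 (negPf det) => /eqP -> /eqP ->.
Qed.

Lemma pencil4_change A B l m l' m' : l * m' - l' * m != 0 -> pencil4 A B ->
  pencil4 (l *: A - m *: B) (l' *: A - m' *: B).
Proof.
move=> det [As Bs rk]; split; try exact: skew_combination.
by move=> x y xy; rewrite pencil_combination; apply/rk/change_neq0.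
Qed.

Lemma ker_line (M : 'M[K]_5) (p q : 'rV[K]_5) : \rank M = 4%N -> p != 0 ->
  p *m M = 0 -> q *m M = 0 -> exists c, q = c *: p.
Proof.
move=> rM p0 /sub_kermxP pM /sub_kermxP qM; apply/sub_rVP.
apply: (submx_trans qM); have [_] := mxrank_leqif_sup pM.
by rewrite rank_rV p0 mxrank_ker rM eqxx => <-.
Qed.

(** By skewness the image of [M] is orthogonal to its kernel; as the kernel is the line of [p], the
    image is all of the orthogonal of [p]. *)
Lemma skew_solve (M : 'M[K]_5) (p v : 'rV[K]_5) : M^T = - M -> \rank M = 4%N ->
  p != 0 -> p *m M = 0 -> v *m p^T = 0 -> exists x, x *m M = v.
Proof.
move=> Ms rM p0 pM /sub_kermxP vp.
have Mp : (M <= kermx p^T)%MS.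
  by apply/sub_kermxP/trmx_inj; rewrite trmx_mul trmxK Ms mulmxN pM oppr0 trmx0.
have [_] := mxrank_leqif_sup Mp.
rewrite mxrank_ker mxrank_tr rank_rV p0 rM eqxx => /esym kM.
by have /submxP[x ->] := submx_trans vp kM; exists x.
Qed.

(** The rank of [E *m M] is at least 4 + 4 - 5 = 3, whereas annihilating the rank 4 matrix [E^T]
    allows rank at most 1. *)
Lemma no_isotropic4 (M : 'M[K]_5) (E : 'M[K]_(4, 5)) : \rank M = 4%N ->
  row_free E -> E *m M *m E^T <> 0.
Proof.
move=> rM Ef /mulmx0_rank_max; rewrite mxrank_tr (eqP Ef).
have := mxrank_mul_min E M; rewrite (eqP Ef) rM.
by move: (\rank _) => r; lia.
Qed.

Lemma quadratic_root (a b c : K) : exists l m : K,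
  (l, m) != (0, 0) /\ a * l ^+ 2 + b * (l * m) + c * m ^+ 2 = 0.
Proof.
have [->|a0] := eqVneq a 0.
  exists 1, 0; split; first by rewrite xpair_eqE oner_eq0.
  by rewrite mul0r !mulr0 expr0n mulr0 !addr0.
pose q : {poly K} := a *: 'X^2 + b *: 'X + c%:P.
have sq : size q != 1%N.
  apply: contraNneq a0 => s1; have := congr1 (fun r : {poly K} => r`_2) (size1_polyC (eq_leq s1)).
  by rewrite !coefE /= mulr1 mulr0 !addr0 => ->.
have [x xq] := closed_rootP q sq; exists x, 1; split.
  by rewrite xpair_eqE oner_eq0 andbF.
have /rootP e := xq; rewrite /q !hornerD !hornerZ hornerXn hornerX hornerC in e.
by rewrite -[RHS]e; ring.
Qed.

End SkewPencils.

(** * Kronecker's chain for a pencil of rank 4 *)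

Section KernelChain.
Variable K : numClosedFieldType.

Lemma form_rows0 m (M : 'M[K]_5) (E : 'M[K]_(m, 5)) :
  (forall i j, row i E *m M *m (row j E)^T = 0) -> E *m M *m E^T = 0.
Proof.
move=> h; apply/matrixP => i j; rewrite [RHS]mxE.
have <- : (row i E *m M *m (row j E)^T) 0 0 = (E *m M *m E^T) i j.
  rewrite -row_mul [LHS]mxE [RHS]mxE; apply: eq_bigr => k _.
  by congr (_ * _); [rewrite [LHS]mxE|rewrite !mxE].
by rewrite h mxE.
Qed.

Lemma row_free_exists n (D : 'M[K]_(n, 5)) k : \rank D = k ->
  exists2 E : 'M[K]_(k, 5), row_free E & (E :=: D)%MS.
Proof.
by move=> <-; exists (row_base D); [exact: row_base_free|exact: eq_row_base].
Qed.

Lemma mul_rows4 (u : 'rV[K]_4) (a b c d : 'rV[K]_5) :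
  u *m (\matrix_i tnth [tuple a; b; c; d] i) =
  u 0 0 *: a + u 0 1 *: b + u 0 (1 + 1) *: c + u 0 (1 + 1 + 1) *: d.
Proof.
have e1 : lift ord0 ord0 = 1 :> 'I_4 by apply: val_inj.
have e2 : lift ord0 (lift ord0 ord0) = 1 + 1 :> 'I_4 by apply: val_inj.
have e3 : lift ord0 (lift ord0 (lift ord0 ord0)) = 1 + 1 + 1 :> 'I_4 by apply: val_inj.
by rewrite mulmx_sum_row !big_ord_recl big_ord0 addr0 !rowK !addrA e1 e2 e3.
Qed.

Section Pencil.
Variables A B : 'M[K]_5.
Hypothesis AB : pencil4 A B.

Let As : A^T = - A. Proof. by case: AB. Qed.
Let Bs : B^T = - B. Proof. by case: AB. Qed.
Let rk l m : (l, m) != (0, 0) -> \rank (l *: A - m *: B) = 4%N.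
Proof. by case: AB => _ _; apply. Qed.
Let Ms l m : (l *: A - m *: B)^T = - (l *: A - m *: B).
Proof. exact: skew_combination. Qed.

Let rA : \rank A = 4%N := pencil4_rank AB.

Variable p : 'rV[K]_5.
Hypotheses (p0 : p != 0) (pA : p *m A = 0).

(* If p were in the kernel of the whole pencil, the forms induced on the      *)
(* quotient by p would have a degenerate member.                              *)
Lemma pencil_ker_neq0 : p *m B != 0.
Proof.
apply/eqP => pB.
have [Q Qf Qc] : exists2 Q : 'M[K]_(4, 5), row_free Q & (Q :=: p^C)%MS.
  by apply: row_free_exists; rewrite mxrank_compl rank_rV p0.
have kill (x : 'rV[K]_5) : x *m p^T = 0 -> x *m Q^T = 0 -> x = 0.
  move=> xp xQ; have : (1%:M <= p + Q)%MS.
    by rewrite (adds_eqmx (eqmx_refl p) Qc) sub1mx addsmx_compl_full.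
  rewrite addsmxE => /submxP[D DE].
  rewrite -[x]mulmx1 -trmx1 DE trmx_mul tr_col_mx mulmxA mul_mx_row xp xQ.
  by rewrite row_mx0 mul0mx.
have degenerate (v : 'rV[K]_4) l m : (l, m) != (0, 0) -> v != 0 ->
    v *m (Q *m (l *: A - m *: B) *m Q^T) <> 0.
  move=> lm v0 vQ; set M := l *: A - m *: B in vQ *.
  have pM : p *m M = 0 by rewrite mulmxBr -!scalemxAr pA pB !scaler0 subr0.
  have vM : v *m Q *m M = 0.
    apply: kill; first by rewrite (skew_swap _ _ (Ms l m)) pM mul0mx oppr0.
    by rewrite -vQ !mulmxA.
  have [c vE] := ker_line (rk lm) p0 pM vM.
  have : (v *m Q <= p :&: p^C)%MS.
    by rewrite sub_capmx {1}vE scalemx_sub //= -Qc submxMl.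
  by rewrite capmx_compl submx0 mulmx_free_eq0 // (negPf v0).
pose A' := Q *m A *m Q^T; pose B' := Q *m B *m Q^T.
have ME l m : Q *m (l *: A - m *: B) *m Q^T = l *: A' - m *: B'.
  by rewrite mulmxBr mulmxBl -!scalemxAr -!scalemxAl.
case: (boolP (row_free A')) => [A'f|].
  (* An eigenvector of [B' *m invmx A'] for [a] is killed by [a *: A' - B']. *)
  have [a /eigenvalueP[v vE v0]] := @eigenvalue_closed K 4 (B' *m invmx A') isT.
  have A'u : A' \in unitmx by rewrite -row_free_unit.
  apply: (degenerate v a 1) v0 _; first by rewrite xpair_eqE oner_eq0 andbF.
  rewrite ME mulmxBr -!scalemxAr scale1r.
  have vB : v *m B' = a *: (v *m A') by rewrite scalemxAl -vE -mulmxA mulmxKV.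
  by rewrite vB subrr.
rewrite -kermx_eq0 => /rowV0Pn[v /sub_kermxP vA' v0].
apply: (degenerate v 1 0) v0 _; first by rewrite xpair_eqE oner_eq0.
by rewrite ME scale1r scale0r subr0.
Qed.

Section Chain2.
Variable c1 : 'rV[K]_5.
Hypothesis c1A : c1 *m A = p *m B.

Lemma chain2_free x y : x *: p + y *: c1 = 0 -> x = 0 /\ y = 0.
Proof.
move=> e; have := congr1 (mulmx^~ A) e.
rewrite /= mulmxDl -!scalemxAl pA c1A scaler0 add0r mul0mx => /eqP.
rewrite scaler_eq0 (negPf pencil_ker_neq0) orbF => /eqP y0; split=> //.
by move: e; rewrite y0 scale0r addr0 => /eqP; rewrite scaler_eq0 (negPf p0) orbF => /eqP.
Qed.

(* Otherwise p, c1 and two more vectors orthogonal to p B span an isotropic   *)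
(* subspace of dimension 4 for some member of the pencil.                     *)
Lemma chain2_ker_neq0 : c1 *m B != 0.
Proof.
apply/eqP => c1B; pose y := p *m B; have y0 : y != 0 := pencil_ker_neq0.
pose C : 'M[K]_(1 + 1, 5) := col_mx p c1.
have Cf : row_free C.
  rewrite -kermx_eq0; apply/eqP/row_matrixP => i; rewrite row0.
  have : row i (kermx C) *m C = 0 by apply/sub_kermxP/row_sub.
  rewrite -[row i _]hsubmxK mul_row_col.
  rewrite [lsubmx _]mx11_scalar [rsubmx _]mx11_scalar !mul_scalar_mx => /chain2_free[-> ->].
  by rewrite !raddf0 row_mx0.
have yC : y *m C^T = 0.
  rewrite tr_col_mx mul_mx_row /y (skew_diag _ Bs) -c1A (skew_diag _ As).
  exact: row_mx0.
have CF : (C <= kermx y^T)%MS.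
  by apply/sub_kermxP/trmx_inj; rewrite trmx_mul trmxK yC trmx0.
have rF : \rank (kermx y^T) = 4%N by rewrite mxrank_ker mxrank_tr rank_rV y0.
have [E Ef ED] : exists2 E : 'M[K]_(2, 5), row_free E & (E :=: kermx y^T :\: C)%MS.
  apply: row_free_exists; have := mxrank_cap_compl (kermx y^T) C.
  have -> : \rank (kermx y^T :&: C)%MS = \rank C.
    by apply: eqmx_rank; apply/eqmxP; exact/capmx_idPr.
  by rewrite rF (eqP Cf) => -[].
have yE : y *m E^T = 0.
  have : (E <= kermx y^T)%MS by rewrite ED diffmxSl.
  by move/sub_kermxP/(congr1 trmx); rewrite trmx_mul trmxK trmx0.
have rCE : row_free (col_mx C E).
  rewrite -row_leq_rank -addsmxE mxrank_disjoint_sum ?(eqP Cf) ?(eqP Ef) //.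
  by apply/eqP; rewrite -submx0 (cap_eqmx (eqmx_refl C) ED) capmxC capmx_diff sub0mx.
pose G (M : 'M[K]_5) := E *m M *m E^T.
have Gs M : M^T = - M -> (G M)^T = - G M.
  by move=> MT; rewrite /G !trmx_mul trmxK MT mulmxA mulmxN mulNmx.
have G0 (g : 'M[K]_2) : g^T = - g -> g 0 1 = 0 -> g = 0.
  move=> gs g01; have e i j : g j i = - g i j by have /matrixP/(_ i j) := gs; rewrite !mxE.
  have gd i : g i i = 0.
    have /eqP := e i i; rewrite -subr_eq0 opprK -mulr2n Num.Theory.mulrn_eq0.
    by move/eqP.
  by apply/matrixP; apply: ord2P; apply: ord2P; rewrite mxE ?gd // e g01 oppr0.
(* A skew 2 x 2 matrix is a single scalar, so some member of the pencil vanishes on [E]. *)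
have [l [m [lm glm]]] : exists l m, (l, m) != (0, 0) /\ l * G A 0 1 - m * G B 0 1 = 0.
  have [e|ne] := eqVneq (G B 0 1, G A 0 1) (0, 0).
    exists 1, 0; split; first by rewrite xpair_eqE oner_eq0.
    by case: e => -> ->; rewrite !mulr0 subrr.
  by exists (G B 0 1), (G A 0 1); split=> //; rewrite mulrC subrr.
pose M := l *: A - m *: B; have MT := Ms l m.
have GM : G M = 0.
  apply: G0; first exact: Gs.
  by rewrite /G mulmxBr mulmxBl -!scalemxAr -!scalemxAl [LHS]mxE mxE [X in _ + X]mxE [X in _ - X]mxE.
(* Both rows of [C *m M] are multiples of [y], so [C] is orthogonal to everything orthogonal to
   [y]. *)
have CM X : y *m X = 0 -> C *m M *m X = 0 :> 'M[K]_(1 + 1, 2).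
  move=> yX; rewrite mul_col_mx !mulmxBr -!scalemxAr pA c1A c1B !scaler0 sub0r subr0.
  by rewrite mul_col_mx mulNmx -!scalemxAl -/y yX !scaler0 oppr0 col_mx0.
suff iso : col_mx C E *m M *m (col_mx C E)^T = 0 by exact: (no_isotropic4 (rk lm) rCE iso).
rewrite tr_col_mx mul_col_mx mul_col_row (CM _ yC) (CM _ yE) -/(G M) GM.
have -> : E *m M *m C^T = 0.
  apply: trmx_inj; rewrite !trmx_mul trmxK MT mulmxA mulmxN mulNmx CM //.
  by rewrite oppr0 trmx0.
exact: block_mx0.
Qed.

End Chain2.

(** Solve successively c1 A = p B, c2 A = c1 B and c3 A = c2 B, each solvable because the right side
    is orthogonal to p. The four vectors p, c1, c2, c3 are mutually orthogonal for A, hence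
    dependent; as the first three are free, c3 is a combination of them, and c1, c2 can be corrected
    so that the chain stops. *)
Lemma kernel_chain : exists c1 c2, [/\ c1 *m A = p *m B, c2 *m A = c1 *m B,
  c2 *m B = 0 & forall x y z, x *: p + y *: c1 + z *: c2 = 0 -> [/\ x = 0, y = 0 & z = 0]].
Proof.
have [c1 c1A] := skew_solve As rA p0 pA (skew_diag p Bs).
have c1Bp : c1 *m B *m p^T = 0.
  by rewrite (skew_swap p c1 Bs) -c1A (skew_diag c1 As) oppr0.
have [c2 c2A] := skew_solve As rA p0 pA c1Bp.
have c2Bp : c2 *m B *m p^T = 0.
  rewrite (skew_swap p c2 Bs) -c1A (skew_swap c2 c1 As) c2A (skew_diag c1 Bs).
  by rewrite !oppr0.
have [c3 c3A] := skew_solve As rA p0 pA c2Bp.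
have free3 x y z : x *: p + y *: c1 + z *: c2 = 0 -> [/\ x = 0, y = 0 & z = 0].
  move=> e; have [z0|z0] := eqVneq z 0.
    by have [|x0 y0] := @chain2_free c1 c1A x y; first by rewrite -e z0 scale0r addr0.
  have c2E : c2 = (- x / z) *: p + (- y / z) *: c1.
    apply: (scalerI z0); rewrite scalerDr !scalerA ![z * _]mulrC !divfK // !scaleNr.
    by apply/eqP; rewrite -opprD -addr_eq0 addrC e.
  (* A relation with [z] nonzero would make [c1'] another solution of c1 A = p B, killed by B,
     against [chain2_ker_neq0]. *)
  pose c1' := c1 - (- y / z) *: p.
  have c1'A : c1' *m A = p *m B by rewrite mulmxBl -scalemxAl pA scaler0 subr0.
  case/eqP: (chain2_ker_neq0 c1'A).
  rewrite mulmxBl -c2A {1}c2E mulmxDl -!scalemxAl pA scaler0 add0r c1A.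
  by rewrite subrr.
pose E := \matrix_i tnth [tuple p; c1; c2; c3] i.
have isoA : E *m A *m E^T = 0.
  have e12 : c2 *m A *m c1^T = 0 by rewrite c2A (skew_diag c1 Bs).
  have e23 : c3 *m A *m c2^T = 0 by rewrite c3A (skew_diag c2 Bs).
  have e13 : c3 *m A *m c1^T = 0.
    by rewrite c3A (skew_swap c1 c2 Bs) -c2A (skew_diag c2 As) oppr0.
  have eN (u v : 'rV[K]_5) : u *m A *m v^T = 0 -> v *m A *m u^T = 0.
    by move=> uv; rewrite (skew_swap u v As) uv oppr0.
  have ep (v : 'rV[K]_5) : p *m A *m v^T = 0 by rewrite pA mul0mx.
  apply: form_rows0 => i j; rewrite !rowK.
  case: i => [[|[|[|[|//]]]] ?]; case: j => [[|[|[|[|//]]]] ?];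
    rewrite !(tnth_nth 0) /=; by [exact: (skew_diag _ As)|exact: ep|exact: (eN _ _ (ep _))
      |exact: e12|exact: e23|exact: e13|exact: eN].
have [x2 [x1 [x0 c3E]]] : exists x2 x1 x0, c3 = x0 *: p + x1 *: c1 + x2 *: c2.
  case: (boolP (row_free E)) => [Ef|]; first by case: (no_isotropic4 rA Ef isoA).
  rewrite -kermx_eq0 => /rowV0Pn[v /sub_kermxP + v0]; rewrite mul_rows4 => e.
  have [v3|v3] := eqVneq (v 0 (1 + 1 + 1)) 0.
    move: e; rewrite v3 scale0r addr0 => /free3[e0 e1 e2].
    case/eqP: v0; apply/rowP => i; rewrite mxE.
    by case: i => [[|[|[|[|//]]]] lt]; [rewrite -[RHS]e0|rewrite -[RHS]e1|rewrite -[RHS]e2|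
      rewrite -[RHS]v3]; congr (v 0 _); apply: val_inj.
  set t := v 0 (1 + 1 + 1) in e v3.
  exists (- v 0 (1 + 1) / t), (- v 0 1 / t), (- v 0 0 / t).
  apply: (scalerI v3); rewrite !scalerDr !scalerA ![t * _]mulrC !divfK // !scaleNr.
  by apply/eqP; rewrite -!opprD -addr_eq0 addrC e.
(* The coefficients come from c2 B = c3 A = x1 (p B) + x2 (c1 B), where [x0] disappears since p A =
   0; subtracting them makes the new c2 killed by B. *)
exists (c1 - x2 *: p), (c2 - x2 *: c1 - x1 *: p); split.
- by rewrite mulmxBl -scalemxAl pA scaler0 subr0.
- by rewrite !mulmxBl -!scalemxAl pA scaler0 subr0 c1A c2A.
- have e : c3 *m A = x1 *: (p *m B) + x2 *: (c1 *m B).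
    by rewrite c3E !mulmxDl -!scalemxAl pA c1A c2A scaler0 add0r.
  by rewrite !mulmxBl -!scalemxAl -c3A e addrK subrr.
- move=> x y z e.
  have /free3[e1 e2 z0] : (x - y * x2 - z * x1) *: p + (y - z * x2) *: c1 + z *: c2 = 0.
    by rewrite -e; apply/rowP => i; rewrite !mxE; ring.
  move: e2; rewrite z0 mul0r subr0 => y0.
  by move: e1; rewrite z0 y0 !mul0r !subr0.
Qed.

End Pencil.
End KernelChain.

(** * The center conic *)

Section ConicGeometry.
Variable K : numClosedFieldType.

Lemma center_conic_change (A B : 'M[K]_5) (a b a' b' : K) : a * b' - a' * b != 0 ->
  center_conic (a *: A - b *: B) (a' *: A - b' *: B) = center_conic A B.
Proof.
move=> det; apply/seteqP; split=> p [p0 [l [m [lm pM]]]]; split=> //.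
  exists (l * a - m * a'), (l * b - m * b'); split; last by rewrite -pencil_combination.
  exact: change_neq0.
pose D := a * b' - a' * b.
exists ((l * b' - m * a') / D), ((l * b - m * a) / D).
have e1 : (l * b' - m * a') / D * a - (l * b - m * a) / D * a' = l by rewrite /D; field.
have e2 : (l * b' - m * a') / D * b - (l * b - m * a) / D * b' = m by rewrite /D; field.
rewrite pencil_combination e1 e2; split=> //.
apply: contra_neq lm => -[x0 y0].
by congr (_, _); [rewrite -[LHS]e1|rewrite -[LHS]e2]; rewrite x0 y0 !mul0r subr0.
Qed.

Lemma mul_rows3 (u : 'rV[K]_3) (a b c : 'rV[K]_5) :
  u *m (\matrix_i tnth [tuple a; b; c] i) =
  u 0 0 *: a + u 0 1 *: b + u 0 (1 + 1) *: c.
Proof.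
have e1 : lift ord0 ord0 = 1 :> 'I_3 by apply: val_inj.
have e2 : lift ord0 (lift ord0 ord0) = 1 + 1 :> 'I_3 by apply: val_inj.
by rewrite mulmx_sum_row !big_ord_recl big_ord0 addr0 !rowK !addrA e1 e2.
Qed.

Definition row3 (x y z : K) : 'rV[K]_3 := \row_i tnth [tuple x; y; z] i.

Lemma row3E x y z : [/\ row3 x y z 0 0 = x, row3 x y z 0 1 = y &
  row3 x y z 0 (1 + 1) = z].
Proof. by split; rewrite mxE (tnth_nth 0). Qed.

Lemma mul_row3 x y z (a b c : 'rV[K]_5) :
  row3 x y z *m (\matrix_i tnth [tuple a; b; c] i) = x *: a + y *: b + z *: c.
Proof. by rewrite mul_rows3; have [-> -> ->] := row3E x y z. Qed.

Definition linear_form (h : 'cV[K]_5) : {mpoly K[5]} := \sum_i h i 0 *: 'X_i.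

Lemma linear_form_homog h : linear_form h \is 1.-homog.
Proof. by apply: rpred_sum => i _; apply: dhomogZ; exact: dhomog_X. Qed.

Lemma eval_linear_form h (v : 'rV[K]_5) : (linear_form h).@[v 0] = (v *m h) 0 0.
Proof.
by rewrite rmorph_sum mxE; apply: eq_bigr => i _ /=; rewrite mevalZ mevalXU mulrC.
Qed.

Definition dirder (v p : 'rV[K]_5) (f : {mpoly K[5]}) :=
  \sum_(i < 5) v 0 i * (mderiv i f).@[p 0].

Lemma dirder_linear_form v p h : dirder v p (linear_form h) = (v *m h) 0 0.
Proof.
rewrite mxE; apply: eq_bigr => i _; congr (_ * _).
have -> : mderiv i (linear_form h) = (h i 0)%:MP; last by rewrite mevalC.
rewrite /linear_form raddf_sum (bigD1 i) //= big1 => [|j ji].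
  rewrite mderivZ mderivX mnm1E eqxx scale1r (_ : _ - _ = 0)%MM.
    by rewrite mpolyX0 addr0 alg_mpolyC.
  by apply/mnmP => k; rewrite mnmBE subnn mnm0E.
by rewrite mderivZ mderivX mnm1E (negPf ji) scale0r scaler0.
Qed.

Lemma dirderM v p f g :
  dirder v p (f * g) = f.@[p 0] * dirder v p g + g.@[p 0] * dirder v p f.
Proof.
rewrite !mulr_sumr -big_split; apply: eq_bigr => i _ /=.
by rewrite mderivM mevalD !mevalM; ring.
Qed.

Lemma dirderB v p f g : dirder v p (f - g) = dirder v p f - dirder v p g.
Proof.
by rewrite -sumrB; apply: eq_bigr => i _; rewrite mderivB mevalB mulrBr.
Qed.

(* The line W is contained in the tangent space of the conic at q. *)
Definition tangent_at (A B : 'M[K]_5) (W : 'M[K]_(2, 5)) (q : 'rV[K]_5) :=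
  forall v : 'rV[K]_5, (v <= W)%MS ->
  forall (d : nat) (f : {mpoly K[5]}), f \is d.-homog ->
    (forall c, center_conic A B c -> f.@[c 0] = 0) ->
    \sum_(i < 5) v 0 i * (mderiv i f).@[q 0] = 0.

Section Chain.
Variables (A B : 'M[K]_5) (p c1 c2 : 'rV[K]_5).
Hypotheses (AB : pencil4 A B) (p0 : p != 0) (pA : p *m A = 0).
Hypotheses (c1A : c1 *m A = p *m B) (c2A : c2 *m A = c1 *m B) (c2B : c2 *m B = 0).
Hypothesis free3 : forall x y z, x *: p + y *: c1 + z *: c2 = 0 ->
  [/\ x = 0, y = 0 & z = 0].

(** Spans the kernel of [l *: A - m *: B]: by the relations of the chain the product telescopes. *)
Definition conic_point (l m : K) := l ^+ 2 *: p + (l * m) *: c1 + m ^+ 2 *: c2.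

Lemma conic_pointP l m : (l, m) != (0, 0) -> center_conic A B (conic_point l m).
Proof.
move=> lm; split.
  apply: contra_neq lm => /free3[/eqP l0 _ /eqP m0].
  by move: l0 m0; rewrite !sqrf_eq0 => /eqP -> /eqP ->.
exists l, m; split=> //.
rewrite /conic_point mulmxBr -!scalemxAr !mulmxDl -!scalemxAl pA c1A c2A c2B.
by apply/rowP => i; rewrite !mxE; ring.
Qed.

Lemma center_conicE q : center_conic A B q ->
  exists l m x, (l, m) != (0, 0) /\ q = x *: conic_point l m.
Proof.
move=> [q0 [l [m [lm qM]]]]; have [_ _ rk] := AB.
have [cp0 [l' [m' [lm' cM]]]] := conic_pointP lm.
have cpM : conic_point l m *m (l *: A - m *: B) = 0.
  rewrite /conic_point mulmxBr -!scalemxAr !mulmxDl -!scalemxAl pA c1A c2A c2B.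
  by apply/rowP => i; rewrite !mxE; ring.
by have [x ->] := ker_line (rk l m lm) cp0 cpM qM; exists l, m, x.
Qed.

Lemma conic_plane_rows (U : 'M[K]_5) : (forall q, center_conic A B q -> (q <= U)%MS) ->
  [/\ (p <= U)%MS, (c1 <= U)%MS & (c2 <= U)%MS].
Proof.
move=> CU.
have pU : (p <= U)%MS.
  have -> : p = conic_point 1 0.
    by rewrite /conic_point expr1n scale1r mulr0 expr0n !scale0r !addr0.
  by apply/CU/conic_pointP; rewrite xpair_eqE oner_eq0.
have c2U : (c2 <= U)%MS.
  have -> : c2 = conic_point 0 1.
    by rewrite /conic_point expr1n scale1r mul0r expr0n !scale0r !add0r.
  by apply/CU/conic_pointP; rewrite xpair_eqE oner_eq0 andbF.
split=> //; have -> : c1 = conic_point 1 1 - p - c2.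
  by rewrite /conic_point !expr1n mul1r !scale1r addrAC addrK addrAC subrr add0r.
have oppU (v : 'rV[K]_5) : (v <= U)%MS -> (- v <= U)%MS.
  by rewrite -scaleN1r; exact: scalemx_sub.
apply: addmx_sub (oppU _ c2U); apply: addmx_sub (oppU _ pU).
by apply/CU/conic_pointP; rewrite xpair_eqE oner_eq0.
Qed.

Lemma in_conic_planeP k (M : 'M[K]_(k, 5)) :
  in_conic_plane A B M <-> (M <= \matrix_i tnth [tuple p; c1; c2] i)%MS.
Proof.
set T := \matrix_i _; have Tsub (x y z : K) : ((x *: p + y *: c1 + z *: c2)%R <= T)%MS.
  by rewrite -mul_row3 submxMl.
split=> [MP|MT U CU].
  rewrite -(genmxE T); apply: MP => q /center_conicE[l [m [x [_ ->]]]].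
  by rewrite genmxE scalemx_sub // Tsub.
have [pU c1U c2U] := conic_plane_rows CU.
apply: (submx_trans MT); apply/row_subP => -[[|[|[|//]]] ?];
  by rewrite rowK (tnth_nth 0).
Qed.

(** In the coordinates p, c1, c2 the line is the kernel of one linear form [n], which restricts to
    the conic as a binary quadratic form and therefore has a zero. *)
Lemma conic_plane_meet (W : 'M[K]_(2, 5)) : \rank W = 2%N -> in_conic_plane A B W ->
  exists2 q, center_conic A B q & (q <= W)%MS.
Proof.
move=> rW /in_conic_planeP; set T := \matrix_i _ => /submxP[Y WE].
have rY : \rank Y = 2%N.
  by apply/eqP; rewrite eqn_leq rank_leq_row -{1}rW WE mxrankM_maxl.
have [n nY n0] : exists2 n : 'rV[K]_3, n *m Y^T = 0 & n != 0.
  have : kermx Y^T != 0 by rewrite -mxrank_eq0 mxrank_ker mxrank_tr rY.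
  by case/rowV0Pn => n /sub_kermxP nY n0; exists n.
have [l [m [lm q0]]] := quadratic_root (n 0 0) (n 0 1) (n 0 (1 + 1)).
exists (conic_point l m); first exact: conic_pointP.
rewrite /conic_point -mul_row3; set t := row3 _ _ _.
have [t0 t1 t2] : [/\ t 0 0 = l ^+ 2, t 0 1 = l * m & t 0 (1 + 1) = m ^+ 2].
  exact: row3E.
rewrite WE submxMr //.
have Yn : (Y <= kermx n^T)%MS.
  by apply/sub_kermxP/trmx_inj; rewrite trmx_mul trmxK nY trmx0.
have [_] := mxrank_leqif_sup Yn.
rewrite mxrank_ker mxrank_tr rank_rV n0 rY eqxx => /esym; apply: submx_trans.
apply/sub_kermxP; rewrite [LHS]mx11_scalar.
have -> : (t *m n^T) 0 0 = 0; last by rewrite raddf0.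
by rewrite mxE big_ord3 t0 t1 t2 !mxE -[RHS]q0; ring.
Qed.

Lemma tangent_line_combination (W : 'M[K]_(2, 5)) w : (w <= W)%MS ->
  tangent_at A B W p ->
  exists x y, w = x *: p + y *: c1.
Proof.
move=> wW tan; pose T := \matrix_i tnth [tuple p; c1; c2] i.
have Tf : row_free T.
  rewrite -kermx_eq0; apply/eqP/row_matrixP => i; rewrite row0.
  have : row i (kermx T) *m T = 0 by apply/sub_kermxP/row_sub.
  rewrite mul_rows3 => /free3[e0 e1 e2]; apply/rowP; elim/ord3P;
    by rewrite [RHS]mxE.
have [D TD] : exists D, T *m D = 1%:M by apply/row_freeP.
have tD k (u : 'rV[K]_3) : (u *m T *m col k D) 0 0 = u 0 k.
  by rewrite -[in RHS](mulmx1 u) -TD mulmxA -mulmxA colE !mulmxA -colE mxE.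
pose Y k := linear_form (col k D).
have coneT q : center_conic A B q -> exists l m x, q = (x *: row3 (l ^+ 2) (l * m) (m ^+ 2)) *m T.
  move=> /center_conicE[l [m [x [_ ->]]]]; exists l, m, x.
  by rewrite -scalemxAl mul_row3.
have pT : p = row3 1 0 0 *m T by rewrite mul_row3 scale1r !scale0r !addr0.
(* The conic has coordinates (l^2, l m, m^2), so this quadric vanishes on it; its differential at p
   is the coordinate along c2. *)
have w2 : (w *m col (1 + 1) D) 0 0 = 0.
  have Qh : Y 0 * Y (1 + 1) - Y 1 * Y 1 \is 2.-homog.
    by apply: rpredB; apply: (dhomogM (d := 1) (e := 1)); exact: linear_form_homog.
  have := tan w wW 2 _ Qh; rewrite -/(dirder w p _) dirderB !dirderM.
  rewrite !dirder_linear_form !eval_linear_form {1 2 3 4}pT !tD.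
  have [-> -> ->] := row3E 1 0 0; rewrite !mul0r mul1r !addr0 subr0; apply.
  move=> q /coneT[l [m [x ->]]].
  set r := row3 _ _ _; have rE k : (x *: r) 0 k = x * r 0 k by rewrite mxE.
  rewrite mevalB !mevalM !eval_linear_form !tD !rE.
  by have [-> -> ->] := row3E (l ^+ 2) (l * m) (m ^+ 2); ring.
(* The linear forms [h] vanish on the plane of the conic, so tangency also forces [w] into that
   plane. *)
have wT : w = w *m D *m T.
  apply/rowP => j; apply/eqP; rewrite -subr_eq0; apply/eqP.
  pose h := col j (1%:M - D *m T).
  have hE v : (v *m h) 0 0 = v 0 j - (v *m D *m T) 0 j.
    rewrite /h colE mulmxA -colE mxE mulmxBr mulmx1 mulmxA.
    by rewrite [LHS]mxE [X in _ + X]mxE.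
  have := tan w wW 1%N _ (linear_form_homog h).
  rewrite -/(dirder w p _) dirder_linear_form hE; apply => q /coneT[l [m [x ->]]].
  by rewrite eval_linear_form hE -(mulmxA _ T D) TD mulmx1 subrr.
exists ((w *m D) 0 0), ((w *m D) 0 1); rewrite {1}wT mul_rows3.
have -> : (w *m D) 0 (1 + 1) = 0 by rewrite -w2 colE mulmxA -colE [RHS]mxE.
by rewrite scale0r addr0.
Qed.

Lemma line_tangent (W : 'M[K]_(2, 5)) : (p <= W)%MS ->
  (forall v : 'rV[K]_5, (v <= W)%MS -> exists x y, v = x *: p + y *: c1) ->
  tangent_to_conic A B W.
Proof.
move=> pW Wc; exists p; split=> //.
  have -> : p = conic_point 1 0.
    by rewrite /conic_point expr1n scale1r mulr0 expr0n !scale0r !addr0.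
  by apply: conic_pointP; rewrite xpair_eqE oner_eq0.
(* The curve [conic_point L M] passes through p at 0 with velocity 2 t p + y c1, whence the choice
   of [t]; differentiating [f] along it gives the claim. *)
move=> v /Wc[x [y ->]] d f fh fC; pose t := x / 2%:R.
pose L : {poly K} := 1 + t *: 'X; pose M : {poly K} := y *: 'X.
pose g (i : 'I_5) := L ^+ 2 * (p 0 i)%:P + L * M * (c1 0 i)%:P + M ^+ 2 * (c2 0 i)%:P.
have g0 : mmap (@polyC K) g f = 0.
  have L0 : L != 0.
    apply/eqP => /(congr1 (fun q : {poly K} => q.[0])).
    by rewrite /L !hornerE => /eqP; rewrite oner_eq0.
  (* The factor [L] discards the parameters at which [L] and [M] could vanish together. *)
  apply: (mulfI L0); rewrite mulr0; apply: poly_eq0_root => z.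
  rewrite hornerM horner_mmap; have [->|Lz] := eqVneq L.[z] 0; first by rewrite mul0r.
  have -> : f.@[fun i => (g i).[z]] = f.@[conic_point L.[z] M.[z] 0].
    apply: meval_eq => i; rewrite /g !(hornerD, hornerM, hornerXn, horner_exp, hornerC) !mxE.
    by [].
  by rewrite fC ?mulr0 //; apply: conic_pointP; rewrite xpair_eqE negb_and Lz.
have := deriv_mmap g f; rewrite g0 deriv0 => /(congr1 (fun q : {poly K} => q.[0])) /=.
rewrite horner0 horner_sum => e; rewrite [RHS]e; apply: eq_bigr => i _.
have L00 : L.[0] = 1 by rewrite /L hornerD hornerZ hornerX hornerC mulr0 addr0.
have M00 : M.[0] = 0 by rewrite /M hornerZ hornerX mulr0.
have L' : L^`().[0] = t by rewrite /L derivD derivZ derivX derivC add0r hornerZ hornerC mulr1.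
have M' : M^`().[0] = y by rewrite /M derivZ derivX hornerZ hornerC mulr1.
clearbody L M; rewrite hornerM mulrC horner_mmap; congr (_ * _).
  apply: meval_eq => j; rewrite /g !(hornerD, hornerM, horner_exp, hornerC) L00 M00.
  by ring.
rewrite /g !expr2 !derivD !derivM !derivC !mulr0 !addr0.
rewrite !(hornerD, hornerM, hornerC) L00 M00 L' M' !mxE /t.
by field.
Qed.

End Chain.
End ConicGeometry.

(** * Classification *)

Section Classification.
Variable K : numClosedFieldType.

Definition dual_frame (u0 u1 : 'rV[K]_2) (xi eta : 'cV[K]_2) :=
  [/\ u0 *m xi = 1%:M, u0 *m eta = 0, u1 *m xi = 0 & u1 *m eta = 1%:M] /\
  xi *m u0 + eta *m u1 = 1%:M.

Lemma dual_frame_exists (u0 : 'rV[K]_2) : u0 != 0 ->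
  exists u1 xi eta, dual_frame u0 u1 xi eta.
Proof.
move=> u00; have [||Q [Qf Q1 _]] := @complete_row K 2 u0 1%:M u00.
- by rewrite mxrank1.
- exact: submx1.
have [D QD] : exists D, Q *m D = 1%:M by apply/row_freeP.
have DQ : D *m Q = 1%:M by apply: mulmx1C.
have e i j : row i Q *m col j D = (i == j)%:R%:M.
  rewrite [LHS]mx11_scalar; congr (_%:M).
  have <- : (Q *m D) i j = (i == j)%:R by rewrite QD mxE.
  by rewrite !mxE; apply: eq_bigr => k _; rewrite !mxE.
exists (row 0 Q), (col 1 D), (col 0 D); rewrite -Q1; split.
  by split; rewrite e //= raddf0.
rewrite -DQ; apply/matrixP => i j; rewrite !mxE !big_ord1 !big_ord_recl big_ord0 addr0 !mxE.
by rewrite addrC (_ : lift _ _ = 1) //; apply: val_inj.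
Qed.

Lemma dual_frameE u0 u1 xi eta : dual_frame u0 u1 xi eta -> forall s : 'rV[K]_2,
  s = (s *m xi) 0 0 *: u0 + (s *m eta) 0 0 *: u1.
Proof.
move=> [_ e] s; rewrite -[LHS]mulmx1 -e mulmxDr !mulmxA.
by rewrite [s *m xi]mx11_scalar [s *m eta]mx11_scalar !mul_scalar_mx !mxE eqxx !mulr1n.
Qed.

Lemma dual_frame_mul u0 u1 xi eta k (M : 'M[K]_(2, k)) : dual_frame u0 u1 xi eta ->
  M = xi *m (u0 *m M) + eta *m (u1 *m M).
Proof. by move=> [_ e]; rewrite !mulmxA -mulmxDl e mul1mx. Qed.

(** This and [dual_frame_shift] change the frame while keeping [u0], that is, the point of the
    conic. *)
Lemma dual_frame_scale u0 u1 xi eta c : c != 0 -> dual_frame u0 u1 xi eta ->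
  dual_frame u0 (c^-1 *: u1) xi (c *: eta).
Proof.
move=> c0 [[e1 e2 e3 e4] e]; split.
  split=> //; rewrite -?scalemxAr -?scalemxAl ?e2 ?e3 ?scaler0 //.
  by rewrite e4 scalerA mulfV // scale1r.
by rewrite -scalemxAr -scalemxAl scalerA mulVf // scale1r.
Qed.

Lemma dual_frame_shift u0 u1 xi eta c : dual_frame u0 u1 xi eta ->
  dual_frame u0 (u1 - c *: u0) (xi + c *: eta) eta.
Proof.
move=> [[e1 e2 e3 e4] e]; split.
  split=> //.
  - by rewrite mulmxDr -scalemxAr e1 e2 scaler0 addr0.
  - rewrite mulmxDr !mulmxBl -!scalemxAr -!scalemxAl e1 e2 e3 e4.
    by rewrite !scaler0 subr0 sub0r addNr.
  - by rewrite mulmxBl -scalemxAl e2 e4 scaler0 subr0.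
by rewrite mulmxDl mulmxBr -scalemxAr -scalemxAl addrACA subrr addr0 e.
Qed.

Lemma line_form_pairing (A : 'M[K]_5) W N :
  line_form A W N = pairing (lin (W *m A *m N^T)).
Proof. by rewrite pairing_lin. Qed.

Lemma line_form_dual u0 u1 xi eta (A : 'M[K]_5) W N : dual_frame u0 u1 xi eta ->
  line_form A W N = sform xi * tform (u0 *m W *m A *m N^T)^T +
    sform eta * tform (u1 *m W *m A *m N^T)^T.
Proof.
move=> fr; rewrite line_form_pairing -pairing_lin_outer !trmxK.
by rewrite {1}(dual_frame_mul (W *m A *m N^T) fr) !mulmxA.
Qed.

Lemma tform0 : tform (0 : 'cV[K]_3) = 0.
Proof. by apply: big1 => j _; rewrite mxE scale0r. Qed.

Lemma line_form_combination (A B : 'M[K]_5) W N l m :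
  line_form (l *: A - m *: B) W N = l *: line_form A W N - m *: line_form B W N.
Proof.
rewrite /line_form !scaler_sumr -sumrB; apply: eq_bigr => i _.
rewrite !scaler_sumr -sumrB; apply: eq_bigr => j _.
rewrite !scalerA -scalerBl; congr (_ *: _).
by rewrite mulmxBr mulmxBl -!scalemxAr -!scalemxAl !mxE.
Qed.

Lemma bihomog_line_form (A : 'M[K]_5) W N : bihomog 1 1 (line_form A W N).
Proof. by rewrite line_form_pairing; apply: bihomog_pairing => j; exact: lin_homog. Qed.

Lemma lines_scheme_change (A B : 'M[K]_5) W N l m l' m' : l * m' - l' * m != 0 ->
  scheme_eq (lines_scheme A B W N)
    (lines_scheme (l *: A - m *: B) (l' *: A - m' *: B) W N).
Proof.
move=> det; rewrite /lines_scheme !line_form_combination.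
by apply: scheme_eq_pencil det; exact: bihomog_line_form.
Qed.

Lemma line_P1_curve (a : 'rV[K]_2) (b : 'cV[K]_3) : a != 0 -> b != 0 ->
  P1_curve (line a b) 0 1.
Proof. by move=> a0 b0; split; [exact: line_param_curve|exact: line_isomorphic]. Qed.

Lemma cross_P1_curve m n (p q : 'I_3 -> {mpoly K[2]}) :
  (forall j, p j \is m.-homog) -> (forall j, q j \is n.-homog) ->
  (forall u, u != 0 -> eval_row (cross p q) u != 0) ->
  P1_curve (graph (cross p q)) 1 (m + n).
Proof.
move=> ph qh pq0; have h := cross_homog ph qh.
by split; [exact: graph_param_curve|exact: graph_isomorphic h pq0].
Qed.

Lemma on_X_form (A : 'M[K]_5) (W : 'M[K]_(2, 5)) : in_hyperplane A W ->
  W *m A *m W^T = 0.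
Proof. by move=> h; apply: form_rows0 => i j; apply: h; exact: row_sub. Qed.

Section Point.
Variables (A B : 'M[K]_5) (W : 'M[K]_(2, 5)) (N : 'M[K]_(3, 5)).
Hypotheses (WX : on_X A B W) (WN : col_mx W N \in unitmx).

Let rW : \rank W = 2%N. Proof. by case: WX. Qed.
Let WA : W *m A *m W^T = 0. Proof. by case: WX => _ h _; exact: on_X_form. Qed.
Let WB : W *m B *m W^T = 0. Proof. by case: WX => _ _ h; exact: on_X_form. Qed.

Let Wf : row_free W. Proof. by rewrite /row_free rW. Qed.

Lemma killed (x : 'rV[K]_5) : x *m W^T = 0 -> x *m N^T = 0 -> x = 0.
Proof.
move=> xW xN; apply: (@row_free_inj _ _ _ _ (col_mx W N)^T).
  by rewrite row_free_unit unitmx_tr.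
by rewrite tr_col_mx mul_mx_row xW xN row_mx0 mul0mx.
Qed.

Let formW (u : 'rV[K]_2) (M : 'M[K]_5) : W *m M *m W^T = 0 -> u *m W *m M *m W^T = 0.
Proof. by move=> WM; rewrite -!mulmxA (mulmxA W) WM mulmx0. Qed.

(** Since W represents a point of X these vectors already annihilate W, so a relation between them
    on K^5/W holds on K^5. *)
Lemma killed_combination (a b : 'rV[K]_2) (c d e : K) :
  let S := c *: (a *m W *m A) + d *: (a *m W *m B) + e *: (b *m W *m B) in
  S *m N^T = 0 -> S = 0.
Proof.
move=> S SN; apply: killed => //.
by rewrite /S !mulmxDl -!scalemxAl !formW // !scaler0 !addr0.
Qed.

(** A relation between u A and u B on K^5/W lifts to K^5 and makes u W a point of the conic. *)
Lemma smooth_type : pencil4 A B ->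
  (forall q, center_conic A B q -> ~ (q <= W)%MS) ->
  smooth_graph_type (lines_scheme A B W N).
Proof.
move=> AB nC.
have ind (u : 'rV[K]_2) : u != 0 ->
    independent (u *m (W *m A *m N^T)) (u *m (W *m B *m N^T)).
  move=> u0 c d e; have [[-> ->]|cd] := eqVneq (c, d) (0, 0); first by [].
  case: (nC (u *m W) _ (submxMl _ _)); split; first by rewrite mulmx_free_eq0.
  exists c, d; split=> //.
  have := @killed_combination u 0 c (- d) 0.
  rewrite scale0r addr0 scaleNr mulmxBr -!scalemxAr; apply.
  by rewrite mulmxBl -!scalemxAl -!mulmxA !mulmxA in e *; rewrite e subrr.
have E : lines_scheme A B W N =
    [set pairing (lin (W *m A *m N^T)); pairing (lin (W *m B *m N^T))].
  by rewrite /lines_scheme !line_form_pairing.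
rewrite /smooth_graph_type E; split; first exact: smooth_graph_reduced.
have [ZE m] := smooth_graph ind.
eexists; split; [exact: ZE|apply: (@cross_P1_curve 1 1)|exact: m].
- by move=> j; exact: lin_homog.
- by move=> j; exact: lin_homog.
- by move=> u u0; apply: cross_neq0; rewrite !eval_lin; exact: ind.
Qed.

Section BasePoint.
Variables (c1 c2 : 'rV[K]_5) (u0 : 'rV[K]_2).
Hypotheses (AB : pencil4 A B) (u00 : u0 != 0).
Let p := u0 *m W.
Hypotheses (pA : p *m A = 0) (c1A : c1 *m A = p *m B)
  (c2A : c2 *m A = c1 *m B) (c2B : c2 *m B = 0).
Hypothesis free3 : forall x y z, x *: p + y *: c1 + z *: c2 = 0 ->
  [/\ x = 0, y = 0 & z = 0].

Let p0 : p != 0. Proof. by rewrite mulmx_free_eq0. Qed.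
Let pB0 : p *m B != 0 := pencil_ker_neq0 AB p0 pA.
Let pW : (p <= W)%MS. Proof. exact: submxMl. Qed.

Let rA : \rank A = 4%N := pencil4_rank AB.

Let W_rows (u1 : 'rV[K]_2) xi eta v : dual_frame u0 u1 xi eta -> (v <= W)%MS ->
  exists x y, v = x *: p + y *: (u1 *m W).
Proof.
move=> fr /submxP[s ->]; rewrite {1}(dual_frameE fr s) mulmxDl -!scalemxAl.
by exists ((s *m xi) 0 0), ((s *m eta) 0 0).
Qed.

Lemma tangent_case (u1 : 'rV[K]_2) xi eta c : dual_frame u0 u1 xi eta ->
  u1 *m W *m A = c *: (p *m B) ->
  [/\ double_line_type (lines_scheme A B W N), tangent_to_conic A B W &
      in_conic_plane A B W].
Proof.
move=> fr0 wA0; have [[e1 e2 e3 e4] _] := fr0.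
(* Otherwise w would lie in the kernel of A, which is spanned by p. *)
have c0 : c != 0.
  apply/eqP => c0; move: wA0; rewrite c0 scale0r => wA.
  have [k wE] := ker_line rA p0 pA wA.
  have u1E : u1 = k *: u0.
    by apply: (row_free_inj Wf); rewrite wE scalemxAl.
  move: e4; rewrite u1E -scalemxAl e2 scaler0 => /matrixP/(_ 0 0)/eqP.
  by rewrite !mxE eq_sym oner_eq0.
have fr := dual_frame_scale c0 fr0.
move: fr; set v1 := c^-1 *: u1; set eta' := c *: eta => fr.
have wA : v1 *m W *m A = p *m B.
  by rewrite -!scalemxAl wA0 scalerA mulVf // scale1r.
clearbody v1 eta'.
have frE := dual_frameE fr; have [frame _] := fr.
pose b0 : 'cV[K]_3 := (p *m B *m N^T)^T; pose b1 : 'cV[K]_3 := (v1 *m W *m B *m N^T)^T.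
(* A relation involving [b1] would produce [d1] with d1 A = p B and d1 B = 0, excluded by
   [chain2_ker_neq0]. *)
have bb : independent b0 b1.
  move=> x y /(congr1 trmx); rewrite !linearZ /= !trmxK => e.
  have e' : x *: (p *m B) = y *: (v1 *m W *m B).
    have := @killed_combination u0 v1 0 x (- y); rewrite /= scale0r add0r -/p !scaleNr.
    rewrite mulmxBl -!scalemxAl. rewrite e subrr => /(_ erefl)/eqP.
    by rewrite subr_eq0 => /eqP.
  have [y0|y0] := eqVneq y 0.
    move/eqP: e'; rewrite y0 scale0r scaler_eq0 (negPf pB0) orbF => /eqP ->.
    by [].
  pose d1 := v1 *m W - (x / y) *: p.
  have d1A : d1 *m A = p *m B by rewrite mulmxBl -scalemxAl pA scaler0 subr0.
  case/eqP: (chain2_ker_neq0 AB p0 pA d1A).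
  apply: (scalerI y0); rewrite scaler0 mulmxBl -scalemxAl scalerBr scalerA.
  by rewrite mulrCA mulfV // mulr1 e' subrr.
(* Both w and c1 are mapped to p B by A, so they differ by a multiple of p and W is spanned by p and
   c1. *)
have [k wE] : exists k, v1 *m W = k *: p + c1.
  have : (v1 *m W - c1) *m A = 0 by rewrite mulmxBl wA c1A subrr.
  by case/(ker_line rA p0 pA) => k kE; exists k; rewrite -kE subrK.
have Wc (v : 'rV[K]_5) : (v <= W)%MS -> exists x y, v = x *: p + y *: c1.
  case/(W_rows fr) => x [y ->]; exists (x + y * k), y.
  by rewrite wE scalerDr scalerA addrA -scalerDl.
split.
- have E : lines_scheme A B W N = [set sform eta' * tform b0;
      sform xi * tform b0 + sform eta' * tform b1].
    rewrite /lines_scheme !(line_form_dual _ _ _ fr) -/p wA pA.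
    by rewrite mul0mx trmx0 tform0 mulr0 add0r.
  have [ZE u m1 m2] := double_line frame frE bb.
  rewrite /double_line_type E; do 2 eexists; split; [exact: ZE|exact: u| |exact: m1|exact: m2].
  split; first by apply: line_P1_curve => //; exact: independent_neq0 bb.
  apply: (@cross_P1_curve 0 0) => [j|j|u' _]; [exact: cst_homog|exact: cst_homog|].
  exact: cst_cross_neq0.
- exact: (line_tangent pA c1A c2A c2B free3 pW Wc).
- apply/(in_conic_planeP AB pA c1A c2A c2B free3); apply/row_subP => i.
  have [x [y ->]] := Wc _ (row_sub i W).
  have -> : x *: p + y *: c1 = row3 x y 0 *m \matrix_i tnth [tuple p; c1; c2] i.
    by rewrite mul_row3 scale0r addr0.
  exact: submxMl.
Qed.

Lemma tangent_at_case (u1 : 'rV[K]_2) : tangent_at A B W p ->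
  exists c, u1 *m W *m A = c *: (p *m B).
Proof.
move=> tan; have [x [y ->]] := tangent_line_combination AB pA c1A c2A c2B free3 (submxMl u1 W) tan.
by exists y; rewrite mulmxDl -!scalemxAl pA scaler0 add0r c1A.
Qed.

(** After subtracting [b] times p from w one has w B = a (w A): then w is a second point of the
    conic, so W lies in its plane. *)
Lemma secant_case (u1 : 'rV[K]_2) xi eta a b : dual_frame u0 u1 xi eta ->
  independent (u1 *m W *m A) (p *m B) ->
  u1 *m W *m B = a *: (u1 *m W *m A) + b *: (p *m B) ->
  crossing_lines_type (lines_scheme A B W N) /\ in_conic_plane A B W.
Proof.
move=> fr0 ind0 wB0; have fr := dual_frame_shift b fr0.
move: fr; set v1 := u1 - b *: u0; set xi' := xi + b *: eta => fr.
have vA : v1 *m W *m A = u1 *m W *m A.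
  by rewrite !mulmxBl -!scalemxAl -/p pA scaler0 subr0.
have vB : v1 *m W *m B = a *: (v1 *m W *m A).
  by rewrite vA !mulmxBl -!scalemxAl -/p wB0 addrK.
have ind : independent (v1 *m W *m A) (p *m B) by rewrite vA.
clearbody v1 xi'.
have frE := dual_frameE fr; have [frame _] := fr.
pose a1 : 'cV[K]_3 := (v1 *m W *m A *m N^T)^T; pose b0 : 'cV[K]_3 := (p *m B *m N^T)^T.
have ab : independent a1 b0.
  move=> x y /(congr1 trmx); rewrite !linearZ /= !trmxK => e; apply: ind.
  have := @killed_combination v1 u0 x 0 (- y); rewrite /= scale0r addr0 -/p !scaleNr.
  rewrite mulmxBl -!scalemxAl e subrr => /(_ erefl)/eqP.
  by rewrite subr_eq0 => /eqP.
split; last first.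
  move=> U CU; have pU : (p <= U)%MS.
    apply: CU; split=> //; exists 1, 0; rewrite scale1r scale0r subr0; split=> //.
    by rewrite xpair_eqE oner_eq0.
  have vU : (v1 *m W <= U)%MS.
    apply: CU; split; first by rewrite mulmx_free_eq0 //; have [_ + _ _] := frame_neq0 frame; apply.
    exists a, 1; split; first by rewrite xpair_eqE oner_eq0 andbF.
    by rewrite mulmxBr scale1r -scalemxAr vB subrr.
  apply/row_subP => i; have [x [y ->]] := W_rows fr (row_sub i W).
  by apply: addmx_sub; apply: scalemx_sub.
(* In the basis A, B - a A of the pencil the equations separate into eta (w A) and xi (p B). *)
have det : (1 : K) * (-1) - (- a) * 0 != 0.
  by rewrite mulr0 subr0 mul1r oppr_eq0 oner_eq0.
apply: (crossing_lines_type_eq (lines_scheme_change A B W N det)).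
have E : lines_scheme (1 *: A - 0 *: B) (- a *: A - -1 *: B) W N =
    [set sform eta * tform a1; sform xi' * tform b0].
  rewrite scale1r scale0r subr0 [- a *: A - _](_ : _ = B - a *: A); last first.
    by rewrite scaleN1r opprK scaleNr addrC.
  rewrite /lines_scheme !(line_form_dual _ _ _ fr) -/p pA.
  rewrite mul0mx trmx0 tform0 mulr0 add0r !mulmxBr -!scalemxAr vB pA subrr.
  by rewrite scaler0 subr0 mul0mx trmx0 tform0 mulr0 addr0.
have [ZE u m1 m2 m3] := crossing_lines frame frE ab.
have [u0' u1' _ _] := frame_neq0 frame.
rewrite /crossing_lines_type E; do 3 eexists; split; [exact: ZE|exact: u| |by split; eassumption].
split.
- by apply: line_P1_curve => //; exact: independent_neq0 (independentC ab).
- by apply: line_P1_curve => //; exact: independent_neq0 ab.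
- apply: (@cross_P1_curve 0 0) => [j|j|u' _]; [exact: cst_homog|exact: cst_homog|].
  exact: cst_cross_neq0.
Qed.

Lemma transversal_case (u1 : 'rV[K]_2) xi eta : dual_frame u0 u1 xi eta ->
  (forall x y z, x *: (u1 *m W *m A) = y *: (p *m B) + z *: (u1 *m W *m B) ->
     [/\ x = 0, y = 0 & z = 0]) ->
  line_and_graph_type (lines_scheme A B W N) /\ ~ in_conic_plane A B W.
Proof.
move=> fr ind; split; last first.
  move=> /(in_conic_planeP AB pA c1A c2A c2B free3) WT.
  have /submxP[r] := submx_trans (submxMl u1 W) WT.
  rewrite mul_rows3; move: (r 0 0) (r 0 1) (r 0 (1 + 1)) => x y z wE.
  have wA : u1 *m W *m A = y *: (p *m B) + z *: (c1 *m B).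
    by rewrite wE !mulmxDl -!scalemxAl pA c1A c2A scaler0 add0r.
  have wB : u1 *m W *m B = x *: (p *m B) + y *: (c1 *m B).
    by rewrite wE !mulmxDl -!scalemxAl c2B scaler0 addr0.
  (* Eliminating c1 B gives y (w A) = (y^2 - z x) (p B) + z (w B). *)
  have [y0 _ z0] : [/\ y = 0, y ^+ 2 - z * x = 0 & z = 0].
    apply: ind; rewrite wA wB !scalerDr !scalerA scalerBl -expr2.
    by rewrite [z * y]mulrC addrA subrK.
  have [] := ind 1 0 0; first by rewrite wA y0 z0 !scale0r !addr0 scaler0.
  by move/eqP; rewrite oner_eq0.
have frE := dual_frameE fr; have [frame _] := fr.
pose a1 : 'cV[K]_3 := (u1 *m W *m A *m N^T)^T; pose b0 : 'cV[K]_3 := (p *m B *m N^T)^T.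
pose b1 : 'cV[K]_3 := (u1 *m W *m B *m N^T)^T.
have ab x y z : x *: a1 = y *: b0 + z *: b1 -> [/\ x = 0, y = 0 & z = 0].
  move=> /(congr1 trmx); rewrite linearD !linearZ /= !trmxK => e; apply: ind.
  apply/eqP; rewrite -subr_eq0; apply/eqP.
  apply: killed.
    by rewrite mulmxBl mulmxDl -!scalemxAl !formW // !scaler0 addr0 subrr.
  by rewrite mulmxBl mulmxDl -!scalemxAl e subrr.
have E : lines_scheme A B W N = [set sform eta * tform a1;
    sform xi * tform b0 + sform eta * tform b1].
  rewrite /lines_scheme !(line_form_dual _ _ _ fr) -/p pA.
  by rewrite mul0mx trmx0 tform0 mulr0 add0r.
have [ZE u m1 m2] := line_and_graph frame frE ab.
rewrite /line_and_graph_type E; do 2 eexists; split; [exact: ZE|exact: u| |exact: m1|exact: m2].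
split.
  apply: line_P1_curve => //; apply/eqP => b00.
  have [] := ab 0 1 0; first by rewrite b00 scaler0 !scale0r addr0.
  by move=> _ /eqP; rewrite oner_eq0.
apply: (@cross_P1_curve 0 1) => [j|j|u' u'0]; [exact: cst_homog|exact: lin_homog|].
exact: line_and_graph_neq0.
Qed.

End BasePoint.
End Point.
End Classification.

(** * The four orbits *)

Section Orbits.
Variable K : numClosedFieldType.

Lemma classify_kernel_point (A B : 'M[K]_5) W N (u0 : 'rV[K]_2) :
  on_X A B W -> col_mx W N \in unitmx -> pencil4 A B -> u0 != 0 ->
  u0 *m W *m A = 0 ->
  [\/ [/\ double_line_type (lines_scheme A B W N), tangent_to_conic A B W &
          in_conic_plane A B W],
      [/\ crossing_lines_type (lines_scheme A B W N), in_conic_plane A B W &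
          ~ tangent_at A B W (u0 *m W)] |
      [/\ line_and_graph_type (lines_scheme A B W N), ~ in_conic_plane A B W &
          ~ tangent_at A B W (u0 *m W)]].
Proof.
move=> WX WN AB u00 pA; have [rW _ _] := WX.
have p0 : u0 *m W != 0 by rewrite mulmx_free_eq0 // /row_free rW.
have [c1 [c2 [c1A c2A c2B free3]]] := kernel_chain AB p0 pA.
have [u1 [xi [eta fr]]] := dual_frame_exists u00.
have [[c wA]|nc] := pselect (exists c, u1 *m W *m A = c *: (u0 *m W *m B)).
  by constructor 1; exact: (tangent_case WX WN AB u00 pA c1A c2A c2B free3 fr wA).
have nt : ~ tangent_at A B W (u0 *m W).
  by move=> t; apply: nc; exact: (tangent_at_case AB pA c1A c2A c2B free3 u1 t).
have ind : independent (u1 *m W *m A) (u0 *m W *m B).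
  move=> x y e; have [x0|x0] := eqVneq x 0; last first.
    by case: nc; exists (y / x); apply: (scalerI x0); rewrite e scalerA mulrC divfK.
  split=> //; move: e; rewrite x0 scale0r => /esym/eqP.
  by rewrite scaler_eq0 (negPf (pencil_ker_neq0 AB p0 pA)) orbF => /eqP.
have [[a [b wB]]|nab] := pselect (exists a b, u1 *m W *m B =
    a *: (u1 *m W *m A) + b *: (u0 *m W *m B)).
  have [ct WP] := secant_case WX WN u00 pA fr ind wB.
  by constructor 2.
have ind3 x y z : x *: (u1 *m W *m A) = y *: (u0 *m W *m B) + z *: (u1 *m W *m B) ->
    [/\ x = 0, y = 0 & z = 0].
  move=> e; have [z0|z0] := eqVneq z 0.
    by move: e; rewrite z0 scale0r addr0 => /ind[-> ->].
  case: nab; exists (x / z), (- (y / z)); apply: (scalerI z0).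
  rewrite scalerDr !scalerA mulrN ![z * (_ / z)]mulrC !divfK // scaleNr.
  by rewrite e addrAC subrr add0r.
have [gt WP] := transversal_case WX WN AB u00 pA c1A c2A c2B free3 fr ind3.
by constructor 3.
Qed.

Lemma on_X_change (A B : 'M[K]_5) W l m l' m' : on_X A B W ->
  on_X (l *: A - m *: B) (l' *: A - m' *: B) W.
Proof.
move=> [rW hA hB]; split=> // p q pW qW; rewrite mulmxBr mulmxBl -!scalemxAr -!scalemxAl;
  by rewrite hA // hB // !scaler0 subr0.
Qed.

(** The trichotomy of [classify_kernel_point], carried over to an arbitrary point of the conic. The
    last two cases exclude tangency only at the given [p]; for the first orbit [p] is taken to be
    the point of tangency. *)
Lemma classify_conic_point (A B : 'M[K]_5) W N p :
  on_X A B W -> col_mx W N \in unitmx -> pencil4 A B -> center_conic A B p ->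
  (p <= W)%MS ->
  [\/ [/\ double_line_type (lines_scheme A B W N), tangent_to_conic A B W &
          in_conic_plane A B W],
      [/\ crossing_lines_type (lines_scheme A B W N), in_conic_plane A B W &
          ~ tangent_at A B W p] |
      [/\ line_and_graph_type (lines_scheme A B W N), ~ in_conic_plane A B W &
          ~ tangent_at A B W p]].
Proof.
move=> WX WN AB [p0 [l [m [lm pA]]]] /submxP[u0 pE].
(* Complete the member that kills [p] to a basis of the pencil; the conic, its plane, its tangents
   and Z_x do not change. *)
have [l' [m' det]] : exists l' m', l * m' - l' * m != 0.
  have [l0|l0] := eqVneq l 0; last by exists 0, 1; rewrite mulr1 mul0r subr0.
  exists 1, 0; rewrite l0 mul0r mul1r sub0r oppr_eq0.
  by apply: contra_neq lm => ->; rewrite l0.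
have CC := center_conic_change A B det.
have tE : tangent_to_conic (l *: A - m *: B) (l' *: A - m' *: B) W = tangent_to_conic A B W.
  by rewrite /tangent_to_conic CC.
have aE : tangent_at (l *: A - m *: B) (l' *: A - m' *: B) W p = tangent_at A B W p.
  by rewrite /tangent_at CC.
have iE : in_conic_plane (l *: A - m *: B) (l' *: A - m' *: B) W = in_conic_plane A B W.
  by rewrite /in_conic_plane CC.
have SE := lines_scheme_change A B W N det.
have u00 : u0 != 0 by apply: contra_neq p0 => u00; rewrite pE u00 mul0mx.
rewrite pE in pA; have := classify_kernel_point (on_X_change l m l' m' WX) WN
  (pencil4_change det AB) u00 pA.
rewrite -pE tE aE iE => -[[t ? ?]|[t ? ?]|[t ? ?]].
- by constructor 1; split=> //; exact: double_line_type_eq SE t.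
- by constructor 2; split=> //; exact: crossing_lines_type_eq SE t.
- by constructor 3; split=> //; exact: line_and_graph_type_eq SE t.
Qed.

Lemma conic_plane_line_meet (A B : 'M[K]_5) (W : 'M[K]_(2, 5)) : pencil4 A B ->
  \rank W = 2%N -> in_conic_plane A B W ->
  exists2 q, center_conic A B q & (q <= W)%MS.
Proof.
move=> AB rW.
have : kermx A != 0 by rewrite -mxrank_eq0 mxrank_ker (pencil4_rank AB).
case/rowV0Pn => p /sub_kermxP pA p0.
have [c1 [c2 [c1A c2A c2B free3]]] := kernel_chain AB p0 pA.
exact: (conic_plane_meet AB pA c1A c2A c2B free3 rW).
Qed.

Lemma set_of_two (T : choiceType) (V1 V2 : T) : [set` [:: V1; V2]] = [set V1; V2].
Proof.
apply/seteqP; split=> x /=; rewrite !inE; first by case/orP => /eqP ->; [left|right].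
by case=> ->; rewrite eqxx ?orbT.
Qed.

Lemma set_of_three (T : choiceType) (V1 V2 V3 : T) :
  [set` [:: V1; V2; V3]] = [set V1; V2; V3].
Proof.
apply/seteqP; split=> x /=; rewrite !inE.
  by case/or3P => /eqP ->; [left; left|left; right|right].
by case=> [[]|] ->; rewrite eqxx ?orbT.
Qed.

Section LinesThroughPoint.
Variables (A B : 'M[K]_5) (W : 'M[K]_(2, 5)) (N : 'M[K]_(3, 5)).
Hypotheses (WX : on_X A B W) (WN : col_mx W N \in unitmx) (AB : pencil4 A B).
Variables L1 L2 : set (bipoint K).
Hypotheses (L1f : fiber_line L1) (L2f : fiber_pr2 L2).
Let Z := lines_scheme A B W N.
Let rW : \rank W = 2%N. Proof. by case: WX. Qed.

Lemma lines_scheme_cycle : pure_dim (zeros Z) 1 /\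
  exists2 c, fundamental_cycle Z c & num_equiv c [:: (2, L1); (1, L2)].
Proof.
have [[p [Cp pW]]|nC] := pselect (exists p, center_conic A B p /\ (p <= W)%MS).
  have [[t _ _]|[t _ _]|[t _ _]] := classify_conic_point WX WN AB Cp pW.
  - exact: double_line_cycle t.
  - exact: crossing_lines_cycle t.
  - exact: line_and_graph_cycle t.
apply: smooth_graph_cycle => //; apply: smooth_type => // q Cq qW.
by apply: nC; exists q.
Qed.

Lemma orbit1_lines : orbit1 A B W -> exists V1 V2,
  [/\ components (zeros Z) = [set V1; V2] /\ V1 <> V2,
      rational_curve V1 /\ rational_curve V2,
      num_equiv [:: (1, V1)] [:: (1, L1)], multiplicity Z V1 2 &
      num_equiv [:: (1, V2)] [:: (1, L2)]].
Proof.
move=> [_ [p [Cp pW t]]].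
have [[d _ _]|[_ _ /(_ t)//]|[_ _ /(_ t)//]] := classify_conic_point WX WN AB Cp pW.
have [V1 [V2 [ZE u [c1 c2] m1 _]]] := d.
exists V1, V2; split=> //.
- by rewrite ZE set_of_two; split=> //; move: u; rewrite /= inE andbT => /eqP.
- by split; [exact: P1_curve_rational c1|exact: P1_curve_rational c2].
- by apply: num_equiv_single (fiber_line_param L1f); exact: c1.1.
- by apply: num_equiv_single (fiber_pr2_param L2f); exact: c2.1.
Qed.

Lemma orbit2_lines : orbit2 A B W -> exists V1 V2 V3,
  [/\ components (zeros Z) = [set V1; V2; V3] /\ [/\ V1 <> V2, V1 <> V3 & V2 <> V3],
      [/\ rational_curve V1, rational_curve V2 & rational_curve V3],
      num_equiv [:: (1, V1)] [:: (1, L1)], num_equiv [:: (1, V2)] [:: (1, L1)] &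
      num_equiv [:: (1, V3)] [:: (1, L2)]].
Proof.
move=> [_ WP nt]; have [p Cp pW] := conic_plane_line_meet AB rW WP.
have [[_ /nt//]|[d _ _]|[_ /(_ WP)//]] := classify_conic_point WX WN AB Cp pW.
have [V1 [V2 [V3 [ZE u [c1 c2 c3] _]]]] := d.
exists V1, V2, V3; split.
- rewrite ZE set_of_three; split=> //; move: u; rewrite /= !inE negb_or andbT.
  by case/andP => /andP[/eqP ? /eqP ?] /eqP.
- split; [exact: P1_curve_rational c1|exact: P1_curve_rational c2|].
  exact: P1_curve_rational c3.
- by apply: num_equiv_single (fiber_line_param L1f); exact: c1.1.
- by apply: num_equiv_single (fiber_line_param L1f); exact: c2.1.
- by apply: num_equiv_single (fiber_pr2_param L2f); exact: c3.1.
Qed.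

Lemma orbit3_lines : orbit3 A B W -> exists V1 V2,
  [/\ components (zeros Z) = [set V1; V2] /\ V1 <> V2,
      rational_curve V1 /\ rational_curve V2,
      num_equiv [:: (1, V1)] [:: (1, L1)] &
      num_equiv [:: (1, V2)] [:: (1, L1); (1, L2)]].
Proof.
move=> [_ [p Cp pW] nP].
have [[_ _ /nP//]|[_ /nP//]|[d _ _]] := classify_conic_point WX WN AB Cp pW.
have [V1 [V2 [ZE u [c1 c2] m1 _]]] := d.
exists V1, V2; split=> //.
- by rewrite ZE set_of_two; split=> //; move: u; rewrite /= inE andbT => /eqP.
- by split; [exact: P1_curve_rational c1|exact: P1_curve_rational c2].
- by apply: num_equiv_single (fiber_line_param L1f); exact: c1.1.
- apply: (num_equiv_combination (kl := fun=> (1, 1)%N)) => // [t||].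
  + by rewrite mem_seq1 => /eqP ->; exact: c2.1.
  + by rewrite big_seq1.
  + by rewrite big_seq1.
Qed.

Lemma orbit4_lines : orbit4 A B W -> scheme_isomorphic_P1 Z.
Proof.
move=> [_ WP0]; apply: (smooth_type WX WN AB _).1 => q Cq qW.
case: (Cq) => /eqP[]; apply: WP0 => // U CU; exact: CU.
Qed.

End LinesThroughPoint.
End Orbits.

Theorem theorem1p1 (R : realType) (A B : 'M[R[i]]_5)
    (W : 'M[R[i]]_(2, 5)) (N : 'M[R[i]]_(3, 5)) (L1 L2 : set (bipoint R[i])) :
  general_section A B -> on_X A B W -> col_mx W N \in unitmx ->
  fiber_line L1 -> fiber_pr2 L2 ->
  let Z := lines_scheme A B W N in
  [/\ pure_dim (zeros Z) 1 /\
      (exists2 c, fundamental_cycle Z c & num_equiv c [:: (2, L1); (1, L2)]),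
      orbit1 A B W -> exists V1 V2,
        [/\ components (zeros Z) = [set V1; V2] /\ V1 <> V2,
            rational_curve V1 /\ rational_curve V2,
            num_equiv [:: (1, V1)] [:: (1, L1)], multiplicity Z V1 2 &
            num_equiv [:: (1, V2)] [:: (1, L2)]],
      orbit2 A B W -> exists V1 V2 V3,
        [/\ components (zeros Z) = [set V1; V2; V3] /\
              [/\ V1 <> V2, V1 <> V3 & V2 <> V3],
            [/\ rational_curve V1, rational_curve V2 & rational_curve V3],
            num_equiv [:: (1, V1)] [:: (1, L1)],
            num_equiv [:: (1, V2)] [:: (1, L1)] &
            num_equiv [:: (1, V3)] [:: (1, L2)]],
      orbit3 A B W -> exists V1 V2,
        [/\ components (zeros Z) = [set V1; V2] /\ V1 <> V2,
            rational_curve V1 /\ rational_curve V2,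
            num_equiv [:: (1, V1)] [:: (1, L1)] &
            num_equiv [:: (1, V2)] [:: (1, L1); (1, L2)]] &
      orbit4 A B W -> scheme_isomorphic_P1 Z].
Proof.
move=> /general_pencil4 AB WX WN L1f L2f Z; split.
- exact: lines_scheme_cycle.
- exact: orbit1_lines.
- exact: orbit2_lines.
- exact: orbit3_lines.
- exact: orbit4_lines.
Qed.
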